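(* Let $0<p<\infty$ and $\omega\in\mathcal{I}nv$. Let $\{z_k\}$ be an arbitrary subset of the zero set of a function $f\in A^p_\omega$, $f\not\equiv0$, and let $$H(z)=\prod_{k}B_{k}(z)\left(2-B_{k}(z)\right),\quad B_k=\frac{z_k}{|z_k|}\varphi_{z_k},$$ with the convention $z_k/|z_k|=1$ if $z_k=0$. Then there exists a constant $C=C(\omega)>0$ (depending only on $\omega$) such that $\|f/H\|_{A^p_\omega}^p\le C\|f\|_{A^p_\omega}^p$. In particular, each subset of an $A^p_\omega$-zero set is an $A^p_\omega$-zero set.
   Context: $\mathbb{D}$ is the open unit disc of $\mathbb{C}$ and $dA=\frac{dx\,dy}{\pi}$. A weight is a function $\omega:\mathbb{D}\to(0,\infty)$ integrable over $\mathbb{D}$ (not necessarily radial or continuous). $A^p_\omega$ consists of analytic functions $f$ in $\mathbb{D}$ with $\|f\|_{A^p_\omega}^p=\int_{\mathbb{D}}|f|^p\omega\,dA<\infty$. For $a\in\mathbb{D}$ let $\varphi_a(z)=\frac{a-z}{1-\overline{a}z}$, and for $r\in(0,1)$ let $\Delta(a,r)=\{z\in\mathbb{D}:|\varphi_a(z)|<r\}$. The class $\mathcal{I}nv$ of invariant weights consists of weights $\omega$ such that for some (equivalently for all) $r\in(0,1)$ there is a constant $C=C(r)\ge1$ with $C^{-1}\omega(a)\le\omega(z)\le C\omega(a)$ for all $a\in\mathbb{D}$ and $z\in\Delta(a,r)$. Zeros are counted with multiplicity (zero sets and their subsets are sequences in which a point may be repeated up to its multiplicity). A sequence $\{z_k\}$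 in $\mathbb{D}$ is an $A^p_\omega$-zero set if there is a function in $A^p_\omega$ that vanishes precisely on the points $z_k$ (with multiplicity) and nowhere else.
   Formalization: The factor B_k is taken with the constant conj(z_k)/|z_k| instead of the printed z_k/|z_k|; with the printed one the product H diverges in general, e.g. at 0 for z_k = i(1-2^{-k}), where B_k(0)(2-B_k(0)) tends to -3. *)

(* Defs.v *)
From HB Require Import structures.
From mathcomp Require Import all_boot all_order all_algebra.
From mathcomp Require Import all_classical all_reals all_analysis.
From mathcomp.real_closed Require Import complex.

Set Implicit Arguments.
Unset Strict Implicit.
Unset Printing Implicit Defensive.

Import Order.TTheory GRing.Theory Num.Theory.
Import numFieldNormedType.Exports.

Local Open Scope classical_set_scope.
Local Open Scope card_scope.
Local Open Scope ring_scope.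

(* The real-valued modulus: `|z| itself lives in R[i]. *)
Notation modulus := ComplexField.Normc.normc.

Section WeightedBergman.
Variable R : realType.

(* R[i] receives its topology through the alias R[i]^o; functions and
   sequences whose convergence matters have codomain R[i]^o. *)
Local Notation C := R[i].

Definition unit_disc : set C := [set z | modulus z < 1].

Definition analytic_in_disc (f : C -> C) : Prop :=
  forall a, unit_disc a ->
    exists2 r : R, 0 < r &
    exists c : nat -> C^o, forall z, modulus (z - a) < r ->
      series (fun n => c n * (z - a) ^+ n : C^o) @ \oo --> (f z : C^o).

Local Notation plane_measure :=
  (@lebesgue_measure R \x @lebesgue_measure R)%E.

Definition plane_disc : set (measurableTypeR R * measurableTypeR R) :=
  [set u | unit_disc (u.1 +i* u.2)%C].

(* dA = dx dy / pi *)
Definition disc_integral (F : C -> \bar R) : \bar R :=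
  ((pi^-1 : R)%:E *
   \int[plane_measure]_(u in plane_disc) F (u.1 +i* u.2)%C)%E.

Definition weight (w : C -> R) : Prop :=
  (forall z, unit_disc z -> 0 < w z) /\
  plane_measure.-integrable plane_disc (fun u => (w (u.1 +i* u.2)%C)%:E).

Definition bergman_norm_pow (p : R) (w : C -> R) (f : C -> C) : \bar R :=
  disc_integral (fun z => (modulus (f z) `^ p * w z)%:E).

Definition in_bergman (p : R) (w : C -> R) (f : C -> C) : Prop :=
  analytic_in_disc f /\ (bergman_norm_pow p w f < +oo)%E.

Definition disc_aut (a z : C) : C := (a - z) / (1 - conjc a * z).

Definition pseudo_disc (a : C) (r : R) : set C :=
  [set z | unit_disc z /\ modulus (disc_aut a z) < r].

Definition invariant_weight (w : C -> R) : Prop :=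
  weight w /\
  exists2 r : R, 0 < r < 1 &
  exists2 K : R, 1 <= K &
    forall a z, unit_disc a -> pseudo_disc a r z ->
      K^-1 * w a <= w z <= K * w a.

(* A finite or infinite sequence of points is a term of nat -> option C;
   indices sent to None carry no point.  The multiplicity of a in such a
   sequence is the cardinality of the following set of indices. *)
Definition occurrences (z : nat -> option C) (a : C) : set nat :=
  [set k | z k = Some a].

Definition zero_order (f : C -> C) (a : C) (n : nat) : Prop :=
  exists2 h : C -> C, analytic_in_disc h /\ h a != 0 &
    forall z, unit_disc z -> f z = (z - a) ^+ n * h z.

Definition in_disc (z : nat -> option C) : Prop :=
  forall k a, z k = Some a -> unit_disc a.

Definition zero_subset (f : C -> C) (z : nat -> option C) : Prop :=
  in_disc z /\
  forall a, unit_disc a ->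
    exists2 n, zero_order f a n & occurrences z a #<= `I_n.

Definition zero_sequence (f : C -> C) (z : nat -> option C) : Prop :=
  in_disc z /\
  forall a, unit_disc a ->
    exists2 n, zero_order f a n & occurrences z a #= `I_n.

Definition bergman_zero_set (p : R) (w : C -> R) (z : nat -> option C) : Prop :=
  exists2 f, in_bergman p w f & zero_sequence f z.

Definition subset_with_mult (z' z : nat -> option C) : Prop :=
  forall a, occurrences z' a #<= occurrences z a.

(* The unimodular constant is conjc a / |a| = |a| / a, so that B_a(0) = |a|
   and B_a tends to 1 locally uniformly as |a| tends to 1.  With a / |a| in
   its place, B_a(0) = a^2 / |a|, and the product below diverges for instance
   when the points accumulate only at the imaginary unit. *)
Definition blaschke_factor (a z : C) : C :=
  (if a == 0 then 1 else conjc a / (modulus a)%:C%C) * disc_aut a z.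

Definition horowitz_partial (z : nat -> option C) (x : C) (n : nat) : C^o :=
  \prod_(k < n)
    (if z k is Some a then blaschke_factor a x * (2 - blaschke_factor a x)
     else 1).

Definition horowitz_product (z : nat -> option C) (x : C) : C :=
  lim (horowitz_partial z x @ \oo).

End WeightedBergman.

(* Main.v *)
From HB Require Import structures.
Require Import Defs.
From mathcomp Require Import all_boot all_order all_algebra.
From mathcomp Require Import finmap.
From mathcomp Require Import all_classical all_reals all_analysis.
From mathcomp.real_closed Require Import complex.
From mathcomp Require Import measurable_realfun ring lra.
Import Order.TTheory GRing.Theory Num.Theory.
Import numFieldNormedType.Exports.
Local Open Scope classical_set_scope.
Local Open Scope ring_scope.
Set Implicit Arguments.
Unset Strict Implicit.
Unset Printing Implicit Defensive.

(** Write B_k for the normalised Blaschke factor of z_k, y_k for |B_k(a)| at a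
    point a of the disc, and f = G_n B_0 ... B_(n-1).  Everything rests on a
    pointwise estimate (quotient_bound), with C depending on w only:

      |G_n(a)|^p w(a) <= C (prod_(k < n) (2 - y_k))^p S(a),

    where S(a) is the integral of |f|^p w against a positive kernel in (a, v)
    that has mass 4 as a function of a.  As |2 - B_k(a)| >= 2 - y_k, dividing G_n
    by the factors 2 - B_k, letting n tend to infinity and integrating in a with
    Tonelli's theorem give the norm inequality, with a constant free of p.

    The estimate comes from Jensen's formula on all the pseudohyperbolic circles
    about a of radius s_i = 1 - 4^-(i+1) at once.  On each of them the maximum
    principle yields a point xi with |G_n(a)| prod max(y_k, s_i) <= |f(xi)|
    (jensen_max).  An invariant weight grows at most by a factor B^(i+1) between a
    and xi (weight_growth), and the sub-mean value property on a disc about xi where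
    w is almost constant bounds |f(xi)|^p w(xi) by a constant times 4^(4(i+1)) S(a)
    (area_mean, level_estimate).  The geometric mean of these inequalities with
    weights 2^-(i+1) has a finite constant, since the sum of i 2^-i is finite, and

      sum_i 2^-(i+1) ln max(y, s_i) >= - ln (2 - y)    for 0 <= y <= 1

    (sum_ln_max_ge), which turns the products of maxima into the factors 2 - y_k.

    Where f(a) is not 0 the same estimate bounds prod y_k (2 - y_k) from below,
    hence sum (1 - |z_k|)^2 is finite (gap_sum_bounded).  The k-th factor of the
    Horowitz product is 1 - (1 - B_k)^2, so the product converges; the quotients
    G_n / prod (2 - B_k) are locally bounded by the estimate and converge locally
    uniformly to g with f = g H (quot_limit).  For the assertion on zero sets the
    division is applied to the complementary points: near a point b a tail of the
    product has modulus between 1/2 and 2, so the order of g at b is the order of f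
    minus the number of occurrences of b (limit_ord).

    Analyticity is handled through hol_at: approximation by a polynomial up to an
    error O(|t|^n), for every n.  This is stable under algebraic operations,
    composition and division by a zero, and it implies a discrete subharmonicity of
    |f|^p from which follow the maximum principle, the expansion in power series
    (analyticP) and, with the invariance of Lebesgue measure under rotations, the
    sub-mean value property. *)

(** * The modulus and the automorphisms of the disc *)
Section Modulus.
Variable R : realType.
Local Notation C := R[i].
Implicit Types (a b c z t : C).

Lemma mod_ge0 z : 0 <= modulus z.
Proof. by case: z => x y; exact: sqrtr_ge0. Qed.

Lemma mod_sqr z : modulus z ^+ 2 = complex.Re z ^+ 2 + complex.Im z ^+ 2.
Proof. by case: z => x y /=; rewrite sqr_sqrtr ?addr_ge0 ?sqr_ge0. Qed.

Lemma modM a b : modulus (a * b) = modulus a * modulus b.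
Proof. exact: ComplexField.Normc.normcM. Qed.

Lemma mod0 : modulus (0 : C) = 0.
Proof. exact: ComplexField.Normc.normc0. Qed.

Lemma mod1 : modulus (1 : C) = 1.
Proof. exact: ComplexField.Normc.normc1. Qed.

Lemma mod_le0 z : (modulus z <= 0) = (z == 0).
Proof.
apply/idP/eqP => [h|->]; last by rewrite mod0.
by apply: ComplexField.Normc.eq0_normc; apply/eqP; rewrite eq_le h mod_ge0.
Qed.

Lemma mod_eq0 z : (modulus z == 0) = (z == 0).
Proof. by rewrite eq_le mod_ge0 andbT mod_le0. Qed.

Lemma mod_gt0 z : (0 < modulus z) = (z != 0).
Proof. by rewrite lt_neqAle eq_sym mod_eq0 mod_ge0 andbT. Qed.

Lemma modV z : modulus z^-1 = (modulus z)^-1.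
Proof. exact: ComplexField.Normc.normcV. Qed.

Lemma mod_div a b : modulus (a / b) = modulus a / modulus b.
Proof. by rewrite modM modV. Qed.

Lemma modX z n : modulus (z ^+ n) = modulus z ^+ n.
Proof. by elim: n => [|n ih]; rewrite ?expr0 ?mod1 // !exprS modM ih. Qed.

Lemma modN z : modulus (- z) = modulus z.
Proof. exact: normcN. Qed.

Lemma mod_subC a b : modulus (a - b) = modulus (b - a).
Proof. by rewrite -modN opprB. Qed.

Lemma modD_le a b : modulus (a + b) <= modulus a + modulus b.
Proof. exact: le_normcD. Qed.

Lemma modB_le a b : modulus (a - b) <= modulus a + modulus b.
Proof. by rewrite -(modN b); exact: modD_le. Qed.

Lemma mod_triangle a b c : modulus (a - c) <= modulus (a - b) + modulus (b - c).
Proof. by rewrite -[a - c](subrKA b); exact: modD_le. Qed.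

Lemma mod_sub_ge a b : modulus a - modulus b <= modulus (a - b).
Proof. by rewrite lerBlDr -{1}[a](subrK b) modD_le. Qed.

Lemma mod_prod (I : Type) (s : seq I) (P : pred I) (F : I -> C) :
  modulus (\prod_(i <- s | P i) F i) = \prod_(i <- s | P i) modulus (F i).
Proof. by apply: (big_morph (@modulus R)); [exact: modM|exact: mod1]. Qed.

Lemma mod_sum_le (I : Type) (s : seq I) (P : pred I) (F : I -> C) :
  modulus (\sum_(i <- s | P i) F i) <= \sum_(i <- s | P i) modulus (F i).
Proof.
elim/big_rec2 : _ => [|i x y _ h]; first by rewrite mod0.
by apply: (le_trans (modD_le _ _)); rewrite lerD2l.
Qed.

Lemma modJ z : modulus (conjc z) = modulus z.
Proof. by case: z => x y /=; rewrite sqrrN. Qed.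

Lemma modR (x : R) : modulus (x%:C)%C = `|x|.
Proof. by rewrite /= expr0n addr0 sqrtr_sqr. Qed.

Lemma mod_natr n : modulus (n%:R : C) = n%:R.
Proof.
have -> : (n%:R : C) = (n%:R%:C)%C by rewrite rmorph_nat.
by rewrite modR ger0_norm.
Qed.

Lemma mod_Re z : `|complex.Re z| <= modulus z.
Proof.
by rewrite -(ler_pXn2r (n:=2)) ?nnegrE ?mod_ge0 // mod_sqr -normrX ger0_norm
  ?sqr_ge0 // lerDl sqr_ge0.
Qed.

Lemma mod_Im z : `|complex.Im z| <= modulus z.
Proof.
by rewrite -(ler_pXn2r (n:=2)) ?nnegrE ?mod_ge0 // mod_sqr -normrX ger0_norm
  ?sqr_ge0 // lerDr sqr_ge0.
Qed.

Lemma mod_le_ReIm z : modulus z <= `|complex.Re z| + `|complex.Im z|.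
Proof.
rewrite -(ler_pXn2r (n:=2)) ?nnegrE ?mod_ge0 ?addr_ge0 // mod_sqr sqrrD.
rewrite -!normrX !(@ger0_norm _ (_ ^+ 2)) ?sqr_ge0 // addrAC lerDl.
by rewrite mulrn_wge0 // mulr_ge0.
Qed.

Lemma conj_mul z : conjc z * z = ((modulus z ^+ 2)%:C)%C.
Proof.
rewrite mod_sqr; case: z => x y; apply/eqP; rewrite eq_complex /=.
by apply/andP; split; apply/eqP; ring.
Qed.

Lemma unit_disc0 : unit_disc (0 : C).
Proof. by rewrite -[unit_disc 0]/(is_true (modulus (0 : C) < 1)) mod0. Qed.

Lemma one_sub_sqr_bounds (t : R) : 0 <= t -> t < 1 -> 1 - t <= 1 - t ^+ 2 <= 2 * (1 - t).
Proof.
move=> t0 t1; rewrite lerD2l lerN2 expr2 ler_piMl ?(ltW t1) //=.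
by rewrite -subr_ge0 (_ : _ - _ = (1 - t) ^+ 2) ?sqr_ge0 //; ring.
Qed.

(** The source of all inequalities on the disc automorphisms: dividing by the
    left-hand side gives 1 - |phi_a(z)|^2 as a product. *)
Lemma mobius_identity a z :
  modulus (1 - conjc a * z) ^+ 2 =
  (1 - modulus a ^+ 2) * (1 - modulus z ^+ 2) + modulus (a - z) ^+ 2.
Proof. by rewrite !mod_sqr; case: a z => [x y] [u v] /=; ring. Qed.

Lemma one_sub_conjM_ge a z : modulus a <= 1 ->
  1 - modulus z <= modulus (1 - conjc a * z).
Proof.
move=> a1; apply: le_trans (mod_sub_ge _ _); rewrite mod1 modM modJ lerD2l lerN2.
by rewrite ler_piMl ?mod_ge0.
Qed.

Lemma one_sub_conjM_ge' a z : modulus z <= 1 ->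
  1 - modulus a <= modulus (1 - conjc a * z).
Proof.
move=> z1; apply: le_trans (mod_sub_ge _ _); rewrite mod1 modM modJ lerD2l lerN2.
by rewrite ler_piMr ?mod_ge0.
Qed.

Lemma one_sub_conjM_le2 a z : modulus a <= 1 -> modulus z <= 1 ->
  modulus (1 - conjc a * z) <= 2.
Proof.
move=> a1 z1; apply: (le_trans (modB_le _ _)); rewrite mod1 modM modJ lerD2l.
by rewrite mulr_ile1 ?mod_ge0.
Qed.

Lemma one_sub_conjM_neq0 a z : modulus a < 1 -> modulus z <= 1 ->
  1 - conjc a * z != 0.
Proof.
move=> a1 z1; rewrite -mod_gt0; apply: lt_le_trans (one_sub_conjM_ge' _ z1).
by rewrite subr_gt0.
Qed.

Lemma disc_aut_identity a z : unit_disc a -> unit_disc z ->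
  1 - modulus (disc_aut a z) ^+ 2 =
  (1 - modulus a ^+ 2) * (1 - modulus z ^+ 2) / modulus (1 - conjc a * z) ^+ 2.
Proof.
move=> a1 z1; rewrite /disc_aut mod_div expr_div_n.
have h : modulus (1 - conjc a * z) != 0.
  by rewrite mod_eq0 one_sub_conjM_neq0 // ltW.
rewrite (_ : (1 - _) * _ = modulus (1 - conjc a * z) ^+ 2 - modulus (a - z) ^+ 2).
  by rewrite mulrBl divff // expf_neq0.
by rewrite mobius_identity addrK.
Qed.

Lemma disc_aut_in a z : unit_disc a -> unit_disc z -> unit_disc (disc_aut a z).
Proof.
move=> a1 z1; have h := disc_aut_identity a1 z1.
have : 0 < 1 - modulus (disc_aut a z) ^+ 2.
  rewrite h divr_gt0 ?mulr_gt0 ?subr_gt0 ?exprn_ilt1 ?mod_ge0 //;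
    by rewrite mod_gt0 one_sub_conjM_neq0 // ltW.
by rewrite subr_gt0 expr_lt1 ?mod_ge0.
Qed.

Lemma disc_autK a z : unit_disc a -> unit_disc z -> disc_aut a (disc_aut a z) = z.
Proof.
move=> a1 z1; have h := one_sub_conjM_neq0 a1 (ltW z1).
have h2 := one_sub_conjM_neq0 a1 (ltW a1).
have h3 : 1 - conjc a * disc_aut a z = (1 - conjc a * a) / (1 - conjc a * z).
  by rewrite /disc_aut; field.
by rewrite /disc_aut -/(disc_aut a z) h3 /disc_aut; field; rewrite h h2.
Qed.

Lemma disc_aut0 a : disc_aut a 0 = a.
Proof. by rewrite /disc_aut mulr0 !subr0 divr1. Qed.

Lemma one_sub_conjMC a z : conjc (1 - conjc a * z) = 1 - conjc z * a.
Proof.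
case: a z => [x y] [u v]; apply/eqP; rewrite eq_complex /=.
by apply/andP; split; apply/eqP; ring.
Qed.

Lemma mod_disc_autC a z : modulus (disc_aut a z) = modulus (disc_aut z a).
Proof.
rewrite /disc_aut !mod_div mod_subC; congr (_ / _).
by rewrite -(one_sub_conjMC a) modJ.
Qed.

(** By the identity for 1 - |phi_a(z)|^2 it suffices to compare the products on
    both sides, where only one denominator has to be recomputed. *)
Lemma disc_aut_invariant c a z : unit_disc c -> unit_disc a -> unit_disc z ->
  modulus (disc_aut (disc_aut c a) (disc_aut c z)) = modulus (disc_aut a z).
Proof.
move=> c1 a1 z1.
have ca := disc_aut_in c1 a1; have cz := disc_aut_in c1 z1.
have e (x y : R) : 0 <= x -> 0 <= y -> 1 - x ^+ 2 = 1 - y ^+ 2 -> x = y.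
  move=> x0 y0 /addrI/oppr_inj/eqP; rewrite eqrXn2 // => /eqP //.
apply: e; rewrite ?mod_ge0 // !disc_aut_identity //.
have h1 := one_sub_conjM_neq0 c1 (ltW a1).
have h2 := one_sub_conjM_neq0 c1 (ltW z1).
have h3 := one_sub_conjM_neq0 a1 (ltW z1).
have h4 := one_sub_conjM_neq0 c1 (ltW c1).
have h1' : 1 - c * conjc a != 0.
  by have := one_sub_conjM_neq0 a1 (ltW c1); rewrite mulrC.
have -> : 1 - conjc (disc_aut c a) * disc_aut c z =
   (1 - conjc c * c) * (1 - conjc a * z) /
     ((1 - c * conjc a) * (1 - conjc c * z)).
  rewrite /disc_aut rmorphM rmorphB /= fmorphV rmorphB rmorphM rmorph1 /= conjcK.
  by field; rewrite h1' h2.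
rewrite !mod_div !modM.
have -> : modulus (1 - c * conjc a) = modulus (1 - conjc c * a).
  by rewrite (mulrC c) -one_sub_conjMC modJ.
have -> : modulus (1 - conjc c * c) = 1 - modulus c ^+ 2.
  rewrite conj_mul -(rmorph1 (@real_complex R)) -rmorphB modR ger0_norm //.
  by rewrite subr_ge0 exprn_ile1 ?mod_ge0 // ltW.
have k1 : modulus (1 - conjc c * a) != 0 by rewrite mod_eq0.
have k2 : modulus (1 - conjc c * z) != 0 by rewrite mod_eq0.
have k3 : modulus (1 - conjc a * z) != 0 by rewrite mod_eq0.
have k4 : 1 - modulus c ^+ 2 != 0.
  by rewrite gt_eqF // subr_gt0 exprn_ilt1 ?mod_ge0.
by field; rewrite k1 k2 k3 k4.
Qed.
End Modulus.

(** * Local polynomial approximation *)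
Section Holomorphy.
Variable R : realType.
Local Notation C := R[i].
Implicit Types (a b c z t x : C) (f g h : C -> C) (F G : C -> C) (P Q : {poly C}).

Definition near0 (S : C -> Prop) :=
  exists2 r : R, 0 < r & forall t, modulus t < r -> S t.

Lemma near0W (S : C -> Prop) : (forall t, S t) -> near0 S.
Proof. by move=> h; exists 1. Qed.

Lemma near0_and (S T : C -> Prop) : near0 S -> near0 T -> near0 (fun t => S t /\ T t).
Proof.
move=> [r r0 hr] [s s0 hs]; exists (Num.min r s); first by rewrite lt_min r0.
by move=> t; rewrite lt_min => /andP[h1 h2]; split; [exact: hr|exact: hs].
Qed.

Lemma near0_sub (S T : C -> Prop) : near0 S -> (forall t, S t -> T t) -> near0 T.
Proof. by move=> [r r0 hr] h; exists r => // t /hr/h. Qed.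

Arguments near0_sub {S T}.

Lemma near0_at0 (S : C -> Prop) : near0 S -> S 0.
Proof. by move=> [r r0]; apply; rewrite mod0. Qed.

Lemma near0_lt (e : R) : 0 < e -> near0 (fun t => modulus t < e).
Proof. by exists e. Qed.

(** Approximation at 0 up to an error O(|t|^n); holding at every order, it serves
    as a local form of analyticity that needs neither series nor derivatives. *)
Definition approx (n : nat) (F : C -> C) :=
  exists P, exists2 K : R, 0 <= K &
    near0 (fun t => modulus (F t - P.[t]) <= K * modulus t ^+ n).

Definition hol_at f b := forall n, approx n (fun t => f (b + t)).

Lemma poly_bounded P :
  exists2 K : R, 0 <= K & forall t, modulus t <= 1 -> modulus P.[t] <= K.
Proof.
elim/poly_ind: P => [|P c [K K0 h]].
  by exists 0 => // t _; rewrite horner0 mod0.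
exists (K + modulus c); first by rewrite addr_ge0 ?mod_ge0.
move=> t t1; rewrite !hornerE; apply: (le_trans (modD_le _ _)); rewrite lerD2r.
by rewrite modM -[K]mulr1 ler_pM ?mod_ge0 // h.
Qed.

Lemma poly_vanish P : P.[0] = 0 -> exists Q, forall t, P.[t] = t * Q.[t].
Proof.
move=> /eqP /factor_theorem[Q ->]; exists Q => t.
by rewrite !hornerE subr0 mulrC.
Qed.

Lemma poly_lipschitz0 P : exists2 K : R, 0 <= K &
  forall t, modulus t <= 1 -> modulus (P.[t] - P.[0]) <= K * modulus t.
Proof.
have [|Q hQ] := @poly_vanish (P - P.[0]%:P); first by rewrite !hornerE subrr.
have [K K0 hK] := poly_bounded Q; exists K => // t t1.
have := hQ t; rewrite !hornerE => ->.
by rewrite modM mulrC ler_wpM2r ?mod_ge0 // hK.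
Qed.

Lemma approx_ext n F G : near0 (fun t => F t = G t) -> approx n F -> approx n G.
Proof.
move=> hE [P [K K0 hK]]; exists P, K => //.
by apply: (near0_sub (near0_and hE hK)) => t [<-].
Qed.

Lemma approx_poly n P : approx n (horner P).
Proof.
by exists P, 0 => //; apply: near0W => t; rewrite subrr mod0 mul0r.
Qed.

Lemma approx_bounded n F : approx n F ->
  exists2 K : R, 0 <= K & near0 (fun t => modulus (F t) <= K).
Proof.
move=> [P [K K0 hK]]; have [L L0 hL] := poly_bounded P.
exists (K + L); first exact: addr_ge0.
apply: (near0_sub (near0_and hK (near0_lt ltr01))) => t [h t1].
rewrite -[F t](subrK P.[t]); apply: (le_trans (modD_le _ _)).
apply: lerD; last exact/hL/ltW.
by apply: (le_trans h); rewrite ler_piMr // exprn_ile1 ?mod_ge0 // ltW.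
Qed.

Lemma approxD n F G : approx n F -> approx n G -> approx n (fun t => F t + G t).
Proof.
move=> [P [K K0 hK]] [Q [L L0 hL]]; exists (P + Q), (K + L); first exact: addr_ge0.
apply: (near0_sub (near0_and hK hL)) => t [h1 h2].
rewrite hornerD (_ : _ - _ = (F t - P.[t]) + (G t - Q.[t])); last by ring.
by apply: (le_trans (modD_le _ _)); rewrite mulrDl lerD.
Qed.

Definition approx_by (n : nat) (F : C -> C) P :=
  exists2 K : R, 0 <= K & near0 (fun t => modulus (F t - P.[t]) <= K * modulus t ^+ n).

Lemma approx_byM n F G P Q : approx_by n F P -> approx_by n G Q ->
  approx_by n (fun t => F t * G t) (P * Q).
Proof.
move=> aF; have [|A A0 hA] := @approx_bounded n F; first by exists P.
move: aF => [K K0 hK] [L L0 hL].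
have [B B0 hB] := poly_bounded Q.
exists (A * L + K * B); first by rewrite addr_ge0 ?mulr_ge0.
apply: (near0_sub (near0_and (near0_and hK hL) (near0_and hA (near0_lt ltr01)))).
move=> t [[h1 h2] [h3 t1]].
rewrite hornerM (_ : _ - _ = F t * (G t - Q.[t]) + (F t - P.[t]) * Q.[t]); last by ring.
apply: (le_trans (modD_le _ _)); rewrite !modM mulrDl; apply: lerD.
  by rewrite -mulrA ler_pM ?mod_ge0.
by rewrite mulrAC ler_pM ?mod_ge0 // hB // ltW.
Qed.

Lemma approxM n F G : approx n F -> approx n G -> approx n (fun t => F t * G t).
Proof. by move=> [P hP] [Q hQ]; exists (P * Q); exact: approx_byM. Qed.

Lemma approx_value0 n P F K : near0 (fun t => modulus (F t - P.[t]) <= K * modulus t ^+ n.+1) ->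
  P.[0] = F 0.
Proof.
move=> /near0_at0; rewrite mod0 exprS mul0r mulr0 mod_le0 subr_eq0.
by move=> /eqP.
Qed.

Lemma approx_lipschitz F : approx 1 F -> exists2 K : R, 0 <= K &
  near0 (fun t => modulus (F t - F 0) <= K * modulus t).
Proof.
move=> [P [K K0 hK]]; have e := approx_value0 hK.
have [L L0 hL] := poly_lipschitz0 P.
exists (K + L); first exact: addr_ge0.
apply: (near0_sub (near0_and hK (near0_lt ltr01))) => t [h t1].
apply: (le_trans (mod_triangle _ P.[t] _)); rewrite mulrDl.
by apply: lerD; [rewrite -[modulus t]expr1|rewrite -e hL // ltW].
Qed.

Lemma approx_nonzero F : approx 1 F -> F 0 != 0 ->
  near0 (fun t => modulus (F 0) / 2 <= modulus (F t)).
Proof.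
move=> /approx_lipschitz[K K0 hK] F0.
have e0 : 0 < modulus (F 0) / 2 / (K + 1).
  by rewrite !divr_gt0 ?mod_gt0 // ltr_wpDl.
apply: (near0_sub (near0_and hK (near0_lt e0))) => t [h].
rewrite ltr_pdivlMr ?ltr_wpDl // => h2.
have h3 : modulus (F t - F 0) <= modulus (F 0) / 2.
  by apply: (le_trans h); apply: le_trans (ltW h2); rewrite mulrC ler_wpM2l ?mod_ge0 // lerDl.
have := mod_sub_ge (F 0) (F t); rewrite mod_subC => h4.
have : modulus (F 0) - modulus (F t) <= modulus (F 0) / 2 by exact: le_trans h4 h3.
by lra.
Qed.

(** For a polynomial approximation P of F, a partial sum Q of the geometric series
    in U = 1 - P / F(0) inverts P up to U^(n+1), which is O(|t|^(n+1)). *)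
Lemma approxV F : (forall n, approx n F) -> F 0 != 0 ->
  forall n, approx n (fun t => (F t)^-1).
Proof.
move=> aF F0 n; have hF := approx_nonzero (aF 1%N) F0.
have c0 : 0 < modulus (F 0) / 2 by rewrite divr_gt0 ?mod_gt0.
have inv_le t : modulus (F 0) / 2 <= modulus (F t) ->
    modulus (F t)^-1 <= (modulus (F 0) / 2)^-1 /\ F t != 0.
  move=> h; have ft : 0 < modulus (F t) by exact: lt_le_trans c0 h.
  by rewrite modV -mod_gt0 lef_pV2 ?posrE.
case: n => [|n].
  exists 0, (modulus (F 0) / 2)^-1; first by rewrite invr_ge0 ltW.
  by apply: (near0_sub hF) => t /inv_le[h _]; rewrite horner0 subr0 expr0 mulr1.
have [P [K K0 hK]] := aF n.+1; have e := approx_value0 hK.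
set U := 1 - (F 0)^-1 *: P.
have [|V hV] := @poly_vanish U.
  by rewrite /U !hornerE e mulVf // subrr.
have [L L0 hL] := poly_bounded V.
pose Q := (F 0)^-1 *: \sum_(i < n.+1) U ^+ i.
have [B B0 hB] := poly_bounded Q.
have PQ : P * Q = 1 - U ^+ n.+1.
  rewrite -[in RHS](expr1n _ n.+1) subrXX.
  rewrite /Q -scalerAr scalerAl; congr (_ * _); first by rewrite /U opprB addrC subrK.
  by apply: eq_bigr => i _; rewrite expr1n mul1r.
exists Q, ((modulus (F 0) / 2)^-1 * (L ^+ n.+1 + K * B)).
  by rewrite mulr_ge0 ?invr_ge0 ?(ltW c0) // addr_ge0 ?exprn_ge0 ?mulr_ge0.
apply: (near0_sub (near0_and (near0_and hK hF) (near0_lt ltr01))).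
move=> t [[h1 /inv_le[h2 ft0]] t1].
have PQt : P.[t] * Q.[t] = 1 - (t * V.[t]) ^+ n.+1.
  by rewrite -hV -horner_exp -hornerM PQ hornerD hornerN hornerC.
rewrite (_ : _ - _ = (F t)^-1 * ((t * V.[t]) ^+ n.+1 - (F t - P.[t]) * Q.[t])); last first.
  have -> : (t * V.[t]) ^+ n.+1 = 1 - P.[t] * Q.[t] by rewrite PQt opprB addrC subrK.
  by field.
rewrite modM -mulrA ler_pM ?mod_ge0 //.
apply: (le_trans (modB_le _ _)); rewrite [leRHS]mulrDl; apply: lerD.
  by rewrite modX modM exprMn mulrC ler_wpM2r ?exprn_ge0 ?mod_ge0 // lerXn2r ?nnegrE ?mod_ge0 // hL // ltW.
by rewrite modM mulrAC ler_pM ?mod_ge0 // hB // ltW.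
Qed.

Lemma approx_comp_poly P F : (forall n, approx n F) -> forall n, approx n (fun t => P.[F t]).
Proof.
move=> aF n; elim/poly_ind: P => [|P c ih].
  by apply: approx_ext (approx_poly n 0); apply: near0W => t; rewrite !horner0.
apply: approx_ext (approxD (approxM ih (aF n)) (approx_poly n c%:P)).
by apply: near0W => t; rewrite !hornerE.
Qed.

Lemma hol_at_ext f g b : near0 (fun t => f (b + t) = g (b + t)) -> hol_at f b -> hol_at g b.
Proof. by move=> h hf n; apply: approx_ext h (hf n). Qed.

Lemma eq_hol_at f g b : f =1 g -> hol_at f b -> hol_at g b.
Proof. by move=> h; apply: hol_at_ext; apply: near0W => t; rewrite h. Qed.

Lemma hol_poly P b : hol_at (horner P) b.
Proof.
move=> n; apply: approx_ext (approx_poly n (P \Po ('X + b%:P))).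
by apply: near0W => t; rewrite horner_comp !hornerE addrC.
Qed.

Lemma hol_cst c b : hol_at (fun=> c) b.
Proof. by apply: eq_hol_at (hol_poly c%:P b) => t; rewrite hornerE. Qed.

Lemma hol_id b : hol_at id b.
Proof. by apply: eq_hol_at (hol_poly 'X b) => t; rewrite hornerE. Qed.

Lemma holD f g b : hol_at f b -> hol_at g b -> hol_at (fun x => f x + g x) b.
Proof. by move=> hf hg n; exact: approxD. Qed.

Lemma holM f g b : hol_at f b -> hol_at g b -> hol_at (fun x => f x * g x) b.
Proof. by move=> hf hg n; exact: approxM. Qed.

Lemma holN f b : hol_at f b -> hol_at (fun x => - f x) b.
Proof.
move=> hf; apply: eq_hol_at (holM (hol_cst (-1) b) hf) => x.
by rewrite mulN1r.
Qed.

Lemma holB f g b : hol_at f b -> hol_at g b -> hol_at (fun x => f x - g x) b.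
Proof. by move=> hf hg; apply: holD => //; exact: holN. Qed.

Lemma holV f b : hol_at f b -> f b != 0 -> hol_at (fun x => (f x)^-1) b.
Proof.
by move=> hf fb n; apply: (@approxV (fun t => f (b + t))) => //=; rewrite addr0.
Qed.

Lemma hol_div f g b : hol_at f b -> hol_at g b -> g b != 0 -> hol_at (fun x => f x / g x) b.
Proof. by move=> hf hg gb; apply: holM => //; exact: holV. Qed.

Lemma hol_prod (I : Type) (s : seq I) (F : I -> C -> C) b :
  (forall i, hol_at (F i) b) -> hol_at (fun x => \prod_(i <- s) F i x) b.
Proof.
move=> h; elim: s => [|i s ih].
  by apply: eq_hol_at (hol_cst 1 b) => x; rewrite big_nil.
by apply: eq_hol_at (holM (h i) ih) => x; rewrite big_cons.
Qed.

Lemma hol_lipschitz f b : hol_at f b -> exists2 K : R, 0 <= K &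
  near0 (fun t => modulus (f (b + t) - f b) <= K * modulus t).
Proof. by move=> /(_ 1%N)/approx_lipschitz; rewrite addr0. Qed.

Lemma hol_comp f (phi : C -> C) b : hol_at phi b -> hol_at f (phi b) ->
  hol_at (fun x => f (phi x)) b.
Proof.
move=> hp hf n; pose psi t := phi (b + t) - phi b.
have apsi : forall n, approx n psi.
  by move=> m; exact: (holB hp (hol_cst (phi b) b)).
have [L L0 hL] := hol_lipschitz hp.
have [P [K K0 [r r0 hr]]] := hf n.
apply: (@approx_ext _ (fun t => (f (phi (b + t)) - P.[psi t]) + P.[psi t])).
  by apply: near0W => t; rewrite subrK.
apply: approxD; last exact: approx_comp_poly.
exists 0, (K * L ^+ n); first by rewrite mulr_ge0 ?exprn_ge0.
have e0 : 0 < r / (L + 1) by rewrite divr_gt0 // ltr_wpDl.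
apply: (near0_sub (near0_and hL (near0_lt e0))) => t [h].
rewrite ltr_pdivlMr ?ltr_wpDl // => h2.
rewrite horner0 subr0 -[phi (b + t)](subrKC (phi b)) -/(psi t).
have hp1 : modulus (psi t) < r.
  by apply: (le_lt_trans h); apply: le_lt_trans h2; rewrite mulrC ler_wpM2l ?mod_ge0 // lerDl.
apply: (le_trans (hr _ hp1)); rewrite -mulrA -exprMn ler_wpM2l //.
by rewrite lerXn2r ?nnegrE ?mod_ge0 // mulr_ge0 ?mod_ge0.
Qed.

Lemma small_mod (r : R) : 0 < r -> exists2 t : C, t != 0 & modulus t = r.
Proof.
move=> r0; exists (r%:C)%C; last by rewrite modR gtr0_norm.
by rewrite -mod_gt0 modR gtr0_norm.
Qed.

(** A constant that is O(|t|) vanishes; used to identify leading coefficients. *)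
Lemma near0_lin_eq0 c (K : R) : 0 <= K ->
  near0 (fun t => t != 0 -> modulus c <= K * modulus t) -> c = 0.
Proof.
move=> K0 [r r0 hr]; apply/eqP; rewrite -mod_eq0 -[_ == 0]negbK; apply/negP => c0.
have cp : 0 < modulus c by rewrite lt_neqAle eq_sym c0 mod_ge0.
pose s := Num.min (r / 2) (modulus c / 2 / (K + 1)).
have K1 : 0 < K + 1 by rewrite ltr_wpDl.
have s0 : 0 < s by rewrite lt_min !divr_gt0.
have [t t0 tE] := small_mod s0.
have h1 : modulus t < r.
  by rewrite tE (le_lt_trans (_ : s <= r / 2)) ?ge_min ?lexx // ltr_pdivrMr // ltr_pMr // ltr1n.
have := hr t h1 t0; rewrite tE.
have : s <= modulus c / 2 / (K + 1) by rewrite ge_min lexx orbT.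
rewrite ler_pdivlMr // => h2 h3.
have : K * s <= s * (K + 1) by rewrite mulrC ler_wpM2l ?(ltW s0) // lerDl.
by lra.
Qed.

(** Dividing out a zero keeps all local expansions: an expansion of f to one
    order more has no constant term, and the value of the quotient at the
    zero is the linear coefficient, which does not depend on the order. *)
Lemma hol_factor f b : hol_at f b -> f b = 0 ->
  exists g, [/\ forall x, f x = (x - b) * g x, hol_at g b &
    forall x, x != b -> hol_at f x -> hol_at g x].
Proof.
move=> hf fb.
have key n : exists Q, exists2 K : R, 0 <= K & near0 (fun t => t != 0 ->
    modulus (f (b + t) / t - Q.[t]) <= K * modulus t ^+ n).
  have [P [K K0 hK]] := hf n.+1.
  have [|Q hQ] := @poly_vanish P; first by rewrite (approx_value0 hK) addr0.
  exists Q, K => //; apply: (near0_sub hK) => t h t0.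
  rewrite (_ : _ - _ = (f (b + t) - P.[t]) / t); last by rewrite hQ; field.
  by rewrite mod_div ler_pdivrMr ?mod_gt0 // -mulrA -exprSr.
have [Q1 [K1 K10 h1]] := key 1%N.
pose g x := if x == b then Q1.[0] else f x / (x - b).
have gE x : x != b -> g x = f x / (x - b) by rewrite /g => /negbTE ->.
exists g; split.
- move=> x; rewrite /g; case: eqVneq => [->|xb]; first by rewrite subrr mul0r fb.
  by rewrite mulrC divfK // subr_eq0.
- move=> n; have [Q [K K0 hK]] := key n.+1.
  have Q0 : Q.[0] = Q1.[0].
    have [L L0 hL] := poly_lipschitz0 (Q - Q1).
    apply/eqP; rewrite -subr_eq0; apply/eqP; apply: (@near0_lin_eq0 _ (K1 + K + L)).
      by rewrite !addr_ge0.
    apply: (near0_sub (near0_and (near0_and h1 hK) (near0_lt ltr01))).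
    move=> t [[k1 k2] t1] t0; have := hL t (ltW t1); rewrite !hornerE => k3.
    rewrite (_ : Q.[0] - Q1.[0] = ((f (b + t) / t - Q1.[t]) - (f (b + t) / t - Q.[t]))
      - (Q.[t] - Q1.[t] - (Q.[0] - Q1.[0]))); last by ring.
    apply: (le_trans (modB_le _ _)); rewrite mulrDl; apply: lerD => //.
    apply: (le_trans (modB_le _ _)); rewrite mulrDl; apply: lerD.
      by have := k1 t0; rewrite expr1.
    apply: (le_trans (k2 t0)); rewrite ler_wpM2l // exprS ler_piMr ?mod_ge0 //.
    by rewrite exprn_ile1 ?mod_ge0 // ltW.
  exists Q, K => //; apply: (near0_sub (near0_and hK (near0_lt ltr01))) => t [h t1].
  rewrite /g; case: eqVneq => [e|tb].
    have -> : t = 0 by apply: (addrI b); rewrite e addr0.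
    by rewrite Q0 subrr mod0 mulr_ge0 ?exprn_ge0 ?mod_ge0.
  have t0 : t != 0 by apply: contra tb => /eqP ->; rewrite addr0.
  rewrite (addrC b t) addrK addrC; apply: (le_trans _ (_ : K * modulus t ^+ n.+1 <= _)).
    by rewrite addrC (addrC t); exact: h.
  by rewrite ler_wpM2l // exprS ler_piMl ?exprn_ge0 ?mod_ge0 // ltW.
- move=> x xb hx; apply: (@hol_at_ext (fun y => f y / (y - b))).
    exists (modulus (x - b)); first by rewrite mod_gt0 subr_eq0.
    move=> t tx; rewrite gE //; apply: contraTneq tx => e.
    by rewrite -leNgt -e opprD addrA subrr sub0r modN.
  apply: hol_div => //; last by rewrite subr_eq0.
  exact: holB (hol_id x) (hol_cst b x).
Qed.
End Holomorphy.

(** * Subharmonicity and the maximum principle *)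
Section MaxPrinciple.
Variable R : realType.
Local Notation C := R[i].
Implicit Types (a b c z t x : C) (f g h : C -> C) (u v : C -> R).

Definition cont_at v b := forall e : R, 0 < e -> near0 (fun t => `|v (b + t) - v b| < e).

Lemma cont_atD u v b : cont_at u b -> cont_at v b -> cont_at (fun x => u x + v x) b.
Proof.
move=> hu hv e e0; have e2 : 0 < e / 2 by rewrite divr_gt0.
apply: (near0_sub (near0_and (hu _ e2) (hv _ e2))) => t [h1 h2].
rewrite opprD addrACA; apply: (le_lt_trans (ler_normD _ _)).
by rewrite [ltRHS](splitr e) ltrD.
Qed.

Lemma cont_at_sum (I : Type) (s : seq I) (F : I -> C -> R) b :
  (forall i, cont_at (F i) b) -> cont_at (fun x => \sum_(i <- s) F i x) b.
Proof.
move=> h; elim: s => [|i s ih] e e0.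
  by apply: near0W => t; rewrite !big_nil subrr normr0.
apply: (near0_sub (cont_atD (h i) ih e0)) => t.
by rewrite !big_cons.
Qed.

Lemma cont_at_comp (k : R -> R) v b : cont_at v b -> {for v b, continuous k} ->
  cont_at (fun x => k (v x)) b.
Proof.
move=> hv /cvgrPdist_lt hk e e0.
have /nbhs_ballP[d /= d0 hd] := hk _ e0.
apply: (near0_sub (hv _ d0)) => t ht.
by have := hd (v (b + t)); rewrite /ball /= distrC => /(_ ht); rewrite distrC.
Qed.

Lemma cont_at_lip v b (K : R) : 0 <= K ->
  near0 (fun t => `|v (b + t) - v b| <= K * modulus t) -> cont_at v b.
Proof.
move=> K0 hK e e0; have d0 : 0 < e / (K + 1) by rewrite divr_gt0 // ltr_wpDl.
apply: (near0_sub (near0_and hK (near0_lt d0))) => t [h].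
rewrite ltr_pdivlMr ?ltr_wpDl // => h2; apply: (le_lt_trans h).
by apply: le_lt_trans h2; rewrite mulrC ler_wpM2l ?mod_ge0 // lerDl.
Qed.

Lemma dist_mod_le a b : `|modulus a - modulus b| <= modulus (a - b).
Proof.
rewrite ler_norml mod_sub_ge andbT lerNl opprB mod_subC; exact: mod_sub_ge.
Qed.

Lemma hol_cont_mod f b : hol_at f b -> cont_at (fun x => modulus (f x)) b.
Proof.
move=> /hol_lipschitz[K K0 hK]; apply: (cont_at_lip K0).
by apply: (near0_sub hK) => t; apply: le_trans; exact: dist_mod_le.
Qed.

Lemma hol_affine c d b : hol_at (fun x : C => c + d * x) b.
Proof.
apply: holD; first exact: hol_cst.
by apply: holM; [exact: hol_cst|exact: hol_id].
Qed.

Lemma cont_mod_sub c b : cont_at (fun x => modulus (x - c)) b.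
Proof.
apply: (@hol_cont_mod (fun x => x - c)).
by apply: holB; [exact: hol_id|exact: hol_cst].
Qed.

Definition cplx (w : R * R) : C := (w.1 +i* w.2)%C.

Lemma cplx_ReIm z : cplx (complex.Re z, complex.Im z) = z.
Proof. by case: z. Qed.

Lemma cplx_sub_le (w w' : R * R) :
  modulus (cplx w - cplx w') <= `|w.1 - w'.1| + `|w.2 - w'.2|.
Proof. by apply: le_trans (mod_le_ReIm _) _; case: w w' => [x y] [x' y']. Qed.

(** Transport to the product topology on pairs of coordinates, where compactness
    is available. *)
Lemma cont_at_continuous v (w : R * R) : cont_at v (cplx w) ->
  {for w, continuous (fun w : R * R => v (cplx w))}.
Proof.
move=> hv; apply/cvgrPdist_lt => e e0; have [r r0 hr] := hv e e0.
have r2 : 0 < r / 2 by rewrite divr_gt0.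
exists (ball w.1 (r / 2), ball w.2 (r / 2)).
  by split; exact: nbhsx_ballx.
move=> w' [/= h1 h2].
have h : modulus (cplx w' - cplx w) < r.
  apply: (le_lt_trans (cplx_sub_le _ _)); rewrite (splitr r) ltrD // distrC.
    exact: h1.
  exact: h2.
by have := hr _ h; rewrite subrKC distrC.
Qed.

Lemma compact_annulus b (r s : R) :
  compact [set w : R * R | r <= modulus (cplx w - b) <= s].
Proof.
have cm : forall w, {for w, continuous (fun w : R * R => modulus (cplx w - b))}.
  by move=> w; apply: (cont_at_continuous (v := fun x => modulus (x - b)));
    exact: cont_mod_sub.
pose B := `[complex.Re b - s, complex.Re b + s]%classic `*`
          `[complex.Im b - s, complex.Im b + s]%classic.
apply: (@subclosed_compact _ _ B).
- rewrite (_ : [set _ | _] = (fun w : R * R => modulus (cplx w - b)) @^-1` [set x | r <= x]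
    `&` (fun w : R * R => modulus (cplx w - b)) @^-1` [set x | x <= s]).
    apply: closedI; apply: closed_comp; do ?by move=> ? _; exact: cm.
      exact: closed_ge.
    exact: closed_le.
  by apply/seteqP; split => w /=; [move=> /andP[]|move=> [-> ->]].
- by apply: compact_setX; exact: segment_compact.
move=> w /= /andP[_ h]; split => /=; rewrite in_itv /= -ler_distl.
  apply: le_trans h; apply: le_trans (mod_Re _).
  by case: b {B cm} => x y; rewrite distrC.
apply: le_trans h; apply: le_trans (mod_Im _).
by case: b {B cm} => x y; rewrite distrC.
Qed.

(** With r = s this is attainment of the maximum over a circle, with r = 0 over a
    closed disc. *)
Lemma annulus_max v b (r s : R) : 0 <= r -> r <= s ->
  (forall x, modulus (x - b) <= s -> cont_at v x) ->
  exists2 c, r <= modulus (c - b) <= s &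
    forall x, r <= modulus (x - b) <= s -> v x <= v c.
Proof.
move=> r0 rs hv; set A := [set w : R * R | r <= modulus (cplx w - b) <= s].
have [||| c] := @compact_EVT_max _ R (fun w => v (cplx w)) A.
- exists (complex.Re b + r, complex.Im b); rewrite /A /=.
  have -> : cplx (complex.Re b + r, complex.Im b) - b = (r%:C)%C.
    by case: b {hv A} => x y; apply/eqP; rewrite eq_complex /= addrC addKr subrr !eqxx.
  by rewrite modR ger0_norm // lexx rs.
- exact: compact_annulus.
- apply: continuous_in_subspaceT => w; rewrite inE => /andP[_ hw].
  by apply: cont_at_continuous; exact: hv.
rewrite inE => cA h; exists (cplx c) => // x hx.
have := h (complex.Re x, complex.Im x); rewrite cplx_ReIm; apply.
by rewrite inE /A /= cplx_ReIm.
Qed.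

Lemma disc_max v b (s : R) : 0 <= s -> (forall x, modulus (x - b) <= s -> cont_at v x) ->
  exists2 c, modulus (c - b) <= s & forall x, modulus (x - b) <= s -> v x <= v c.
Proof.
move=> s0 /(annulus_max (lexx 0) s0)[c /andP[_ hc] h].
by exists c => // x hx; apply: h; rewrite mod_ge0.
Qed.

Local Notation "''I'" := ('i%C : C).

(** A discrete form of having a nonnegative Laplacian, stable under sums and
    asking nothing of v but its values. *)
Definition cross_sub v b := forall e : R, 0 < e -> near0 (fun t =>
  4 * v b <= v (b + t) + v (b + 'I * t) + v (b - t) + v (b - 'I * t) + e * modulus t ^+ 2).

Lemma cross_subD u v b : cross_sub u b -> cross_sub v b -> cross_sub (fun x => u x + v x) b.
Proof.
move=> hu hv e e0; have e2 : 0 < e / 2 by rewrite divr_gt0.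
apply: (near0_sub (near0_and (hu _ e2) (hv _ e2))) => t [h1 h2].
by have := lerD h1 h2; lra.
Qed.

Lemma cross_sub_sum (I : Type) (s : seq I) (F : I -> C -> R) b :
  (forall i, cross_sub (F i) b) -> cross_sub (fun x => \sum_(i <- s) F i x) b.
Proof.
move=> h; elim: s => [|i s ih] e e0.
  apply: near0W => t; rewrite !big_nil mulr0 !addr0 add0r.
  by rewrite mulr_ge0 ?exprn_ge0 ?mod_ge0 // ltW.
apply: (near0_sub (cross_subD (h i) ih e0)) => t.
by rewrite !big_cons.
Qed.

Lemma sum_sqr_cross b c t :
  modulus (c + t - b) ^+ 2 + modulus (c + 'I * t - b) ^+ 2
  + modulus (c - t - b) ^+ 2 + modulus (c - 'I * t - b) ^+ 2
  = 4 * modulus (c - b) ^+ 2 + 4 * modulus t ^+ 2.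
Proof. by rewrite !mod_sqr; case: b c t => [x y] [x' y'] [p q] /=; ring. Qed.

Lemma mod_iM t : modulus ('I * t) = modulus t.
Proof. by rewrite modM /= expr0n add0r expr1n sqrtr1 mul1r. Qed.

(** Adding d |x - b|^2 makes the cross inequality strict, so the maximum of the
    perturbed function cannot be interior; then let d tend to 0. *)
Lemma max_principle v b (s : R) : 0 < s ->
  (forall x, modulus (x - b) <= s -> cont_at v x) ->
  (forall x, modulus (x - b) < s -> cross_sub v x) ->
  exists2 c, modulus (c - b) = s & forall x, modulus (x - b) <= s -> v x <= v c.
Proof.
move=> s0 cv sv; have s0' := ltW s0.
have [c /andP[c1 c2] hc] := annulus_max s0' (lexx s) cv.
have cs : modulus (c - b) = s by apply/le_anti; rewrite c1 c2.
exists c => // x xs; apply/ler_addgt0Pr => e e0.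
(* On the circle of radius s the perturbation is exactly e. *)
pose d := e / s ^+ 2.
have d0 : 0 < d by rewrite divr_gt0 // exprn_gt0.
pose u y := v y + d * modulus (y - b) ^+ 2.
have cu y : modulus (y - b) <= s -> cont_at u y.
  move=> ys; apply: cont_atD; first exact: cv.
  apply: (cont_at_comp (k := fun r : R => d * r ^+ 2)); first exact: cont_mod_sub.
  by apply: cvgM; [exact: cvg_cst|apply: exprn_continuous].
have [m ms hm] := disc_max s0' cu.
have mS : modulus (m - b) = s.
  apply/eqP; rewrite eq_le ms /= leNgt; apply/negP => ms'.
  have [r r0 hr] := sv m ms' d d0.
  have q0 : 0 < Num.min (r / 2) (s - modulus (m - b)).
    by rewrite lt_min divr_gt0 ?subr_gt0.
  have [t t0 tE] := small_mod q0.
  have tr : modulus t < r.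
    by rewrite tE (le_lt_trans (_ : _ <= r / 2)) ?ge_min ?lexx // ltr_pdivrMr // ltr_pMr // ltr1n.
  have ts : modulus t <= s - modulus (m - b) by rewrite tE ge_min lexx orbT.
  have H w : modulus w = modulus t -> u (m + w) <= u m.
    move=> we; apply: hm; rewrite addrAC; apply: (le_trans (modD_le _ _)).
    by rewrite we -lerBrDl.
  have h1 := H t erefl; have h2 := H ('I * t) (mod_iM t).
  have h3 := H (- t) (modN t); have h4 := H (- ('I * t)) (etrans (modN _) (mod_iM t)).
  have hs := sum_sqr_cross b m t; have := hr t tr.
  have tp : 0 < modulus t ^+ 2 by rewrite exprn_gt0 // mod_gt0.
  move: h1 h2 h3 h4; rewrite /u => h1 h2 h3 h4 h5.
  have dt : 0 < d * modulus t ^+ 2 by rewrite mulr_gt0.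
  have hs' := congr1 (fun x : R => d * x) hs.
  by move: hs' h1 h2 h3 h4 h5; rewrite /= !mulrDr; lra.
have := hm x xs; rewrite /u mS => h.
have h1 : v m <= v c by apply: hc; rewrite mS lexx.
have h2 : d * s ^+ 2 = e by rewrite /d divfK // gt_eqF // exprn_gt0.
have h3 : 0 <= d * modulus (x - b) ^+ 2.
  by rewrite mulr_ge0 ?(ltW d0) // exprn_ge0 // mod_ge0.
by rewrite h2 in h; lra.
Qed.

(** Up to third order the product of the values of f at the four vertices of
    a small cross is the fourth power of its central value: the product is
    unchanged when the cross turns by a quarter. *)
Lemma hol_cross_prod f b : hol_at f b -> exists2 K : R, 0 <= K & near0 (fun t =>
  modulus (f (b + t) * f (b + 'I * t) * f (b - t) * f (b - 'I * t) - f b ^+ 4)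
   <= K * modulus t ^+ 3).
Proof.
move=> /(_ 3%N)[P [K K0 hK]].
have e := approx_value0 hK; rewrite /= addr0 in e.
have [|P1 hP1] := @poly_vanish _ (P - P.[0]%:P); first by rewrite !hornerE subrr.
have [|P2 hP2] := @poly_vanish _ (P1 - P1.[0]%:P); first by rewrite !hornerE subrr.
have [|P3 hP3] := @poly_vanish _ (P2 - P2.[0]%:P); first by rewrite !hornerE subrr.
set c0 := f b; set c1 := P1.[0]; set c2 := P2.[0].
have PE t : P.[t] = c0 + c1 * t + c2 * t ^+ 2 + t ^+ 3 * P3.[t].
  have h1 : P.[t] = c0 + t * P1.[t] by rewrite -hP1 hornerD hornerN hornerC e subrKC.
  have h2 : P1.[t] = c1 + t * P2.[t] by rewrite -hP2 hornerD hornerN hornerC subrKC.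
  have h3 : P2.[t] = c2 + t * P3.[t] by rewrite -hP3 hornerD hornerN hornerC subrKC.
  by rewrite h1 h2 h3; ring.
have [L L0 hL] := poly_bounded P3.
have ap (w : C) : modulus w = 1 -> approx_by 3 (fun t => f (b + w * t))
   (c0%:P + (c1 * w) *: 'X + (c2 * w ^+ 2) *: 'X^2).
  move=> w1; exists (K + L); first exact: addr_ge0.
  have [r r0 hr] := near0_and hK (near0_lt ltr01).
  exists r => // t tr; have wt : modulus (w * t) = modulus t by rewrite modM w1 mul1r.
  have [|h1 h2] := hr (w * t); first by rewrite wt.
  rewrite !hornerD !hornerZ hornerC hornerX hornerXn (_ : _ - _ = (f (b + w * t) - P.[w * t]) + (w * t) ^+ 3 * P3.[w * t]); last first.
    by rewrite PE; ring.
  apply: (le_trans (modD_le _ _)); rewrite mulrDl; apply: lerD.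
    by rewrite wt in h1.
  by rewrite modM modX wt mulrC ler_wpM2r ?exprn_ge0 ?mod_ge0 // hL // ltW.
have i1 : modulus 'I = 1 by rewrite -[RHS](mod1 R) -(mod_iM 1) mulr1.
have m1 : modulus (-1 : C) = 1 by rewrite modN mod1.
have mi : modulus (- 'I) = 1 by rewrite modN.
have [A A0 hA] := approx_byM (approx_byM (approx_byM (ap _ (mod1 R)) (ap _ i1)) (ap _ m1)) (ap _ mi).
(* D bounds the remainder divided by t^4 computed in pE: the coefficients of t, t^2
   and t^3 cancel by the symmetry of the cross. *)
pose D := 2 * modulus c0 ^+ 2 * modulus c2 ^+ 2 + modulus c2 ^+ 4 + modulus (2 * c0 * c2 - c1 ^+ 2) ^+ 2.
have D0 : 0 <= D by rewrite !addr_ge0 ?mulr_ge0 ?exprn_ge0 ?mod_ge0.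
exists (A + D); first by rewrite addr_ge0.
apply: (near0_sub (near0_and hA (near0_lt ltr01))) => t [].
rewrite !mul1r !mulN1r mulNr.
set p := horner _ _; set F := _ * _ * _ * _ => h t1.
have pE : p - c0 ^+ 4 = t ^+ 4 * (2 * c0 ^+ 2 * c2 ^+ 2 + c2 ^+ 4 * t ^+ 4 - (2 * c0 * c2 - c1 ^+ 2) ^+ 2).
  have i2 : 'I ^+ 2 = -1 by exact: sqr_i.
  rewrite /p !hornerM !hornerD !hornerZ !hornerC !hornerX !hornerXn !sqrrN i2.
  rewrite (_ : _ * _ * _ * _ = ((c0 + c2 * t ^+ 2) ^+ 2 - (c1 * t) ^+ 2) *
     ((c0 - c2 * t ^+ 2) ^+ 2 - 'I ^+ 2 * (c1 * t) ^+ 2)); last by ring.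
  by rewrite i2; ring.
rewrite -(subrKA p); apply: (le_trans (modD_le _ _)); rewrite mulrDl.
apply: lerD; first exact: h.
have tt (k : nat) : modulus t ^+ k <= 1 by rewrite exprn_ile1 ?mod_ge0 // ltW.
rewrite -/c0 pE modM modX mulrC; apply: ler_pM; rewrite ?mod_ge0 ?exprn_ge0 ?mod_ge0 //.
  rewrite /D; apply: (le_trans (modB_le _ _)); apply: lerD; last by rewrite modX.
  apply: (le_trans (modD_le _ _)); apply: lerD.
    by rewrite modM (modX c2) modM (modX c0) (mod_natr _ 2).
  by rewrite modM (modX c2) (modX t) ler_piMr ?exprn_ge0 ?mod_ge0.
by rewrite exprS ler_piMl ?exprn_ge0 ?mod_ge0 // ltW.
Qed.

Lemma cont_at_powR v b (p : R) : 0 < p -> (forall x, 0 <= v x) -> cont_at v b ->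
  cont_at (fun x => v x `^ p) b.
Proof.
move=> p0 v0 hv; have := v0 b; rewrite le_eqVlt => /predU1P[vb|vb]; last first.
  apply: (cont_at_comp (k := fun r => r `^ p)) => //.
  apply/differentiable_continuous/derivable1_diffP.
  by apply: derivable_powR; rewrite in_itv /= vb.
move=> e e0; have d0 : 0 < e `^ p^-1 by rewrite powR_gt0.
apply: (near0_sub (hv _ d0)) => t; rewrite -vb powR0 ?gt_eqF // !subr0.
rewrite !ger0_norm ?powR_ge0 // => h.
rewrite -[ltRHS]powRr1 ?(ltW e0) // -(mulVf (x := p)) ?gt_eqF // powRrM.
by rewrite gt0_ltr_powR ?nnegrE ?powR_ge0.
Qed.

Lemma hol_cont_powR f b (p : R) : 0 < p -> hol_at f b ->
  cont_at (fun x => modulus (f x) `^ p) b.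
Proof.
move=> p0 hf; apply: cont_at_powR => //; first by move=> x; exact: mod_ge0.
exact: hol_cont_mod.
Qed.

(** Tangent line inequality for exp, at p ln x. *)
Lemma powR_tangent (x y p : R) : 0 < x -> 0 < y -> 0 < p ->
  x `^ p * (1 + p * (ln y - ln x)) <= y `^ p.
Proof.
move=> x0 y0 p0; have yx : 0 < y / x by rewrite divr_gt0.
have -> : y `^ p = x `^ p * (y / x) `^ p.
  by rewrite -powRM ?(ltW x0) ?(ltW yx) // mulrC divfK // gt_eqF.
rewrite ler_wpM2l ?powR_ge0 // [leRHS]/powR gt_eqF // -ln_div ?posrE //.
by apply: expR_ge1Dx.
Qed.

Lemma ln_ge_inv (x : R) : 0 < x -> 1 - x^-1 <= ln x.
Proof.
move=> x0; rewrite -[ln x]opprK -lnV ?posrE // lerBlDl -lerBlDr opprK.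
have := le_ln1Dx (x := x^-1 - 1); rewrite ltrBDl addrN invr_gt0 subrKC => /(_ x0).
by lra.
Qed.

(** The powers of |f| are subharmonic, with no constant lost as p varies: by
    convexity of the exponential it suffices that ln |f| averages correctly,
    and the sum of ln |f| over a cross is read off the product. *)
Lemma hol_cross_sub f b (p : R) : 0 < p -> hol_at f b ->
  cross_sub (fun x => modulus (f x) `^ p) b.
Proof.
move=> p0 hf e e0.
have [fb|fb] := eqVneq (f b) 0.
  apply: near0W => t; rewrite fb mod0 powR0 ?gt_eqF // mulr0.
  by rewrite !addr_ge0 ?powR_ge0 // mulr_ge0 ?exprn_ge0 ?mod_ge0 // ltW.
have [K K0 hK] := hol_cross_prod hf.
set m := modulus (f b); have m0 : 0 < m by rewrite mod_gt0.
have m4 : 0 < m ^+ 4 by rewrite exprn_gt0.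
have q0 : 0 < m ^+ 4 / 2 / (K + 1) by rewrite !divr_gt0 // ltr_wpDl.
have mp : 0 < m `^ p by rewrite powR_gt0.
pose L := 2 * m `^ p * p * K / m ^+ 4.
have L0 : 0 <= L by rewrite divr_ge0 ?(ltW m4) // !mulr_ge0 ?(ltW p0) // ltW.
have r0 : 0 < e / (L + 1) by rewrite divr_gt0 // ltr_wpDl.
apply: (near0_sub (near0_and (near0_and hK (near0_lt ltr01))
  (near0_and (near0_lt q0) (near0_lt r0)))) => t [[h t1] [tq tr]].
set s := modulus t in h t1 tq tr *; have s0 : 0 <= s by exact: mod_ge0.
set a1 := modulus (f (b + t)); set a2 := modulus (f (b + _)).
set a3 := modulus (f (b - t)); set a4 := modulus (f (b - _)).
have s3 : s ^+ 3 <= s by rewrite exprS ler_piMr // exprn_ile1 // ltW.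
have Ks : K * s ^+ 3 <= m ^+ 4 / 2.
  apply: (le_trans (_ : _ <= K * s)); first by rewrite ler_wpM2l.
  move: tq; rewrite ltr_pdivlMr ?ltr_wpDl // => tq.
  by apply: le_trans (ltW tq); rewrite mulrC ler_wpM2l // lerDl.
have prodE : m ^+ 4 - K * s ^+ 3 <= a1 * a2 * a3 * a4.
  have := mod_sub_ge (f b ^+ 4) (f (b + t) * f (b + 'I * t) * f (b - t) * f (b - 'I * t)).
  rewrite modX -/m !modM -/a1 -/a2 -/a3 -/a4 mod_subC => h2.
  by rewrite lerBlDr -lerBlDl; apply: le_trans h.
have pp : 0 < a1 * a2 * a3 * a4.
  by apply: lt_le_trans prodE; have := m4; move: Ks; lra.
have a1p : 0 <= a1 by exact: mod_ge0. have a2p : 0 <= a2 by exact: mod_ge0.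
have a3p : 0 <= a3 by exact: mod_ge0. have a4p : 0 <= a4 by exact: mod_ge0.
have pos : [/\ 0 < a1, 0 < a2, 0 < a3 & 0 < a4].
  by split; rewrite lt_neqAle eq_sym ?a1p ?a2p ?a3p ?a4p andbT;
    apply: contraTneq pp => ->; rewrite ?mulr0 ?mul0r ?mulr0 ?mul0r ltxx.
case: pos => b1 b2 b3 b4.
have k1 := powR_tangent m0 b1 p0; have k2 := powR_tangent m0 b2 p0.
have k3 := powR_tangent m0 b3 p0; have k4 := powR_tangent m0 b4 p0.
pose y := a1 * a2 * a3 * a4 / m ^+ 4.
have y0 : 0 < y by rewrite divr_gt0.
have lnE : ln a1 + ln a2 + ln a3 + ln a4 - 4 * ln m = ln y.
  by rewrite /y ln_div ?posrE // lnXn // !lnM ?posrE ?mulr_gt0 // -[ln m *+ 4]mulr_natl.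
have y2 : 1 - K * s ^+ 3 / m ^+ 4 <= y.
  by rewrite /y ler_pdivlMr // mulrBl mul1r divfK // gt_eqF.
have yh : 2^-1 <= y.
  apply: le_trans y2; have : K * s ^+ 3 / m ^+ 4 <= 2^-1 by rewrite ler_pdivrMr // [leRHS]mulrC.
  by lra.
have lny : - (2 * (K * s ^+ 3 / m ^+ 4)) <= ln y.
  apply: le_trans (ln_ge_inv y0).
  rewrite -[leRHS]opprK lerN2 opprB.
  have yi : y^-1 <= 2 by rewrite -[leRHS]invrK lef_pV2 ?posrE.
  have -> : y^-1 - 1 = y^-1 * (1 - y) by rewrite mulrBr mulr1 mulVf // gt_eqF.
  have [y1|y1] := leP y 1.
    by rewrite ler_pM ?invr_ge0 ?(ltW y0) ?subr_ge0 //; move: y2; lra.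
  apply: (le_trans (_ : _ <= 0)).
    by rewrite mulr_ge0_le0 ?invr_ge0 ?(ltW y0) // subr_le0 ltW.
  by rewrite mulr_ge0 // divr_ge0 ?(ltW m4) // mulr_ge0 // exprn_ge0.
have key : L * s ^+ 3 <= e * s ^+ 2.
  rewrite exprS mulrA ler_wpM2r ?exprn_ge0 //.
  move: tr; rewrite ltr_pdivlMr ?ltr_wpDl // => tr.
  by apply: le_trans (ltW tr); rewrite mulrC ler_wpM2l // lerDl.
have fin : m `^ p * p * - (2 * (K * s ^+ 3 / m ^+ 4)) <= m `^ p * p * ln y.
  by rewrite ler_wpM2l // mulr_ge0 // ltW.
have finE : m `^ p * p * - (2 * (K * s ^+ 3 / m ^+ 4)) = - (L * s ^+ 3).
  by rewrite /L; ring.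
rewrite finE -lnE in fin.
move: k1 k2 k3 k4 fin key.
move: (L * s ^+ 3) (e * s ^+ 2) (ln a1) (ln a2) (ln a3) (ln a4) (ln m).
by move: (m `^ p) (a1 `^ p) (a2 `^ p) (a3 `^ p) (a4 `^ p) => *; lra.
Qed.

Lemma hol_max_principle f b (s : R) : 0 < s ->
  (forall x, modulus (x - b) <= s -> hol_at f x) ->
  exists2 c, modulus (c - b) = s &
    forall x, modulus (x - b) <= s -> modulus (f x) <= modulus (f c).
Proof.
move=> s0 hf.
have [||c hc h] := @max_principle (fun x => modulus (f x) `^ 1) b s s0.
- by move=> x xs; apply: hol_cont_powR => //; exact: hf.
- by move=> x xs; apply: hol_cross_sub => //; apply: hf; exact: ltW.
by exists c => // x /h; rewrite !powRr1 ?mod_ge0.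
Qed.
End MaxPrinciple.

(** * Power series expansions *)
Section PowerSeries.
Variable R : realType.
Local Notation C := R[i].
Implicit Types (a b c z t x : C) (f g h : C -> C).

Lemma cvg_modP (u : nat -> C^o) (l : C^o) :
  u @ \oo --> l <->
  forall e : R, 0 < e -> exists N, forall n, (N <= n)%N -> modulus (l - u n) < e.
Proof.
have nE z : `|z : C^o| = ((modulus z)%:C)%C by [].
split=> [/cvgrPdist_lt h e e0|h].
  have [|N _ hN] := h ((e%:C)%C); first by rewrite ltcR.
  by exists N => n /hN /=; rewrite nE ltcR.
apply/cvgrPdist_lt => e e0.
have eE : e = ((complex.Re e)%:C)%C by rewrite RRe_real // ger0_real // ltW.
have [|N hN] := h (complex.Re e); first by rewrite -ltcR -eE.
by exists N => // n /= /hN; rewrite nE eE ltcR.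
Qed.

Lemma real_cvgP (u : nat -> R) (l : R) :
  u @ \oo --> l <->
  forall e : R, 0 < e -> exists N, forall n, (N <= n)%N -> `|l - u n| < e.
Proof.
split=> [/cvgrPdist_lt h e e0|h].
  by have [N _ hN] := h e e0; exists N => n /hN.
by apply/cvgrPdist_lt => e /h[N hN]; exists N => // n /hN.
Qed.

Lemma geometric_small (q e : R) : 0 <= q -> q < 1 -> 0 < e ->
  exists N, forall n, (N <= n)%N -> q ^+ n < e.
Proof.
move=> q0 q1 e0; have : geometric 1 q @ \oo --> (0 : R).
  by apply: cvg_geometric; rewrite ger0_norm.
move=> /real_cvgP /(_ e e0)[N hN]; exists N => n /hN.
by rewrite sub0r normrN /geometric /= mul1r ger0_norm // exprn_ge0.
Qed.

Lemma bounded_sum_cvg (m : nat -> R) (B : R) : (forall n, 0 <= m n) ->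
  (forall n, \sum_(k < n) m k <= B) ->
  exists T : R, (fun n => \sum_(k < n) m k) @ \oo --> T.
Proof.
move=> m0 hB; have : cvgn (fun n => \sum_(k < n) m k).
  apply: (@nondecreasing_is_cvgn _ _).
    apply/nondecreasing_seqP => n; by rewrite big_ord_recr lerDl.
  by exists B => _ [n _ <-].
by exists (limn (fun n => \sum_(k < n) m k)).
Qed.

Lemma partial_sum_le (m : nat -> R) (T : R) : (forall n, 0 <= m n) ->
  (fun n => \sum_(k < n) m k) @ \oo --> T -> forall n, \sum_(k < n) m k <= T.
Proof.
move=> m0 hT n; have <- := cvg_lim (@Rhausdorff R) hT.
apply: nondecreasing_cvgn_le; last exact: cvgP hT.
by apply/nondecreasing_seqP => k; rewrite big_ord_recr lerDl.
Qed.

Lemma sum_dist_le (u : nat -> C) (m : nat -> R) :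
  (forall n, modulus (u n.+1 - u n) <= m n) ->
  forall n N, (n <= N)%N ->
    modulus (u N - u n) <= \sum_(k < N) m k - \sum_(k < n) m k.
Proof.
move=> h n; elim=> [|N ih].
  by rewrite leqn0 => /eqP ->; rewrite !subrr mod0.
rewrite leq_eqVlt => /predU1P[->|]; first by rewrite !subrr mod0.
rewrite ltnS => /ih h1; apply: (le_trans (mod_triangle _ (u N) _)).
by rewrite big_ord_recr /= addrAC addrC lerD.
Qed.

(** Completeness of the plane, with the rate of convergence: it is the tail of the
    dominating series. *)
Lemma summable_increments (u : nat -> C) (m : nat -> R) (T : R) :
  (forall n, 0 <= m n) -> (fun n => \sum_(k < n) m k) @ \oo --> T ->
  (forall n, modulus (u n.+1 - u n) <= m n) ->
  exists l, forall n, modulus (l - u n) <= T - \sum_(k < n) m k.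
Proof.
move=> m0 hT hu; have hM := partial_sum_le m0 hT.
have dist := sum_dist_le hu.
have part (x : nat -> R) : (forall n, `|x n.+1 - x n| <= m n) ->
    exists l : R, x @ \oo --> l.
  move=> hx; have : cvgn (fun n => x n + \sum_(k < n) m k).
    apply: (@nondecreasing_is_cvgn _ _).
      apply/nondecreasing_seqP => n; rewrite big_ord_recr /= addrCA.
      rewrite addrA (addrC (\sum_(_ < _) _)) -addrA -lerBlDl.
      by have := hx n; rewrite ler_norml => /andP[]; lra.
    exists (x 0%N + T + T) => _ [n _ <-]; apply: lerD => //.
    have : x n <= x 0%N + \sum_(k < n) m k.
      elim: n => [|n ih]; first by rewrite big_ord0 addr0.
      rewrite big_ord_recr /=; have := hx n; rewrite ler_norml => /andP[_].
      by move: ih; lra.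
    by move=> /le_trans; apply; rewrite lerD2l.
  set y := (fun n => _) => hy; exists (lim (y @ \oo) - T).
  rewrite (_ : x = (fun n => y n - \sum_(k < n) m k)); last first.
    by apply/funext => n; rewrite /y addrK.
  by apply: cvgB.
have [|lr hr] := part (fun n => complex.Re (u n)).
  move=> n; apply: le_trans (hu n); apply: le_trans (mod_Re _).
  by case: (u n.+1) (u n) => [? ?] [? ?].
have [|li hi] := part (fun n => complex.Im (u n)).
  move=> n; apply: le_trans (hu n); apply: le_trans (mod_Im _).
  by case: (u n.+1) (u n) => [? ?] [? ?].
exists (lr +i* li)%C => n; apply/ler_addgt0Pr => e e0.
have e2 : 0 < e / 2 by rewrite divr_gt0.
move: hr hi => /real_cvgP /(_ _ e2)[N1 h1] /real_cvgP /(_ _ e2)[N2 h2].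
pose N := maxn n (maxn N1 N2).
have nN : (n <= N)%N by rewrite leq_maxl.
have N1N : (N1 <= N)%N by rewrite /N maxnCA leq_maxl.
have N2N : (N2 <= N)%N by rewrite /N maxnA leq_maxr.
apply: (le_trans (mod_triangle _ (u N) _)); rewrite addrC; apply: lerD.
  by apply: (le_trans (dist n N nN)); rewrite lerD2r.
apply: (le_trans (mod_le_ReIm _)); rewrite [leRHS](splitr e); apply: lerD.
  by have := h1 N N1N; case: (u N) => [? ?] /= /ltW.
by have := h2 N N2N; case: (u N) => [? ?] /= /ltW.
Qed.

(** Taylor expansion of g at a with remainders bounded by T (2|x - a|/s)^K: for
    |x - a| < s/2 the series converges to g, and every truncation is a polynomial
    approximation. *)
Definition expands g a (s T : R) (c : nat -> C) := forall K x, modulus (x - a) <= s ->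
  modulus (g x - \sum_(k < K) c k * (x - a) ^+ k) <= T * (2 * modulus (x - a) / s) ^+ K.

(** Repeatedly subtracting the value at the centre and dividing by x - a costs
    a factor 2 / s each time by the maximum principle, as in the Schwarz lemma. Hence the
    expansion holds on half of the disc, with a radius that depends only on s. *)
Lemma hol_expands f a (s M : R) : 0 < s ->
  (forall x, modulus (x - a) <= s -> hol_at f x) ->
  (forall x, modulus (x - a) <= s -> modulus (f x) <= M) ->
  exists2 c : nat -> C, expands f a s M c & forall k, modulus (c k) <= M * (2 / s) ^+ k.
Proof.
move=> s0 hf fM.
pose good n (g : C -> C) := (forall x, modulus (x - a) <= s -> hol_at g x) /\
  (forall x, modulus (x - a) <= s -> modulus (g x) <= M * (2 / s) ^+ n).
have as' : modulus (a - a) <= s by rewrite subrr mod0 ltW.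
have step n g : {h | good n g -> good n.+1 h /\ forall x, g x = g a + (x - a) * h x}.
  apply: cid; have [[hg gM]|ng] := pselect (good n g); last by exists g => /ng.
  have h1 : hol_at (fun x => g x - g a) a by apply: holB; [exact: hg|exact: hol_cst].
  have [|h [hE ha hx]] := hol_factor h1; first by rewrite subrr.
  exists h => _; split; last by move=> x; rewrite -hE subrKC.
  have hh x : modulus (x - a) <= s -> hol_at h x.
    move=> xs; have [->//|xa] := eqVneq x a; apply: hx => //.
    by apply: holB; [exact: hg|exact: hol_cst].
  split=> //; have [c cs hc] := hol_max_principle s0 hh.
  move=> x /hc /le_trans; apply.
  rewrite -(ler_pM2l s0) -{1}cs -modM -hE.
  have -> : s * (M * (2 / s) ^+ n.+1) = M * (2 / s) ^+ n + M * (2 / s) ^+ n.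
    by rewrite exprS; move: ((2 / s) ^+ n) => X; field; rewrite gt_eqF.
  apply: (le_trans (modB_le _ _)); rewrite lerD //; last exact: gM.
  by apply: gM; rewrite cs.
pose F := fix F n : C -> C := if n is m.+1 then projT1 (step m (F m)) else f.
have FG n : good n (F n).
  elim: n => [|n ih]; first by split => // x /fM; rewrite expr0 mulr1.
  by rewrite /=; case: (step n (F n)) => h /= /(_ ih)[].
have FS n x : F n x = F n a + (x - a) * F n.+1 x.
  by have := FG n; rewrite /=; case: (step n (F n)) => h /= H /H[_ ->].
exists (fun k => F k a); last by move=> k; have [_] := FG k; apply.
move=> K x xs; have -> : f x - \sum_(k < K) F k a * (x - a) ^+ k = (x - a) ^+ K * F K x.
  elim: K => [|K ih]; first by rewrite big_ord0 subr0 mul1r.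
  by rewrite big_ord_recr opprD addrA ih (FS K x) exprSr; move: (F K.+1 x) => X; ring.
rewrite modM modX mulrC.
have [_ /(_ x xs) h] := FG K.
have -> : M * (2 * modulus (x - a) / s) ^+ K = M * (2 / s) ^+ K * modulus (x - a) ^+ K.
  by rewrite -[RHS]mulrA -exprMn mulrAC.
by rewrite ler_wpM2r // exprn_ge0 // mod_ge0.
Qed.

(** Weierstrass: a normally convergent series of holomorphic functions has
    a power series expansion, by summing the expansions of its terms. *)
Lemma hol_sum_expands (h : nat -> C -> C) (m : nat -> R) g a (s T : R) : 0 < s ->
  (forall n, 0 <= m n) -> (fun n => \sum_(k < n) m k) @ \oo --> T ->
  (forall n x, modulus (x - a) <= s -> hol_at (h n) x) ->
  (forall n x, modulus (x - a) <= s -> modulus (h n x) <= m n) ->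
  (forall n x, modulus (x - a) <= s ->
     modulus (g x - \sum_(k < n) h k x) <= T - \sum_(k < n) m k) ->
  exists c : nat -> C, expands g a s T c.
Proof.
move=> s0 m0 hT hh hm hg; have MT := partial_sum_le m0 hT.
have /choice[d hd] : forall n, exists d : nat -> C, expands (h n) a s (m n) d /\
    forall k, modulus (d k) <= m n * (2 / s) ^+ k.
  move=> n; have [||d d1 d2] := @hol_expands (h n) a s (m n) s0.
  - by move=> x; exact: hh.
  - by move=> x; exact: hm.
  - by exists d.
have q0 : 0 <= 2 / s by rewrite divr_ge0 // ltW.
have /choice[c hc] : forall k, exists l, forall n,
   modulus (l - \sum_(i < n) d i k) <= (T - \sum_(i < n) m i) * (2 / s) ^+ k.
  move=> k; have [|||l hl] := @summable_increments (fun n => \sum_(i < n) d i k)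
      (fun n => m n * (2 / s) ^+ k) (T * (2 / s) ^+ k).
  - by move=> n; rewrite mulr_ge0 // exprn_ge0.
  - rewrite (_ : (fun n => _) = (fun n => (\sum_(i < n) m i) * (2 / s) ^+ k)).
      by apply: cvgMl.
    by apply/funext => n; rewrite mulr_suml.
  - by move=> n; rewrite big_ord_recr /= addrAC subrr add0r; case: (hd n).
  by exists l => n; rewrite mulrBl mulr_suml.
exists c => K x xs; apply/ler_addgt0Pr => e e0.
pose W := 1 + \sum_(k < K) (2 / s) ^+ k * modulus (x - a) ^+ k.
have W0 : 0 < W.
  by rewrite ltr_wpDr // sumr_ge0 // => k _; rewrite mulr_ge0 ?exprn_ge0 ?mod_ge0.
have eW : 0 < e / W by rewrite divr_gt0.
move: (hT) => /real_cvgP /(_ _ eW)[N /(_ N (leqnn N))].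
rewrite ger0_norm ?subr_ge0 // ltr_pdivlMr // => hN.
set Q := \sum_(k < K) (\sum_(i < N) d i k) * (x - a) ^+ k.
set S := \sum_(k < K) c k * _.
have e1 : modulus (g x - \sum_(i < N) h i x) <= (T - \sum_(i < N) m i) * 1.
  by rewrite mulr1; exact: hg.
have e2 : modulus (\sum_(i < N) h i x - Q) <= T * (2 * modulus (x - a) / s) ^+ K.
  have -> : Q = \sum_(i < N) \sum_(k < K) d i k * (x - a) ^+ k.
    by rewrite exchange_big; apply: eq_bigr => k _; rewrite mulr_suml.
  rewrite -sumrB; apply: (le_trans (mod_sum_le _ _ _)).
  apply: (le_trans (_ : _ <= \sum_(i < N) m i * (2 * modulus (x - a) / s) ^+ K)).
    by apply: ler_sum => i _; have [hdi _] := hd i; exact: hdi.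
  by rewrite -mulr_suml ler_wpM2r // exprn_ge0 // divr_ge0 ?(ltW s0) // mulr_ge0 // mod_ge0.
have e3 : modulus (Q - S) <= (T - \sum_(i < N) m i) * \sum_(k < K) (2 / s) ^+ k * modulus (x - a) ^+ k.
  rewrite -sumrB; apply: (le_trans (mod_sum_le _ _ _)); rewrite mulr_sumr.
  apply: ler_sum => k _; rewrite -mulrBl modM modX mulrA ler_wpM2r ?exprn_ge0 ?mod_ge0 //.
  by rewrite mod_subC; exact: hc.
apply: (le_trans (mod_triangle _ Q _)).
apply: (le_trans (lerD (mod_triangle _ (\sum_(i < N) h i x) _) e3)).
apply: (le_trans (lerD (lerD e1 e2) (lexx _))).
by move: hN; rewrite /W mulrDr; lra.
Qed.

Lemma expands_analytic g : (forall a, unit_disc a ->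
    exists s T : R, 0 < s /\ exists c : nat -> C, expands g a s T c) -> analytic_in_disc g.
Proof.
move=> h a /h[s [T [s0 [c hc]]]]; exists (s / 2); first by rewrite divr_gt0.
exists c => z zs; apply/cvg_modP => e e0.
have zs' : modulus (z - a) <= s.
  by apply: (le_trans (ltW zs)); rewrite ler_pdivrMr // ler_pMr // ler1n.
pose q := 2 * modulus (z - a) / s.
have q0 : 0 <= q by rewrite divr_ge0 ?(ltW s0) // mulr_ge0 // mod_ge0.
have q1 : q < 1 by rewrite ltr_pdivrMr // mul1r mulrC -ltr_pdivlMr.
have T1 : 0 < `|T| + 1 by rewrite ltr_wpDl.
have [|N hN] := geometric_small q0 q1 (e := e / (`|T| + 1)); first by rewrite divr_gt0.
exists N => n /hN; rewrite ltr_pdivlMr // => hn.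
rewrite /series /= big_mkord; apply: (le_lt_trans (hc n z zs')).
apply: le_lt_trans hn; rewrite -/q mulrC ler_wpM2l ?exprn_ge0 //.
by apply: (le_trans (ler_norm _)); rewrite lerDl.
Qed.

Lemma expands_hol f a (s M : R) (c : nat -> C) : 0 < s -> 0 <= M ->
  expands f a s M c -> hol_at f a.
Proof.
move=> s0 M0 hc n; exists (\poly_(k < n) c k), (M * (2 / s) ^+ n).
  by rewrite mulr_ge0 ?exprn_ge0 // divr_ge0 // ltW.
exists s => // t ts; have := hc n (a + t); rewrite addrAC subrr add0r => /(_ (ltW ts)).
by rewrite horner_poly mulrAC exprMn mulrA.
Qed.

(** The terms of the series at a point t0 with |t0| = r/2 are bounded, by M say, so
    on a smaller disc the remainders are dominated by a geometric series. *)
Lemma series_expands f a (r : R) (c : nat -> C^o) : 0 < r ->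
  (forall z, modulus (z - a) < r ->
     series (fun n => c n * (z - a) ^+ n : C^o) @ \oo --> (f z : C^o)) ->
  exists M : R, 0 <= M /\ expands f a (r / 2 / 2) M c.
Proof.
move=> r0 h; have r2 : 0 < r / 2 by rewrite divr_gt0.
have [t0 t00 tE] := small_mod r2.
have t0r : modulus (a + t0 - a) < r by rewrite addrAC subrr add0r tE ltr_pdivrMr // ltr_pMr // ltr1n.
have [B B0 hB] : exists2 B : R, 0 <= B & forall n, modulus (c n) * (r / 2) ^+ n <= B.
  move: (h _ t0r) => /cvg_modP /(_ 1 ltr01)[N hN].
  pose S n := series (fun n => c n * (a + t0 - a) ^+ n : C^o) n.
  pose B := \sum_(k < N) (modulus (c k) * (r / 2) ^+ k).
  have B0 : 0 <= B by apply: sumr_ge0 => k _; rewrite mulr_ge0 ?exprn_ge0 ?mod_ge0 // ltW.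
  exists (B + 2); first by rewrite addr_ge0.
  move=> n; have [Nn|nN] := leqP N n; last first.
    rewrite /B (bigD1 (Ordinal nN)) //= -addrA lerDl addr_ge0 // sumr_ge0 // => k _.
    by rewrite mulr_ge0 ?exprn_ge0 ?mod_ge0 // ltW.
  have -> : modulus (c n) * (r / 2) ^+ n = modulus (S n.+1 - S n).
    rewrite /S /series /= big_nat_recr //= addrAC subrr add0r modM modX.
    by rewrite addrAC subrr add0r tE.
  have h1 := hN n.+1 (leqW Nn); have h2 := hN n Nn.
  apply: (le_trans (mod_triangle _ (f (a + t0)) _)).
  rewrite [modulus (S n.+1 - _)]mod_subC.
  have : modulus (f (a + t0) - S n.+1) + modulus (f (a + t0) - S n) <= 1 + 1.
    by apply: lerD; exact: ltW.
  by move=> /le_trans; apply; rewrite -[leLHS]add0r lerD.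
exists (2 * B); split; first by rewrite mulr_ge0.
have main K x N : modulus (x - a) <= r / 2 / 2 -> (K <= N)%N ->
   modulus (\sum_(k < N) c k * (x - a) ^+ k - \sum_(k < K) c k * (x - a) ^+ k)
     <= 2 * B * (modulus (x - a) / (r / 2)) ^+ K * (1 - 2^-1 ^+ (N - K)).
  move=> xs; pose q := modulus (x - a) / (r / 2).
  have q0 : 0 <= q by rewrite divr_ge0 ?mod_ge0 // ltW.
  have q2 : q <= 2^-1 by rewrite ler_pdivrMr // mulrC.
  elim: N => [|N ih].
    by rewrite leqn0 => /eqP ->; rewrite !subrr mod0 mulr0.
  rewrite leq_eqVlt => /predU1P[->|]; first by rewrite !subrr mod0 subnn expr0 subrr mulr0.
  rewrite ltnS => KN; rewrite big_ord_recr /= addrAC; apply: (le_trans (modD_le _ _)).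
  apply: (le_trans (lerD (ih KN) (lexx _))).
  have term : modulus (c N * (x - a) ^+ N) <= B * q ^+ K * 2^-1 ^+ (N - K).
    rewrite modM modX (_ : modulus (x - a) = (r / 2) * q); last first.
      by rewrite /q mulrC divfK // gt_eqF.
    rewrite exprMn mulrA -[leRHS]mulrA; apply: ler_pM (hB N) _.
    - by rewrite mulr_ge0 ?mod_ge0 // exprn_ge0 // ltW.
    - by rewrite exprn_ge0.
    rewrite -[in leLHS](subnKC KN) exprD ler_wpM2l ?exprn_ge0 //.
    by rewrite lerXn2r ?nnegrE // invr_ge0.
  apply: (le_trans (lerD (lexx _) term)).
  rewrite subSn // -/q exprS.
  rewrite -[2 * B * _]mulrA; move: (B * q ^+ K) (2^-1 ^+ (N - K)) => X Y.
  by lra.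
move=> K x xs; apply/ler_addgt0Pr => e e0.
have xr : modulus (x - a) < r.
  by apply: (le_lt_trans xs); lra.
move: (h _ xr) => /cvg_modP /(_ e e0)[N0 hN0].
pose N := maxn N0 K.
have h1 : modulus (f x - \sum_(k < N) c k * (x - a) ^+ k) < e.
  by have := hN0 N (leq_maxl _ _); rewrite /series /= big_mkord.
apply: (le_trans (mod_triangle _ (\sum_(k < N) c k * (x - a) ^+ k) _)).
rewrite addrC; apply: lerD (ltW h1).
apply: (le_trans (main K x N xs (leq_maxr _ _))).
apply: (le_trans (_ : _ <= 2 * B * (modulus (x - a) / (r / 2)) ^+ K)).
  rewrite ler_piMr ?gerBl ?exprn_ge0 ?invr_ge0 // !mulr_ge0 // exprn_ge0 //.
  by rewrite divr_ge0 ?mod_ge0 // ltW.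
have r20 := ltW r2; have xa0 := mod_ge0 (x - a).
apply: ler_wpM2l; first exact: mulr_ge0.
apply: lerXn2r; rewrite ?nnegrE.
- exact: divr_ge0.
- by apply: divr_ge0; [exact: mulr_ge0|exact: divr_ge0].
rewrite ler_pdivlMr ?divr_gt0 //.
have -> : modulus (x - a) / (r / 2) * (r / 2 / 2) = modulus (x - a) / 2.
  by rewrite mulrA divfK // gt_eqF.
by have := mod_ge0 (x - a); lra.
Qed.

Lemma analytic_hol f a : analytic_in_disc f -> unit_disc a -> hol_at f a.
Proof.
move=> hf a1; have [r r0 [c hc]] := hf a a1.
have [M [M0 hM]] := series_expands r0 hc.
by apply: expands_hol hM => //; rewrite !divr_gt0.
Qed.

Lemma disc_room a : unit_disc a -> exists2 s : R, 0 < s &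
  forall x, modulus (x - a) <= s -> unit_disc x.
Proof.
move=> a1; have h : 0 < 1 - modulus a by rewrite subr_gt0.
exists ((1 - modulus a) / 2); first by rewrite divr_gt0.
move=> x xs; have := modD_le (x - a) a; rewrite subrK => h1.
by rewrite /unit_disc /=; move: h xs h1; lra.
Qed.

Lemma hol_analytic f : (forall a, unit_disc a -> hol_at f a) -> analytic_in_disc f.
Proof.
move=> hf; apply: expands_analytic => a a1.
have [s s0 hs] := disc_room a1.
have hfs x : modulus (x - a) <= s -> hol_at f x by move=> /hs/hf.
have [c _ hc] := @disc_max R (fun x => modulus (f x)) a s (ltW s0)
  (fun x xs => hol_cont_mod (hfs x xs)).
have [d hd _] := hol_expands s0 hfs hc.
by exists s, (modulus (f c)); split => //; exists d.
Qed.

Lemma analyticP f : analytic_in_disc f <-> forall a, unit_disc a -> hol_at f a.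
Proof. by split; [move=> h a; exact: analytic_hol|exact: hol_analytic]. Qed.
End PowerSeries.

(** * Orders of vanishing *)
Section Orders.
Variable R : realType.
Local Notation C := R[i].
Implicit Types (a b c t x : C) (f g h F G : C -> C).

(** The order is read off the size of |F| near b.  This form passes to products,
    quotients and limits between two multiples of a function, and it determines
    zero_order by division (ord_at_zero_order). *)
Definition ord_at F b (k : nat) := exists d L : R, [/\ 0 < d, 0 <= L & near0 (fun t =>
  t != 0 -> d * modulus t ^+ k <= modulus (F (b + t)) <= L * modulus t ^+ k)].

Lemma ord_at_ext F G b k : near0 (fun t => t != 0 -> F (b + t) = G (b + t)) ->
  ord_at F b k -> ord_at G b k.
Proof.
move=> hE [d [L [d0 L0 h]]]; exists d, L; split => //.
by apply: (near0_sub (near0_and hE h)) => t [h1 h2] t0; rewrite -h1 // h2.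
Qed.

Lemma ord_atM F G b k l : ord_at F b k -> ord_at G b l ->
  ord_at (fun x => F x * G x) b (k + l).
Proof.
move=> [d [L [d0 L0 h]]] [d' [L' [d0' L0' h']]].
exists (d * d'), (L * L'); split; [exact: mulr_gt0|exact: mulr_ge0|].
apply: (near0_sub (near0_and h h')) => t [h1 h2] t0.
have /andP[a1 a2] := h1 t0; have /andP[b1 b2] := h2 t0.
have tk m : 0 <= modulus t ^+ m by rewrite exprn_ge0 // mod_ge0.
by rewrite exprD modM mulrACA (mulrACA L) !ler_pM ?mulr_ge0 ?mod_ge0 // ltW.
Qed.

Lemma ord_at_hol F b : hol_at F b -> F b != 0 -> ord_at F b 0.
Proof.
move=> hF Fb; have := @approx_nonzero _ (fun t => F (b + t)) (hF 1%N).
rewrite addr0 => /(_ Fb) h1.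
have [K K0 hK] := approx_bounded (hF 1%N).
exists (modulus (F b) / 2), K; split; first by rewrite divr_gt0 ?mod_gt0.
  exact: K0.
by apply: (near0_sub (near0_and h1 hK)) => t [h2 h3] _; rewrite !expr0 !mulr1 h2.
Qed.

Lemma ord_at_sub b : ord_at (fun x => x - b) b 1.
Proof.
exists 1, 1; split=> //; apply: near0W => t _.
by rewrite (addrC b) addrK !expr1 !mul1r !lexx.
Qed.

Lemma ord_at_exp b n : ord_at (fun x => (x - b) ^+ n) b n.
Proof.
exists 1, 1; split=> //; apply: near0W => t _.
by rewrite (addrC b) addrK modX !mul1r !lexx.
Qed.

Lemma ord_at_div F G b (N c : nat) : ord_at (fun x => F x * G x) b N -> ord_at F b c ->
  (c <= N)%N -> ord_at G b (N - c).
Proof.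
move=> [d [L [d0 L0 h]]] [d' [L' [d0' L0' h']]] cN.
have L1 : 0 < L' + 1 by rewrite ltr_wpDl.
exists (d / (L' + 1)), (L / d'); split; first by rewrite divr_gt0.
  by rewrite divr_ge0 // ltW.
apply: (near0_sub (near0_and h h')) => t [h1 h2] t0.
have /andP[a1 a2] := h1 t0; have /andP[b1 b2] := h2 t0.
have tp m : 0 < modulus t ^+ m by rewrite exprn_gt0 // mod_gt0.
rewrite modM -(subnK cN) exprD mulrA in a1; rewrite modM -(subnK cN) exprD mulrA in a2.
rewrite mulrAC ler_pdivrMr // mulrAC ler_pdivlMr //; apply/andP; split.
  rewrite -(ler_pM2r (tp c)); apply: (le_trans a1); rewrite mulrC -mulrA ler_wpM2l ?mod_ge0 //.
  by apply: (le_trans b2); rewrite ler_wpM2r ?(ltW (tp c)) // lerDl.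
rewrite -(ler_pM2r (tp c)); apply: le_trans a2; rewrite -mulrA [leRHS]mulrC.
by rewrite ler_wpM2l ?mod_ge0.
Qed.

Lemma ord_at_prod (I : Type) (s : seq I) (F : I -> C -> C) (k : I -> nat) b :
  (forall i, ord_at (F i) b (k i)) ->
  ord_at (fun x => \prod_(i <- s) F i x) b (\sum_(i <- s) k i)%N.
Proof.
move=> h; elim: s => [|i s ih].
  apply: (@ord_at_ext (fun=> 1)); first by apply: near0W => t; rewrite big_nil.
  by rewrite big_nil; apply: ord_at_hol; [exact: hol_cst|exact: oner_neq0].
rewrite big_cons; apply: ord_at_ext (ord_atM (h i) ih).
by apply: near0W => t; rewrite big_cons.
Qed.

(** The value at b itself is only constrained through continuity. *)
Lemma ord_at_vanish G b k : hol_at G b -> ord_at G b k.+1 -> G b = 0.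
Proof.
move=> hG [d [L [d0 L0 h]]]; have [K K0 hK] := hol_lipschitz hG.
apply: (@near0_lin_eq0 _ _ (L + K)); first exact: addr_ge0.
apply: (near0_sub (near0_and (near0_and h hK) (near0_lt ltr01))).
move=> t [[h1 h2] t1] t0; have /andP[_ h3] := h1 t0.
rewrite -[G b](subKr (G (b + t))) mulrDl; apply: (le_trans (modB_le _ _)).
apply: lerD => //; apply: (le_trans h3); rewrite ler_wpM2l // exprS.
by rewrite ler_piMr ?mod_ge0 // exprn_ile1 ?mod_ge0 // ltW.
Qed.

Lemma ord_at_nonzero G b : hol_at G b -> ord_at G b 0 -> G b != 0.
Proof.
move=> hG [d [L [d0 L0 h]]]; apply/eqP => Gb.
have [K K0 hK] := hol_lipschitz hG.
suff : (d%:C)%C = 0 :> C by move=> [] /eqP; rewrite gt_eqF.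
apply: (near0_lin_eq0 K0); apply: (near0_sub (near0_and h hK)) => t [h1 h2] t0.
have /andP[h3 _] := h1 t0; rewrite expr0 mulr1 in h3.
by rewrite Gb subr0 in h2; rewrite modR gtr0_norm //; exact: le_trans h3 h2.
Qed.

Lemma near0_unit_disc b : unit_disc b -> near0 (fun t => unit_disc (b + t)).
Proof.
move=> /disc_room[s s0 hs]; exists s => // t ts; apply: hs.
by rewrite addrAC subrr add0r ltW.
Qed.

Lemma zero_order_ord_at f b n : unit_disc b -> zero_order f b n -> ord_at f b n.
Proof.
move=> b1 [h [/analyticP hh hb] hE].
have := ord_atM (ord_at_exp b n) (ord_at_hol (hh b b1) hb); rewrite addn0.
apply: ord_at_ext; apply: (near0_sub (near0_unit_disc b1)) => t ht _.
by rewrite hE.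
Qed.

Lemma ord_at_zero_order f b n : analytic_in_disc f -> unit_disc b ->
  ord_at f b n -> zero_order f b n.
Proof.
move=> + b1; elim: n f => [|n ih] f /analyticP hf hn.
  exists f; first by split; [exact/analyticP|exact: ord_at_nonzero (hf b b1) hn].
  by move=> z _; rewrite expr0 mul1r.
have [g [fE gb gx]] := hol_factor (hf b b1) (ord_at_vanish (hf b b1) hn).
have ga : analytic_in_disc g.
  by apply/analyticP => x x1; have [->//|xb] := eqVneq x b; apply: gx => //; exact: hf.
have [|h hh hE] := ih g ga.
  rewrite -[n]/(n.+1.-1) -subn1.
  apply: ord_at_div (ord_at_sub b) _ => //; apply: ord_at_ext hn.
  by apply: near0W => t _; exact: fE.
by exists h => // z z1; rewrite fE hE // exprS mulrA.
Qed.
End Orders.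

(** * Blaschke factors and division by them *)
Section Blaschke.
Variable R : realType.
Local Notation C := R[i].
Implicit Types (a b c t x : C) (f g h : C -> C) (z : nat -> option C).

Definition bfac (o : option C) x := if o is Some a then blaschke_factor a x else 1.

Definition bcst a : C := if a == 0 then 1 else conjc a / ((modulus a)%:C)%C.

Lemma mod_bcst a : modulus (bcst a) = 1.
Proof.
rewrite /bcst; case: eqVneq => [_|a0]; first exact: mod1.
by rewrite mod_div modJ modR ger0_norm ?mod_ge0 // divff // mod_eq0.
Qed.

Lemma bcst_neq0 a : bcst a != 0.
Proof. by rewrite -mod_gt0 mod_bcst. Qed.

Lemma mod_blaschke a x : modulus (blaschke_factor a x) = modulus (disc_aut a x).
Proof. by rewrite /blaschke_factor modM -/(bcst a) mod_bcst mul1r. Qed.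

Lemma hol_disc_aut a x : unit_disc a -> modulus x <= 1 -> hol_at (disc_aut a) x.
Proof.
move=> a1 x1; apply: hol_div; last exact: one_sub_conjM_neq0.
  by apply: holB; [exact: hol_cst|exact: hol_id].
apply: holB; first exact: hol_cst.
by apply: holM; [exact: hol_cst|exact: hol_id].
Qed.

Lemma hol_blaschke a x : unit_disc a -> unit_disc x -> hol_at (blaschke_factor a) x.
Proof.
by move=> a1 x1; apply: holM; [exact: hol_cst|apply: hol_disc_aut => //; exact: ltW].
Qed.

Lemma blaschke_lt1 a x : unit_disc a -> unit_disc x -> modulus (blaschke_factor a x) < 1.
Proof. by move=> a1 x1; rewrite mod_blaschke; exact: disc_aut_in. Qed.

Lemma blaschke_neq0 a b : unit_disc a -> unit_disc b -> a != b -> blaschke_factor a b != 0.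
Proof.
move=> a1 b1 ab; rewrite -mod_gt0 mod_blaschke mod_gt0 /disc_aut.
by rewrite mulf_neq0 ?subr_eq0 // invr_neq0 // one_sub_conjM_neq0 // ltW.
Qed.

Lemma ord_at_blaschke a : unit_disc a -> ord_at (blaschke_factor a) a 1.
Proof.
move=> a1; pose u x := - (bcst a / (1 - conjc a * x)).
have n0 : 1 - conjc a * a != 0 by exact: one_sub_conjM_neq0 a1 (ltW a1).
have hu : hol_at u a.
  apply: holN; apply: hol_div => //; first exact: hol_cst.
  apply: holB; first exact: hol_cst.
  by apply: holM; [exact: hol_cst|exact: hol_id].
have ua : u a != 0 by rewrite oppr_eq0 mulf_neq0 ?bcst_neq0 ?invr_neq0.
have := ord_atM (ord_at_sub a) (ord_at_hol hu ua); rewrite addn0.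
apply: ord_at_ext; apply: near0W => t _.
by rewrite /u /blaschke_factor -/(bcst a) /disc_aut; ring.
Qed.

(** The unimodular constant makes B_a tend to 1 as |a| tends to 1:
    1 - B_a(x) = (1 - |a|)(|a| + conj(a) x) / (|a| (1 - conj(a) x)). *)
Lemma one_sub_blaschke a x : unit_disc a -> unit_disc x ->
  modulus (1 - blaschke_factor a x) <= 2 * (1 - modulus a) / (1 - modulus x).
Proof.
move=> a1 x1; have x0 : 0 < 1 - modulus x by rewrite subr_gt0.
have n0 := one_sub_conjM_neq0 a1 (ltW x1).
have np : 0 < modulus (1 - conjc a * x) by rewrite mod_gt0.
have nge := one_sub_conjM_ge x (ltW a1).
have [->|a0] := eqVneq a 0.
  rewrite /blaschke_factor eqxx mul1r /disc_aut rmorph0 mul0r subr0 divr1 sub0r opprK.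
  rewrite mod0 subr0 mulr1 ler_pdivlMr //; apply: (le_trans (_ : _ <= 2 * 1)); last by rewrite mulr1.
  rewrite ler_pM ?mod_ge0 ?(ltW x0) //; last by rewrite gerBl mod_ge0.
  by apply: (le_trans (modD_le _ _)); rewrite mod1 (_ : 2 = 1 + 1) // lerD2l ltW.
have ma : 0 < modulus a by rewrite mod_gt0.
have mc : ((modulus a)%:C)%C != 0 :> C by rewrite -mod_gt0 modR gtr0_norm.
have E : 1 - blaschke_factor a x =
    ((1 - modulus a)%:C)%C * (((modulus a)%:C)%C + conjc a * x) /
     (((modulus a)%:C)%C * (1 - conjc a * x)).
  have h := conj_mul a; rewrite rmorphXn /= in h.
  rewrite /blaschke_factor (negbTE a0) /disc_aut rmorphB /= (rmorph1 (@real_complex R)).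
  have -> : conjc a / ((modulus a)%:C)%C * ((a - x) / (1 - conjc a * x)) =
     (conjc a * a - conjc a * x) / (((modulus a)%:C)%C * (1 - conjc a * x)).
    by field; rewrite n0.
  rewrite h; move: ((modulus a)%:C)%C mc => m m0 {h}.
  by field; rewrite n0 m0.
rewrite E mod_div !modM !modR (gtr0_norm ma) ger0_norm ?subr_ge0 ?(ltW a1) //.
rewrite ler_pdivrMr ?mulr_gt0 // mulrAC ler_pdivlMr // -!mulrA (mulrCA 2).
rewrite ler_wpM2l ?subr_ge0 ?(ltW a1) //.
rewrite mulrA ler_pM ?mod_ge0 ?(ltW x0) //.
apply: (le_trans (modD_le _ _)); rewrite modR gtr0_norm // modM modJ mulr_natl mulr2n.
by rewrite lerD2l ler_piMr ?mod_ge0 // ltW.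
Qed.

Definition occ_below z b n := [seq k <- iota 0 n | z k == Some b].

Lemma size_occ_belowS z b n :
  size (occ_below z b n.+1) = (size (occ_below z b n) + (z n == Some b))%N.
Proof.
rewrite /occ_below -addn1 iotaD filter_cat size_cat add0n /=.
by case: eqP.
Qed.

Lemma size_occ_below z b n :
  size (occ_below z b n) = (\sum_(k <- index_enum 'I_n) (z k == Some b))%N.
Proof.
elim: n => [|n ih]; first by rewrite big_ord0.
by rewrite size_occ_belowS big_ord_recr /= -ih.
Qed.

Lemma card_seq (s : seq nat) : uniq s -> ([set` s] #= `I_(size s))%card.
Proof.
move=> u; have -> : [set` s] = [set` [fset k in s]%fset].
  by apply/seteqP; split => k /=; rewrite in_fset.
by apply/card_eq_fsetP; rewrite card_fseq undup_id.
Qed.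

Lemma card_occ_below z b n : ([set` occ_below z b n] #= `I_(size (occ_below z b n)))%card.
Proof. by apply: card_seq; rewrite filter_uniq // iota_uniq. Qed.

Lemma occ_below_sub z b n : [set` occ_below z b n] `<=` occurrences z b.
Proof. by move=> k /=; rewrite mem_filter => /andP[/eqP]. Qed.

Lemma size_occ_below_le z b n N : (occurrences z b #<= `I_N)%card ->
  (size (occ_below z b n) <= N)%N.
Proof.
move=> h; rewrite -card_le_II -(card_le_eql (card_occ_below z b n)).
exact: card_le_trans (subset_card_le (@occ_below_sub z b n)) h.
Qed.

(** The occurrences of b are finitely many, so they all lie below some index. *)
Lemma occ_below_total z b N : (occurrences z b #<= `I_N)%card ->
  exists n0, forall n, (n0 <= n)%N -> [set` occ_below z b n] = occurrences z b.
Proof.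
move=> h; have : finite_set (occurrences z b) by apply/finite_set_leP; exists N.
move=> /finite_fsetP[X hX]; exists (\max_(k <- X) k.+1)%N => n hn.
apply/seteqP; split; first exact: occ_below_sub.
move=> k kz /=; rewrite mem_filter mem_iota /= add0n kz eqxx /=.
apply: leq_trans hn; apply: (@leq_bigmax_seq _ _ xpredT (fun k => k.+1)) => //.
by have : [set` X] k by rewrite -hX.
Qed.

Definition bprod z n x := \prod_(k < n) bfac (z k) x.

Lemma hol_bfac z k x : in_disc z -> unit_disc x -> hol_at (bfac (z k)) x.
Proof.
move=> hz x1; case E : (z k) => [a|]; last exact: hol_cst.
by apply: hol_blaschke => //; exact: hz E.
Qed.

Lemma ord_at_bfac z k b : in_disc z -> unit_disc b -> ord_at (bfac (z k)) b (z k == Some b).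
Proof.
move=> hz b1; case E : (z k) => [a|]; last first.
  by apply: ord_at_hol; [exact: hol_cst|exact: oner_neq0].
have a1 := hz _ _ E; have [->|ab] := eqVneq a b; first by rewrite eqxx; exact: ord_at_blaschke.
rewrite (_ : (Some a == Some b) = false); last by apply/negbTE; apply: contra ab => /eqP[->].
by apply: ord_at_hol; [exact: hol_blaschke|exact: blaschke_neq0].
Qed.

Lemma ord_at_bprod z n b : in_disc z -> unit_disc b ->
  ord_at (bprod z n) b (size (occ_below z b n)).
Proof.
by move=> hz b1; rewrite size_occ_below; apply: ord_at_prod => k; exact: ord_at_bfac.
Qed.

Lemma dependent_choice (T : Type) (P : nat -> T -> Prop) (Q : nat -> T -> T -> Prop) (x0 : T) :
  P 0%N x0 -> (forall n (u : T), P n u -> exists v, P n.+1 v /\ Q n u v) ->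
  exists u : nat -> T, u 0%N = x0 /\ forall n, P n (u n) /\ Q n (u n) (u n.+1).
Proof.
move=> h0 hS.
have step n (x : T) : {y | P n x -> P n.+1 y /\ Q n x y}.
  apply: cid; have [/hS[y]|nP] := pselect (P n x); first by exists y.
  by exists x => /nP.
pose u := fix u n := if n is m.+1 then projT1 (step m (u m)) else x0.
have uP n : P n (u n).
  by elim: n => //= n ih; case: (step n (u n)) => y /= /(_ ih)[].
exists u; split=> // n; split=> //.
by have := uP n; rewrite /=; case: (step n (u n)) => y /= H /H[].
Qed.

(** Dividing out the factors one at a time: the next point of the sequence is
    still a zero of the quotient, because the order of the product of the factors
    used so far is the number of its occurrences met so far. *)
Lemma bprod_quotients f z : analytic_in_disc f -> zero_subset f z ->
  exists G : nat -> C -> C,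
    [/\ forall n x, unit_disc x -> hol_at (G n) x,
        forall n x, unit_disc x -> G n x = G n.+1 x * bfac (z n) x &
        forall n x, unit_disc x -> f x = G n x * bprod z n x].
Proof.
move=> /analyticP hf [zD hz].
pose P n G := (forall x, unit_disc x -> hol_at G x) /\
   (forall x, unit_disc x -> f x = G x * bprod z n x).
pose Q n (G G' : C -> C) := forall x, unit_disc x -> G x = G' x * bfac (z n) x.
have [||G [_ hG]] := @dependent_choice _ P Q f; last first.
- by exists G; split => n x x1; case: (hG n) => -[h1 h2] h3; [exact: h1|exact: h3|exact: h2].
- move=> n G [hG fE].
  case E : (z n) => [b|]; last first.
    exists G; split; last by move=> x _; rewrite E mulr1.
    by split=> // x x1; rewrite /bprod big_ord_recr /= E mulr1 fE.
  have b1 := zD _ _ E; have [N hN hocc] := hz b b1.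
  have hc : (size (occ_below z b n) < N)%N.
    by have := size_occ_below_le n.+1 hocc; rewrite size_occ_belowS E eqxx addn1.
  have Gb : G b = 0.
    apply: (@ord_at_vanish _ _ _ (N - size (occ_below z b n)).-1); first exact: hG.
    rewrite prednK ?subn_gt0 //; apply: (@ord_at_div _ (bprod z n)) (ltnW hc).
      apply: ord_at_ext (zero_order_ord_at b1 hN).
      by apply: (near0_sub (near0_unit_disc b1)) => t /fE -> _; rewrite mulrC.
    exact: ord_at_bprod.
  have [g [gE gb gx]] := hol_factor (hG b b1) Gb.
  have gD x : unit_disc x -> hol_at g x.
    by move=> x1; have [->//|xb] := eqVneq x b; apply: gx => //; exact: hG.
  exists (fun x => g x * (- (1 - conjc b * x) / bcst b)); split.
    split=> [x x1|x x1].
      apply: holM; first exact: gD.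
      apply: hol_div; [|exact: hol_cst|exact: bcst_neq0].
      apply: holN; apply: holB; first exact: hol_cst.
      by apply: holM; [exact: hol_cst|exact: hol_id].
    rewrite /bprod big_ord_recr /= E fE // gE /= /blaschke_factor -/(bcst b) /disc_aut /bprod.
    have n0 := one_sub_conjM_neq0 b1 (ltW x1).
    by move: (\prod_(k < n) _) => W; field; rewrite n0 bcst_neq0.
  move=> x x1; rewrite E gE /= /blaschke_factor -/(bcst b) /disc_aut.
  have n0 := one_sub_conjM_neq0 b1 (ltW x1).
  by field; rewrite n0 bcst_neq0.
- by split=> // x x1; rewrite /bprod big_ord0 mulr1.
Qed.
End Blaschke.

(** * Jensen's inequality on a pseudohyperbolic circle *)
Section Jensen.
Variable R : realType.
Local Notation C := R[i].
Implicit Types (a b c t x : C) (f g h G : C -> C) (z : nat -> option C).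

(** On the circle of radius s this has the modulus of the Moebius map of b;
    for |b| < s the zero has been reflected away through that circle. *)
Definition reflected (s : R) b x : C :=
  if s <= modulus b then disc_aut b x
  else (((s ^+ 2)%:C)%C - conjc b * x) / ((s%:C)%C * (1 - conjc b * x)).

Lemma hol_reflected (s : R) b x : 0 < s -> unit_disc b -> modulus x <= 1 ->
  hol_at (reflected s b) x.
Proof.
move=> s0 b1 x1; rewrite /reflected; case: leP => h; first exact: hol_disc_aut.
have hl (k : C) : hol_at (fun x => k - conjc b * x) x.
  apply: holB; first exact: hol_cst.
  by apply: holM; [exact: hol_cst|exact: hol_id].
apply: hol_div => //; first by apply: holM => //; exact: hol_cst.
by rewrite mulf_neq0 ?one_sub_conjM_neq0 // -mod_gt0 modR gtr0_norm.
Qed.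

(** At the centre a reflected factor has modulus s: these values give the
    max (|b|, s) of Jensen's inequality. *)
Lemma reflected0 (s : R) b : 0 < s -> modulus (reflected s b 0) = Num.max (modulus b) s.
Proof.
move=> s0; rewrite /reflected; case: leP => h; first by rewrite disc_aut0.
rewrite !mulr0 !subr0 mulr1 mod_div !modR normrX gtr0_norm //.
by rewrite expr2 mulfK // gt_eqF.
Qed.

Lemma reflected_circle (s : R) b x : 0 < s -> modulus x = s ->
  modulus (reflected s b x) = modulus (disc_aut b x).
Proof.
move=> s0 xs; rewrite /reflected; case: leP => // h.
rewrite /disc_aut !mod_div modM modR gtr0_norm //.
have -> : ((s ^+ 2)%:C)%C - conjc b * x = conjc (x - b) * x.
  by rewrite -xs -conj_mul rmorphB /= mulrBl.
rewrite modM modJ xs mod_subC (mulrC s) -mulrA; congr (_ * _).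
by rewrite invfM mulrCA divff ?gt_eqF // mulr1.
Qed.

(** A form of Jensen's formula with the mean replaced by the maximum: the
    maximum principle for the quotient with its zeros in the smaller disc
    reflected. *)
Lemma jensen_max f G z n a (s : R) : in_disc z -> unit_disc a -> 0 < s -> s < 1 ->
  (forall x, unit_disc x -> hol_at G x) ->
  (forall x, unit_disc x -> f x = G x * bprod z n x) ->
  exists xi, [/\ unit_disc xi, modulus (disc_aut a xi) = s &
    modulus (G a) * \prod_(k < n) Num.max (modulus (bfac (z k) a)) s <= modulus (f xi)].
Proof.
move=> zD a1 s0 s1 hG fE.
pose th k x := if z k is Some c then reflected s (disc_aut a c) x else 1.
pose Phi x := G (disc_aut a x) * \prod_(k < n) th k x.
have hPhi x : modulus (x - 0) <= s -> hol_at Phi x.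
  rewrite subr0 => xs; have x1 : unit_disc x by exact: le_lt_trans xs s1.
  apply: holM.
    apply: (@hol_comp _ G (disc_aut a)); first by apply: hol_disc_aut => //; exact: ltW.
    by apply: hG; exact: disc_aut_in.
  apply: hol_prod => k; rewrite /th; case E : (z (nat_of_ord k)) => [c|]; last exact: hol_cst.
  by apply: hol_reflected (ltW x1) => //; apply: disc_aut_in => //; exact: zD E.
have [x + hx] := hol_max_principle s0 hPhi; rewrite subr0 => xs.
have x1 : unit_disc x by rewrite /unit_disc /= xs.
have xi1 := disc_aut_in a1 x1.
exists (disc_aut a x); split => //; first by rewrite disc_autK.
have := hx 0; rewrite subr0 mod0 => /(_ (ltW s0)).
rewrite /Phi disc_aut0 !modM !mod_prod => h.
apply: le_trans (_ : _ <= modulus (G a) * \prod_(k < n) modulus (th k 0)) _.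
  rewrite ler_wpM2l ?mod_ge0 // le_eqVlt; apply/orP; left; apply/eqP; apply: eq_bigr => k _.
  rewrite /th /bfac; case E : (z (nat_of_ord k)) => [c|].
    by rewrite reflected0 // mod_blaschke mod_disc_autC.
  by rewrite mod1 max_l // ltW.
apply: (le_trans h); rewrite fE // modM /bprod mod_prod.
rewrite ler_wpM2l ?mod_ge0 // le_eqVlt; apply/orP; left; apply/eqP; apply: eq_bigr => k _.
rewrite /th /bfac; case E : (z (nat_of_ord k)) => [c|//].
have c1 := zD _ _ E.
by rewrite reflected_circle // mod_blaschke -(disc_aut_invariant a1 c1 xi1) disc_autK.
Qed.
End Jensen.

(** * Geometric mean over the radii *)
Section Levels.
Variable R : realType.
Implicit Types (x r p t : R).

(** Radii tending to 1 geometrically, the ratio 4 being the square of the ratio 2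
    of the weights 2^-(i+1) that they receive. *)
Definition lvl i : R := 1 - 4^-1 ^+ i.+1.

Lemma lvl_gt0 i : 0 < lvl i.
Proof. by rewrite subr_gt0 exprn_ilt1 // invf_lt1 // ltr1n. Qed.

Lemma lvl_lt1 i : lvl i < 1.
Proof. by rewrite ltrBlDr ltrDl exprn_gt0 // invr_gt0. Qed.

Lemma geometric_half M : \sum_(i < M) (2^-1 : R) ^+ i.+1 = 1 - 2^-1 ^+ M.
Proof.
elim: M => [|M ih]; first by rewrite big_ord0 expr0 subrr.
rewrite big_ord_recr /= ih exprS; move: (2^-1 ^+ M) => X.
by rewrite -[in RHS](subrK (2^-1 * X) X); lra.
Qed.

Lemma geometric_half_weighted M :
  \sum_(i < M) (2^-1 : R) ^+ i.+1 * i.+1%:R <= 2.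
Proof.
suff -> : \sum_(i < M) (2^-1 : R) ^+ i.+1 * i.+1%:R = 2 - 2^-1 ^+ M * (M%:R + 2).
  by rewrite gerBl mulr_ge0 ?exprn_ge0 ?invr_ge0 // addr_ge0.
elim: M => [|M ih]; first by rewrite big_ord0 expr0 add0r mul1r subrr.
rewrite big_ord_recr /= ih exprS -[M.+1%:R]natr1; move: (2^-1 ^+ M) (M%:R) => X Y.
by lra.
Qed.

Lemma geometric_eighth M : \sum_(i < M) (8^-1 : R) ^+ i.+1 <= 7^-1.
Proof.
suff -> : \sum_(i < M) (8^-1 : R) ^+ i.+1 = 7^-1 - 7^-1 * 8^-1 ^+ M.
  by rewrite gerBl mulr_ge0 ?exprn_ge0 ?invr_ge0.
elim: M => [|M ih]; first by rewrite big_ord0 expr0 mulr1 subrr.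
by rewrite big_ord_recr /= ih exprS; move: (8^-1 ^+ M) => X; lra.
Qed.

(** Here r^2 = 1 - x is the deficit.  The levels with 4^-(i+1) < r^2 are cut off;
    they have total weight about r, whence a gain of order r^3.  The induction
    peels off the first level: replacing r by 2 r shifts the levels by one. *)
Lemma min_sum_le M r : 0 <= r -> r <= 1 ->
  \sum_(i < M) 2^-1 ^+ i.+1 * Num.min (r ^+ 2) (4^-1 ^+ i.+1) <= r ^+ 2 - 6 / 7 * r ^+ 3.
Proof.
elim: M r => [|M ih] r r0 r1.
  rewrite big_ord0 exprS; have : 0 <= r ^+ 2 * (1 - 6 / 7 * r).
    by rewrite mulr_ge0 ?sqr_ge0 //; lra.
  by rewrite exprSr; lra.
have [r2|r2] := leP r 2^-1; last first.
  apply: (le_trans (_ : _ <= \sum_(i < M.+1) 8^-1 ^+ i.+1)).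
    apply: ler_sum => i _; have -> : (8^-1 : R) = 2^-1 * 4^-1 by rewrite -invfM -natrM.
    by rewrite exprMn ler_wpM2l ?exprn_ge0 ?invr_ge0 // ge_min lexx orbT.
  apply: (le_trans (geometric_eighth _)).
  have : 0 <= (1 - r) * (2 * r - 1) * (3 * r + 1).
    by rewrite !mulr_ge0 //; lra.
  by rewrite !exprS expr0; lra.
rewrite big_ord_recl.
have -> : \sum_(i < M) (2^-1 : R) ^+ (lift ord0 i).+1 * Num.min (r ^+ 2) (4^-1 ^+ (lift ord0 i).+1)
   = 8^-1 * \sum_(i < M) 2^-1 ^+ i.+1 * Num.min ((2 * r) ^+ 2) (4^-1 ^+ i.+1).
  rewrite mulr_sumr; apply: eq_bigr => i _.
  rewrite lift0 exprS -[in LHS](mulKf (x := 4) _ (Num.min _ _)) // minr_pMr //.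
  rewrite (exprS _ i.+1) mulVKf // exprMn (_ : 2 ^+ 2 = 4 :> R); last by rewrite -natrX.
  by rewrite mulrACA -invfM -natrM.
have m1 : Num.min (r ^+ 2) (4^-1 ^+ 1) = r ^+ 2.
  apply: min_l; rewrite expr1 (_ : 4^-1 = 2^-1 ^+ 2); last by rewrite exprVn -natrX.
  by rewrite lerXn2r ?nnegrE ?invr_ge0.
have := ih (2 * r); rewrite mulr_ge0 // => /(_ erefl) h.
have {h} := h _; rewrite /= m1 expr1 !exprS expr0 => h.
have h2 : 2 * r <= 1 by lra.
by move: (h h2); lra.
Qed.

(** With d = 1 - x and M large, both sides are - d to first order.  The levels below x leave
    ln x, while those above x replace ln x by a smaller loss, which gains a multiple
    of d^(3/2); this absorbs the discrepancies of order d^2 between - ln (2 - x),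
    - d and ln x. *)
Lemma sum_ln_max_ge M x : 0 <= x -> x <= 1 ->
  - ln (2 - x) <= \sum_(i < M) 2^-1 ^+ i.+1 * ln (Num.max x (lvl i)).
Proof.
move=> x0 x1; pose r := Num.sqrt (1 - x).
have t0 : 0 <= 1 - x by rewrite subr_ge0.
have rE : r ^+ 2 = 1 - x by rewrite sqr_sqrtr.
have r0 : 0 <= r by exact: sqrtr_ge0.
have r1 : r <= 1 by rewrite -(ler_pXn2r (n := 2)) ?nnegrE // rE expr1n gerBl.
rewrite lerNl -sumrN.
apply: (le_trans (_ : _ <= \sum_(i < M) (1 + 4 / 3 * r ^+ 2) *
   (2^-1 ^+ i.+1 * Num.min (r ^+ 2) (4^-1 ^+ i.+1)))).
  apply: ler_sum => i _; rewrite -mulrN mulrCA ler_wpM2l ?exprn_ge0 ?invr_ge0 //.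
  have -> : Num.max x (lvl i) = 1 - Num.min (r ^+ 2) (4^-1 ^+ i.+1).
    rewrite rE /lvl; move: (4^-1 ^+ i.+1) => u.
    by case: (leP x) => h1; case: leP => h2; lra.
  set y := Num.min _ _.
  have yr : y <= r ^+ 2 by rewrite ge_min lexx.
  have y4 : y <= 4^-1.
    apply: (le_trans (_ : _ <= 4^-1 ^+ i.+1)); first by rewrite ge_min lexx orbT.
    by rewrite exprS ler_piMr ?invr_ge0 // exprn_ile1 ?invr_ge0 // invf_le1 // ler1n.
  have y0 : 0 <= y by rewrite le_min sqr_ge0 exprn_ge0 ?invr_ge0.
  have yp : 0 < 1 - y by lra.
  have := ln_ge_inv yp; rewrite lerBlDr => h.
  rewrite lerNl; apply: le_trans (ln_ge_inv yp).
  rewrite lerNl opprB lerBlDr.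
  rewrite -[leLHS]mul1r ler_pdivrMr //.
  have : 0 <= y ^+ 2 * (1 - 4 * y) by rewrite mulr_ge0 ?sqr_ge0 //; lra.
  have : 0 <= y * (r ^+ 2 - y) * (1 - y) by rewrite !mulr_ge0 ?subr_ge0 //; lra.
  by rewrite !exprS expr0; lra.
rewrite -mulr_sumr.
have tp : 0 < 2 - x by lra.
apply: le_trans (ln_ge_inv tp).
apply: (le_trans (ler_wpM2l _ (min_sum_le M r0 r1))).
  by rewrite addr_ge0 // mulr_ge0 ?sqr_ge0 // divr_ge0.
have -> : 2 - x = 1 + r ^+ 2 by rewrite rE; lra.
have rp : 0 < 1 + r ^+ 2 by rewrite ltr_wpDr ?sqr_ge0.
rewrite -(ler_pM2r rp) mulrBl mulVf ?gt_eqF // mul1r.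
(* What remains is a quartic in r = sqrt(1 - x), positive by a sum of squares. *)
have sos : 0 <= 18 - 49 * r + 42 * r ^+ 2 - 28 * r ^+ 3 + 24 * r ^+ 4.
  have h1 := sqr_ge0 (r ^+ 2 - 7 / 12 * r - 7 / 100).
  have h2 := sqr_ge0 (r - 137 / 200).
  by move: h1 h2; rewrite !exprS !expr0; lra.
have : 0 <= r ^+ 3 * (18 - 49 * r + 42 * r ^+ 2 - 28 * r ^+ 3 + 24 * r ^+ 4).
  by rewrite mulr_ge0 ?exprn_ge0.
by rewrite !exprS !expr0; lra.
Qed.

(** Only partial sums of the weights 2^-(i+1) are used; their total tends to 1. *)
Lemma le_of_partial (Y Z : R) : 0 <= Z -> (forall M, (1 - 2^-1 ^+ M) * Y <= Z) -> Y <= Z.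
Proof.
move=> Z0 h; have [Y0|Y0] := leP Y 0; first exact: le_trans Y0 Z0.
apply/ler_addgt0Pr => e e0.
have eY : 0 < e / Y by rewrite divr_gt0.
have h2 : (0 : R) <= 2^-1 by rewrite invr_ge0.
have h3 : (2^-1 : R) < 1 by rewrite invf_lt1 // ltr1n.
have [N hN] := geometric_small h2 h3 eY.
have := hN N (leqnn N); rewrite ltr_pdivlMr // => h1.
by have := h N; rewrite mulrBl mul1r; lra.
Qed.

(** Taking logarithms, this is the average of the hypotheses with the weights
    2^-(i+1); the exponent of B becomes the sum of (i+1) 2^-(i+1), at most 2. *)
Lemma combine_levels n (X S B p : R) (y : 'I_n -> R) : 0 < X -> 0 < S -> 1 <= B -> 0 < p ->
  (forall k, 0 <= y k <= 1) ->
  (forall i, (X * \prod_k Num.max (y k) (lvl i)) `^ p <= B ^+ i.+1 * S) ->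
  X `^ p <= B ^+ 2 * S * (\prod_k (2 - y k)) `^ p.
Proof.
move=> X0 S0 B1 p0 hy h.
have B0 : 0 < B by exact: lt_le_trans ltr01 B1.
have lnB : 0 <= ln B by exact: ln_ge0.
have y2 k : 1 <= 2 - y k by have /andP[_] := hy k; lra.
have y20 k : 0 < 2 - y k by exact: lt_le_trans ltr01 (y2 k).
have mp i k : 0 < Num.max (y k) (lvl i) by rewrite lt_max lvl_gt0 orbT.
have lnP (F : 'I_n -> R) : (forall k, 0 < F k) ->
    0 < \prod_k F k /\ ln (\prod_k F k) = \sum_k ln (F k).
  move=> F0; elim/big_rec2 : _ => [|k u v _ [v0 vE]]; first by rewrite ln1.
  by rewrite mulr_gt0 // lnM ?posrE // vE.
have [P0 PE] := lnP (fun k => 2 - y k) y20.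
have main : p * ln X - ln S <= 2 * ln B + p * \sum_k ln (2 - y k).
  apply: le_of_partial.
    by rewrite addr_ge0 ?mulr_ge0 ?(ltW p0) // sumr_ge0 // => k _; exact: ln_ge0.
  move=> M; rewrite -geometric_half mulr_suml.
  apply: (le_trans (_ : _ <= \sum_(i < M) (2^-1 ^+ i.+1 * i.+1%:R * ln B -
     p * \sum_k 2^-1 ^+ i.+1 * ln (Num.max (y k) (lvl i))))).
    apply: ler_sum => i _; have [Q0 QE] := lnP _ (mp i).
    have := h i; rewrite -ler_ln ?posrE ?powR_gt0 ?mulr_gt0 ?exprn_gt0 //.
    rewrite ln_powR lnM ?posrE // lnM ?posrE ?exprn_gt0 // lnXn // QE => hi.
    have c0 : 0 < (2^-1 : R) ^+ i.+1 by rewrite exprn_gt0 // invr_gt0.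
    rewrite -[ln B *+ _]mulr_natl in hi; rewrite -mulr_sumr.
    move: (ler_wpM2l (ltW c0) hi); move: (\sum_k _) (i.+1%:R) (ln X) (ln B) (ln S) => u v lX lB lS.
    by lra.
  rewrite sumrB; apply: lerD; first by rewrite -mulr_suml ler_wpM2r // geometric_half_weighted.
  rewrite -mulr_sumr -mulrN ler_wpM2l ?(ltW p0) // exchange_big /= -sumrN.
  by apply: ler_sum => k _; have /andP[k0 k1] := hy k; rewrite lerNl; exact: sum_ln_max_ge.
rewrite -ler_ln ?posrE ?mulr_gt0 ?powR_gt0 ?exprn_gt0 //.
rewrite ln_powR lnM ?posrE ?mulr_gt0 ?powR_gt0 ?exprn_gt0 //.
rewrite lnM ?posrE ?exprn_gt0 // lnXn // ln_powR PE -[ln B *+ 2]mulr_natl.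
by move: main; lra.
Qed.
End Levels.

(** * Growth of an invariant weight *)
Section WeightGrowth.
Variable R : realType.
Local Notation C := R[i].
Implicit Types (a b c t x xi : C) (w : C -> R).

Section InvariantWeight.
Variables (w : C -> R) (r K : R).
Hypotheses (r01 : 0 < r < 1) (K1 : 1 <= K).
Hypothesis w_gt0 : forall x, unit_disc x -> 0 < w x.
Hypothesis w_inv : forall a x, unit_disc a -> pseudo_disc a r x ->
  K^-1 * w a <= w x <= K * w a.

(** A radius leading to a point at pseudohyperbolic distance t is cut into steps
    that each multiply 1 - t by 1 + r / 2, so the weight loses at most a factor K
    on each step. *)
Lemma weight_steps m a x : unit_disc a -> unit_disc x ->
  modulus x <= 1 - (1 + r / 2) ^- m -> w a <= K ^+ m * w (disc_aut a x).
Proof.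
have /andP[r0 r1] := r01; have k0 : 0 < 1 + r / 2 by lra.
elim: m x => [|m ih] x a1 x1.
  by rewrite expr0 invr1 subrr mod_le0 => /eqP ->; rewrite disc_aut0 mul1r.
move=> xm; have [->|x0] := eqVneq x 0.
  by rewrite disc_aut0 ler_peMl ?exprn_ege1 // ltW // w_gt0.
have t0 : 0 < modulus x by rewrite mod_gt0.
(* The previous point on the radius: 1 - s is (1 + r/2)(1 - |x|), capped at 1. *)
pose s := Num.max 0 (1 - (1 + r / 2) * (1 - modulus x)).
have s0 : 0 <= s by rewrite le_max lexx.
have x1' : 0 < 1 - modulus x by rewrite subr_gt0.
have sx : s <= modulus x.
  rewrite ge_max (ltW t0) /=.
  have : 0 <= r / 2 * (1 - modulus x) by rewrite mulr_ge0 ?divr_ge0 ?(ltW r0) ?(ltW x1').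
  by lra.
have sm : s <= 1 - (1 + r / 2) ^- m.
  rewrite ge_max subr_ge0 invf_le1 ?exprn_gt0 // exprn_ege1 /=; last by lra.
  rewrite lerD2l lerN2.
  have -> : (1 + r / 2) ^- m = (1 + r / 2) * (1 + r / 2) ^- m.+1.
    by rewrite exprS invfM mulVKf // gt_eqF.
  by rewrite ler_wpM2l ?(ltW k0) //; move: xm; lra.
have sstep : modulus x - s <= r / 2 * (1 - modulus x).
  have : 1 - (1 + r / 2) * (1 - modulus x) <= s by rewrite le_max lexx orbT.
  by lra.
pose y := ((s / modulus x)%:C)%C * x.
have ys : modulus y = s.
  by rewrite modM modR ger0_norm ?divr_ge0 ?(ltW t0) // divfK // gt_eqF.
have y1 : unit_disc y by rewrite /unit_disc /= ys; exact: le_lt_trans sx x1.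
have xy : modulus (x - y) = modulus x - s.
  have -> : x - y = ((1 - s / modulus x)%:C)%C * x by rewrite rmorphB /= rmorph1 mulrBl mul1r.
  rewrite modM modR ger0_norm; last by rewrite subr_ge0 ler_pdivrMr // mul1r.
  by rewrite mulrBl mul1r divfK // gt_eqF.
apply: (le_trans (ih y a1 y1 _)); first by rewrite ys.
rewrite exprSr -mulrA ler_wpM2l ?exprn_ge0 //; first exact: le_trans ler01 K1.
have [ay ax] := (disc_aut_in a1 y1, disc_aut_in a1 x1).
have : pseudo_disc (disc_aut a y) r (disc_aut a x).
  split=> //; rewrite disc_aut_invariant // /disc_aut mod_div mod_subC xy.
  have dge := one_sub_conjM_ge x (ltW y1).
  have d0 : 0 < modulus (1 - conjc y * x) by exact: lt_le_trans x1' dge.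
  rewrite ltr_pdivrMr //; apply: (le_lt_trans sstep).
  apply: (lt_le_trans (_ : _ < r * (1 - modulus x))); last by rewrite ler_wpM2l // ltW.
  by rewrite ltr_pM2r //; lra.
move=> /(w_inv ay)/andP[h _]; rewrite -(ler_pM2l (_ : 0 < K^-1)) ?invr_gt0 ?(lt_le_trans ltr01) //.
by rewrite mulKf // gt_eqF // (lt_le_trans ltr01).
Qed.

(** If (1 + r/2)^q >= 4, then q (i+1) steps reach the radius 1 - 4^-(i+1). *)
Lemma weight_growth : exists2 B : R, 1 <= B & forall i a xi, unit_disc a -> unit_disc xi ->
  modulus (disc_aut a xi) <= lvl R i -> w a <= B ^+ i.+1 * w xi.
Proof.
have /andP[r0 r1] := r01; have k1 : 1 < 1 + r / 2 by lra.
have k0 : 0 < 1 + r / 2 by lra.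
have q0 : 0 <= (1 + r / 2)^-1 by rewrite invr_ge0 ltW.
have q1 : (1 + r / 2)^-1 < 1 by rewrite invf_lt1.
have f0 : 0 < (4^-1 : R) by rewrite invr_gt0.
have [q hq] := geometric_small q0 q1 f0; have {}hq := hq q (leqnn q).
exists (K ^+ q); first exact: exprn_ege1.
move=> i a xi a1 xi1 h.
have := @weight_steps (q * i.+1) a (disc_aut a xi) a1 (disc_aut_in a1 xi1).
rewrite disc_autK // => H; rewrite -exprM; apply: H; apply: (le_trans h).
rewrite /lvl lerD2l lerN2 exprM -exprVn; apply: lerXn2r.
- by rewrite nnegrE invr_ge0 exprn_ge0 // ltW.
- by rewrite nnegrE ltW.
by rewrite -exprVn ltW.
Qed.
End InvariantWeight.
End WeightGrowth.

(** * Means over roots of unity *)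
Section CircleMeans.
Variable R : realType.
Local Notation C := R[i].
Implicit Types (a b c t x y u : C) (f g h : C -> C) (v : C -> R).

Definition expi (th : R) : C := (cos th +i* sin th)%C.

Lemma expiD th ph : expi (th + ph) = expi th * expi ph.
Proof.
by apply/eqP; rewrite eq_complex /= cosD sinD; apply/andP; split; apply/eqP; ring.
Qed.

Lemma mod_expi th : modulus (expi th) = 1.
Proof. by rewrite /= cos2Dsin2 sqrtr1. Qed.

Lemma expi0 : expi 0 = 1.
Proof. by rewrite /expi cos0 sin0. Qed.

Lemma expi_2pi : expi (pi *+ 2) = 1.
Proof. by rewrite /expi cos2pi sin2pi. Qed.

Lemma expi_small (e : R) : 0 < e -> exists2 d : R, 0 < d &
  forall th, `|th| < d -> modulus (expi th - 1) < e.
Proof.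
move=> e0; have e2 : 0 < e / 2 by rewrite divr_gt0.
have := @continuous_cos R 0; move=> /cvgrPdist_lt /(_ _ e2)/nbhs_ballP[d1 /= d10 h1].
have := @continuous_sin R 0; move=> /cvgrPdist_lt /(_ _ e2)/nbhs_ballP[d2 /= d20 h2].
exists (Num.min d1 d2); first by rewrite lt_min d10.
move=> th; rewrite lt_min => /andP[t1 t2].
have {}h1 : `|1 - cos th| < e / 2.
  by have := h1 th; rewrite /ball /= sub0r normrN cos0; exact.
have {}h2 : `|sin th| < e / 2.
  by have := h2 th; rewrite /ball /= sub0r normrN sin0 sub0r normrN; exact.
rewrite -[ltLHS]/(modulus (expi th - 1)).
apply: (le_lt_trans (mod_le_ReIm _)); rewrite /= oppr0 addr0 [ltRHS](splitr e) ltrD //.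
by rewrite distrC.
Qed.

Lemma expi_onto u : modulus u = 1 -> exists2 th : R, 0 <= th & expi th = u.
Proof.
move=> u1; have := mod_sqr u; rewrite u1 expr1n; case: u {u1} => p q /= h.
have pI : -1 <= p <= 1.
  by rewrite -ler_norml -(ler_pXn2r (n := 2)) ?nnegrE // expr1n real_normK ?num_real // h lerDl sqr_ge0.
have qE : 1 - p ^+ 2 = q ^+ 2 by rewrite h addrAC subrr add0r.
have [q0|q0] := leP 0 q.
  exists (acos p); first exact: acos_ge0.
  by rewrite /expi acosK ?in_itv //= sin_acos // qE sqrtr_sqr ger0_norm.
exists (pi *+ 2 - acos p).
  by rewrite subr_ge0 (le_trans (acos_lepi pI)) // mulr2n lerDl pi_ge0.
rewrite expiD expi_2pi mul1r /expi cosN sinN acosK ?in_itv //=.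
by rewrite sin_acos // qE sqrtr_sqr ltr0_norm // opprK.
Qed.

Definition root_of_unity N : C := expi (pi *+ 2 / N%:R).

Lemma expiMn th n : expi (th *+ n) = expi th ^+ n.
Proof. by elim: n => [|n ih]; rewrite ?mulr0n ?expi0 ?expr0 // mulrSr expiD ih exprSr. Qed.

Lemma root_of_unityX N : (0 < N)%N -> root_of_unity N ^+ N = 1.
Proof.
move=> N0; rewrite -expiMn -[(_ / _) *+ _]mulr_natr divfK ?expi_2pi //.
by rewrite pnatr_eq0 -lt0n.
Qed.

Lemma mod_root_of_unityX N j : modulus (root_of_unity N ^+ j) = 1.
Proof. by rewrite modX mod_expi expr1n. Qed.

Definition circle_sum v N x := \sum_(j < N) v (root_of_unity N ^+ j * x).

(** Rotating by a root of unity permutes the terms of the sum cyclically. *)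
Lemma circle_sum_rot v N m x : (0 < N)%N ->
  circle_sum v N (root_of_unity N ^+ m * x) = circle_sum v N x.
Proof.
move=> N0; elim: m => [|m ih]; first by rewrite mul1r.
rewrite -{}ih exprS -mulrA; set y := _ ^+ m * x.
case: N N0 y => // N N0 y; rewrite /circle_sum big_ord_recr [RHS]big_ord_recl /= addrC.
congr (_ + _); first by rewrite mulrA -exprSr root_of_unityX // expr0.
by apply: eq_bigr => j _; rewrite mulrA -exprSr.
Qed.

(** Compactness of the disc; only x ranges over it, y may lie outside. *)
Lemma uniform_cont v (s e : R) : 0 < e ->
  (forall x, modulus x <= s -> cont_at v x) ->
  exists2 d : R, 0 < d & forall x y, modulus x <= s -> modulus (y - x) < d -> `|v y - v x| < e.
Proof.
move=> e0 cv; have e2 : 0 < e / 2 by rewrite divr_gt0.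
pose A := [set w : R * R | 0 <= modulus (cplx w - 0) <= s].
pose P (d : R) (w : R * R) := forall y, modulus (y - cplx w) < d -> `|v y - v (cplx w)| < e.
have cov : forall w, A w -> \forall w' \near w & d \near (0 : R)^'+, P d w'.
  move=> w /andP[_]; rewrite subr0 => ws; have [r r0 hr] := cv _ ws _ e2.
  have r4 : 0 < r / 4 by rewrite divr_gt0.
  exists ((ball w.1 (r / 4) `*` ball w.2 (r / 4)), [set d | d < r / 2]).
    split; last by apply: nbhs_right_lt; rewrite divr_gt0.
    by exists (ball w.1 (r / 4), ball w.2 (r / 4)) => //; split; exact: nbhsx_ballx.
  move=> [w' d] [/= [b1 b2] dr] y yd.
  have ww' : modulus (cplx w' - cplx w) < r / 2.
    apply: (le_lt_trans (cplx_sub_le _ _)).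
    have -> : r / 2 = r / 4 + r / 4 by lra.
    by apply: ltrD; rewrite distrC; [exact: b1|exact: b2].
  have h1 : `|v (cplx w') - v (cplx w)| < e / 2.
    have := hr (cplx w' - cplx w); rewrite subrKC; apply.
    by apply: (lt_trans ww'); rewrite ltr_pdivrMr // ltr_pMr // ltr1n.
  have h2 : `|v y - v (cplx w)| < e / 2.
    have := hr (y - cplx w); rewrite subrKC; apply.
    apply: (le_lt_trans (mod_triangle _ (cplx w') _)).
    by rewrite (splitr r) ltrD //; exact: lt_trans yd dr.
  rewrite -(subrKA (v (cplx w))) (splitr e); apply: (le_lt_trans (ler_normD _ _)).
  by rewrite ltrD // distrC.
have := proj1 (compact_near_coveringP A) (@compact_annulus R 0 0 s) R (0 : R)^'+ P.
move=> H; have {H} /nbhs_ballP := H (@at_right_proper_filter R 0) cov.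
move=> [d /= d0 hd]; exists (d / 2); first by rewrite divr_gt0.
move=> x y xs yx; have := hd (d / 2); rewrite /ball /= sub0r normrN gtr0_norm ?divr_gt0 //.
rewrite ltr_pdivrMr // ltr_pMr // ltr1n => /(_ erefl erefl).
move=> H; have : P (d / 2) (complex.Re x, complex.Im x).
  by apply: H; rewrite /A /mkset cplx_ReIm subr0 mod_ge0.
by rewrite /P cplx_ReIm; apply.
Qed.

(** Averaging a subharmonic function over the N-th roots of unity makes it
    nearly invariant under rotations, so that for large N the maximum over the
    circle given by the maximum principle is almost attained at every point. *)
Lemma circle_mean f b (s p e : R) : 0 < p -> 0 < e ->
  (forall x, modulus (x - b) <= s -> hol_at f x) ->
  exists2 N, (3 < N)%N & forall x, modulus x <= s ->
    modulus (f b) `^ p * N%:R <=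
      circle_sum (fun y => modulus (f (b + y)) `^ p) N x + e * N%:R.
Proof.
move=> p0 e0 hf; pose v y := modulus (f (b + y)) `^ p.
have hfb x : modulus x <= s -> hol_at f (b + x).
  by move=> xs; apply: hf; rewrite addrAC subrr add0r.
have cv x : modulus x <= s -> cont_at v x.
  move=> xs d d0; have := hol_cont_powR p0 (hfb x xs) d0.
  by move=> h; apply: (near0_sub h) => t; rewrite /v addrA.
have [d d0 hd] := uniform_cont e0 cv.
have s1 : 0 < `|s| + 1 by rewrite ltr_wpDl.
have [eta eta0 heta] := expi_small (divr_gt0 d0 s1).
(* N >= 4 keeps the angle 2 pi / N away from the half-turn. *)
pose N := (maxn 4 (Num.truncn (pi *+ 2 / eta)).+1).
have N4 : (3 < N)%N by rewrite /N leq_maxl.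
have N0 : (0 < N)%N by exact: leq_trans N4.
have NR : 0 < N%:R :> R by rewrite ltr0n.
have p2 : 0 < (pi : R) *+ 2 by rewrite mulrn_wgt0 // pi_gt0.
have Neta : pi *+ 2 / N%:R < eta.
  rewrite ltr_pdivrMr // mulrC -ltr_pdivrMr //.
  apply: (lt_le_trans (real_truncnS_gt (num_real _))); rewrite ler_nat.
  by rewrite /N leq_maxr.
exists N => // x xs.
have [->|x0] := eqVneq x 0.
  rewrite /circle_sum (eq_bigr (fun=> modulus (f b) `^ p)); last by move=> j _; rewrite mulr0 addr0.
  by rewrite sumr_const card_ord mulr_natr lerDl mulr_ge0 // ltW.
have xp : 0 < modulus x by rewrite mod_gt0.
have rotm j y : modulus (root_of_unity N ^+ j * y) = modulus y.
  by rewrite modM mod_root_of_unityX mul1r.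
have [||c + hc] := @max_principle _ (circle_sum v N) 0 (modulus x) xp.
- move=> y; rewrite subr0 => yx; apply: cont_at_sum => j k k0.
  have [|r r0 hr] := cv (root_of_unity N ^+ j * y) _ k k0.
    by rewrite rotm (le_trans yx).
  by exists r => // t tr; rewrite mulrDr; apply: hr; rewrite rotm.
- move=> y; rewrite subr0 => yx; apply: cross_sub_sum => j k k0.
  have hj : hol_at (fun y => f (b + root_of_unity N ^+ j * y)) y.
    apply: (@hol_comp _ f (fun y => b + root_of_unity N ^+ j * y)); first exact: hol_affine.
    by apply: hfb; rewrite rotm (le_trans (ltW yx)).
  exact: hol_cross_sub p0 hj k k0.
rewrite subr0 => cx.
have := hc 0; rewrite subr0 mod0 => /(_ (ltW xp)).
rewrite {1}/circle_sum (eq_bigr (fun=> modulus (f b) `^ p)); last first.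
  by move=> j _; rewrite /v mulr0 addr0.
rewrite sumr_const card_ord -[_ *+ N]mulr_natr => h; apply: (le_trans h).
have [th th0 thE] : exists2 th : R, 0 <= th & expi th = c / x.
  by apply: expi_onto; rewrite mod_div cx divff // gt_eqF.
pose al : R := pi *+ 2 / N%:R.
have al0 : 0 < al by rewrite divr_gt0.
pose m := Num.truncn (th / al); have /andP[m1 m2] := truncn_itv (divr_ge0 th0 (ltW al0)).
rewrite -/m ler_pdivlMr // in m1; rewrite -/m ltr_pdivrMr // in m2.
pose ph := th - m%:R * al.
have ph0 : 0 <= ph by rewrite subr_ge0.
have ph1 : `|ph| < eta.
  rewrite ger0_norm //; apply: lt_trans Neta; rewrite -/al /ph ltrBlDr.
  by move: m2; rewrite -natr1 mulrDl mul1r addrC.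
(* The maximum point c is x turned by m steps 2 pi / N and a remainder ph. *)
have cE : c = root_of_unity N ^+ m * (expi ph * x).
  rewrite mulrA -expiMn -expiD -/al -[al *+ m]mulr_natl /ph subrKC thE divfK //.
rewrite cE circle_sum_rot //.
rewrite -lerBlDl /circle_sum -sumrB.
apply: (le_trans (_ : _ <= \sum_(j < N) e)); last by rewrite sumr_const card_ord mulr_natr.
apply: ler_sum => j _; apply: (le_trans (ler_norm _)); apply/ltW/hd; first by rewrite rotm.
rewrite -mulrBr rotm -[X in _ - X]mul1r -mulrBl modM.
have := heta _ ph1; rewrite ltr_pdivlMr // => h3; apply: le_lt_trans h3.
rewrite ler_wpM2l ?mod_ge0 //; apply: (le_trans xs).
by apply: (le_trans (ler_norm _)); rewrite lerDl.
Qed.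
End CircleMeans.

(** * Translations and rotations of the plane *)
Section PlaneMeasure.
Variable R : realType.
Local Notation C := R[i].
Local Notation T := (measurableTypeR R * measurableTypeR R)%type.
Local Notation mu := (@lebesgue_measure R).
Local Notation m2 := (@lebesgue_measure R \x @lebesgue_measure R)%E.
Local Open Scope ereal_scope.

Definition shift (c : R) : measurableTypeR R -> measurableTypeR R := fun x => (x + c)%R.

Lemma measurable_shift c : measurable_fun setT (shift c).
Proof. exact: measurable_funD. Qed.

Lemma lebesgue_measure_shift c (A : set R) : measurable A ->
  pushforward mu (shift c) A = mu A.
Proof.
move=> mA; apply/esym/lebesgue_measure_unique => //; first exact: measurable_shift.
move=> /= ? _ [[a b]] _ <-.
rewrite /pushforward.
have -> : shift c @^-1` `]a, b] = `](a - c)%R, (b - c)%R]%classic.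
  apply/seteqP; split => x /=; rewrite !in_itv /= /shift.
    by rewrite ltrBlDr lerBrDr.
  by rewrite ltrBlDr lerBrDr.
rewrite !lebesgue_measure_itv /= !lte_fin ltrD2r.
by case: ifP => // _; rewrite -!EFinB; congr EFin; ring.
Qed.

Lemma ge0_integral_shift c (f : R -> \bar R) : measurable_fun setT f ->
  (forall x, 0 <= f x) -> \int[mu]_x f (x + c)%R = \int[mu]_x f x.
Proof.
move=> mf f0; have h := ge0_integral_pushforward (measurable_shift c) mu measurableT mf.
rewrite preimage_setT in h; rewrite -[LHS]/(\int[mu]_x (f \o shift c) x) -h //.
by apply: eq_measure_integral => [|? A mA _]; [exact: measurable_shift|exact: lebesgue_measure_shift].
Qed.

Lemma measurable_pair_fun (g h : T -> R) (F : T -> \bar R) : measurable_fun setT F ->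
  measurable_fun setT g -> measurable_fun setT h ->
  measurable_fun setT (fun u : T => F (g u, h u)).
Proof.
move=> mF mg mh; apply: (measurableT_comp mF).
by apply: (@measurable_fun_pair _ _ _ T (measurableTypeR R) (measurableTypeR R)).
Qed.

Lemma ge0_integral_translate (c : T) (F : T -> \bar R) : measurable_fun setT F ->
  (forall u, 0 <= F u) ->
  \int[m2]_u F (u.1 + c.1, u.2 + c.2)%R = \int[m2]_u F u.
Proof.
move=> mF F0; have mG : measurable_fun setT (fun u : T => F (u.1 + c.1, u.2 + c.2)%R).
  apply: measurable_pair_fun => //.
    by apply: measurable_funD; [exact: measurable_fst|exact: measurable_cst].
  by apply: measurable_funD; [exact: measurable_snd|exact: measurable_cst].
rewrite (fubini_tonelli1 F mF F0) (fubini_tonelli1 _ mG (fun u => F0 _)).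
have mI := @measurable_fun_fubini_tonelli_F _ _ _ _ R mu F mF F0.
rewrite -[RHS](ge0_integral_shift c.1 mI); last by move=> x; exact: integral_ge0.
apply: eq_integral => x _; rewrite /fubini_F /=.
by rewrite -(ge0_integral_shift c.2 (f := fun y => F (x + c.1, y)%R)) //; exact: measurable_fun_pair2.
Qed.

Lemma measurable_shear1 (t : R) (F : T -> \bar R) : measurable_fun setT F ->
  measurable_fun setT (fun u : T => F (u.1 + t * u.2, u.2)%R).
Proof.
move=> mF; apply: measurable_pair_fun => //.
apply: measurable_funD; first exact: measurable_fst.
by apply: measurable_funM; [exact: measurable_cst|exact: measurable_snd].
Qed.

Lemma measurable_shear2 (t : R) (F : T -> \bar R) : measurable_fun setT F ->
  measurable_fun setT (fun u : T => F (u.1, u.2 + t * u.1)%R).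
Proof.
move=> mF; apply: measurable_pair_fun => //.
apply: measurable_funD; first exact: measurable_snd.
by apply: measurable_funM; [exact: measurable_cst|exact: measurable_fst].
Qed.

(** Shears preserve area because each slice is translated. *)
Lemma ge0_integral_shear1 (t : R) (F : T -> \bar R) : measurable_fun setT F ->
  (forall u, 0 <= F u) -> \int[m2]_u F (u.1 + t * u.2, u.2)%R = \int[m2]_u F u.
Proof.
move=> mF F0; rewrite (fubini_tonelli2 F mF F0).
rewrite (fubini_tonelli2 _ (measurable_shear1 t mF) (fun u => F0 _)).
apply: eq_integral => y _; rewrite /fubini_G /=.
by rewrite (ge0_integral_shift (t * y)%R (f := fun x => F (x, y))) //; exact: measurable_fun_pair1.
Qed.

Lemma ge0_integral_shear2 (t : R) (F : T -> \bar R) : measurable_fun setT F ->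
  (forall u, 0 <= F u) -> \int[m2]_u F (u.1, u.2 + t * u.1)%R = \int[m2]_u F u.
Proof.
move=> mF F0; rewrite (fubini_tonelli1 F mF F0).
rewrite (fubini_tonelli1 _ (measurable_shear2 t mF) (fun u => F0 _)).
apply: eq_integral => x _; rewrite /fubini_F /=.
by rewrite (ge0_integral_shift (t * x)%R (f := fun y => F (x, y))) //; exact: measurable_fun_pair2.
Qed.

(** A rotation other than the half-turn is a product of three shears. *)
Lemma ge0_integral_rotation (th : R) (F : C -> \bar R) : (cos th != -1)%R ->
  measurable_fun setT (fun u : T => F (cplx u)) -> (forall x, 0 <= F x) ->
  \int[m2]_u F (expi th * cplx u)%R = \int[m2]_u F (cplx u).
Proof.
move=> c1 mF F0; have c0 : (1 + cos th != 0)%R by rewrite addrC addr_eq0.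
pose t : R := (- (sin th / (1 + cos th)))%R.
rewrite -(ge0_integral_shear1 t mF) //.
rewrite -(ge0_integral_shear2 (sin th) (measurable_shear1 t mF)) //=.
rewrite -(ge0_integral_shear1 t (measurable_shear2 (sin th) (measurable_shear1 t mF))) //=.
apply: eq_integral => u _; congr F; apply/eqP; rewrite eq_complex /= /t.
(* The parameter t is - tan (th / 2); both coordinates are compared after
   multiplication by 1 + cos th. *)
have cs : (sin th ^+ 2 = (1 + cos th) * (1 - cos th))%R.
  by have /eqP := cos2Dsin2 th; rewrite addrC eq_sym -subr_eq => /eqP <-; ring.
apply/andP; split; apply/eqP; apply: (mulfI c0).
  have -> : ((1 + cos th) * (u.1 + - (sin th / (1 + cos th)) * u.2 +
    - (sin th / (1 + cos th)) * (u.2 + sin th * (u.1 + - (sin th / (1 + cos th)) * u.2)))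
    = (1 + cos th) * u.1 - sin th * u.2 * 2 - sin th ^+ 2 * u.1
        + sin th ^+ 2 * (sin th / (1 + cos th)) * u.2 + (- cos th * sin th * u.2 + cos th * sin th * u.2))%R.
    by field.
  by rewrite cs; field.
have -> : ((1 + cos th) * (u.2 + sin th * (u.1 + - (sin th / (1 + cos th)) * u.2))
   = (1 + cos th) * (u.2 + sin th * u.1) - sin th ^+ 2 * u.2)%R by field.
by rewrite cs; ring.
Qed.
End PlaneMeasure.

(** * The sub-mean value property over discs *)
Section AreaMeans.
Variable R : realType.
Local Notation C := R[i].
Local Notation T := (measurableTypeR R * measurableTypeR R)%type.
Local Notation mu := (@lebesgue_measure R).
Local Notation m2 := (@lebesgue_measure R \x @lebesgue_measure R)%E.
Implicit Types (S : set C) (v : C -> R) (a b c x y : C).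

Definition open_set S := forall x, S x -> near0 (fun t => S (x + t)).

Definition in_plane S : set T := [set u | S (cplx u)].

Lemma open_ball b (s : R) : open_set [set x | modulus (x - b) < s].
Proof.
move=> x /= xs; exists (s - modulus (x - b)); first by rewrite subr_gt0.
move=> t; rewrite ltrBrDr => h; rewrite addrAC.
by apply: (le_lt_trans (modD_le _ _)); rewrite [ltLHS]addrC.
Qed.

Lemma open_unit_disc : open_set (@unit_disc R).
Proof. by move=> x; exact: near0_unit_disc. Qed.

(** An open set of the plane is the union of the squares with rational centre
    and half-side 1 / (n + 1) that it contains. *)
Lemma open_set_measurable S : open_set S -> measurable (in_plane S).
Proof.
move=> oS; pose sq (q1 q2 : rat) n : set T :=
  `](ratr q1 - n.+1%:R^-1 : R), (ratr q1 + n.+1%:R^-1 : R)[%classic `*`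
  `](ratr q2 - n.+1%:R^-1 : R), (ratr q2 + n.+1%:R^-1 : R)[%classic.
pose F q1 q2 n := if `[< sq q1 q2 n `<=` in_plane S >] then sq q1 q2 n else set0.
have -> : in_plane S = \bigcup_q1 \bigcup_q2 \bigcup_n F q1 q2 n.
  apply/seteqP; split; last first.
    by move=> u [q1 _ [q2 _ [n _]]]; rewrite /F; case: asboolP => // h /h.
  move=> u Su; have [r r0 hr] := oS _ Su.
  pose n := Num.truncn (4 / r).
  have e0 : 0 < (n.+1%:R^-1 : R) by rewrite invr_gt0 ltr0n.
  have en : (n.+1%:R^-1 : R) < r / 4.
    rewrite -[ltRHS]invrK ltf_pV2 ?posrE ?ltr0n ?invr_gt0 ?divr_gt0 // invf_div.
    exact: real_truncnS_gt (num_real _).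
  have near_rat (x e : R) : 0 < e -> exists q : rat, x - e < ratr q < x + e.
    move=> ep; have [|q] := @rat_in_itvoo R (x - e) (x + e); first by lra.
    by rewrite in_itv /=; exists q.
  have [q1 /andP[a1 b1]] := near_rat u.1 _ e0; have [q2 /andP[a2 b2]] := near_rat u.2 _ e0.
  have H : sq q1 q2 n `<=` in_plane S.
    move=> u' [/=]; rewrite !in_itv /= => /andP[c1 d1] /andP[c2 d2].
    move: e0 en a1 b1 a2 b2 c1 d1 c2 d2; move: (n.+1%:R^-1) => e e0 en a1 b1 a2 b2 c1 d1 c2 d2.
    rewrite /in_plane /= -[cplx u'](subrKC (cplx u)); apply: hr.
    apply: (le_lt_trans (cplx_sub_le _ _)).
    have : `|u'.1 - u.1| < r / 2 by rewrite ltr_norml; apply/andP; split; lra.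
    have : `|u'.2 - u.2| < r / 2 by rewrite ltr_norml; apply/andP; split; lra.
    by lra.
  exists q1 => //; exists q2 => //; exists n => //; rewrite /F asboolT //.
  by split => /=; rewrite in_itv /=; apply/andP; split;
    move: a1 b1 a2 b2; move: (n.+1%:R^-1) => e; lra.
apply: bigcupT_measurable_rat => q1; apply: bigcupT_measurable_rat => q2.
apply: bigcupT_measurable => n; rewrite /F; case: asboolP => // _.
by apply: measurableX; exact: measurable_itv.
Qed.

Lemma cont_measurable S v : open_set S -> (forall x, S x -> cont_at v x) ->
  measurable_fun (in_plane S) (fun u : T => v (cplx u)).
Proof.
move=> oS cv mS; apply: (measurability _ (RGenOInfty.measurableE R)) => //.
move=> _ [_ [k ->] <-].
rewrite (_ : _ `&` _ = in_plane [set x | S x /\ k < v x]); last first.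
  by apply/seteqP; split => u [/= h1]; rewrite in_itv /= andbT.
apply: open_set_measurable => x [Sx kx].
have k0 : 0 < v x - k by rewrite subr_gt0.
apply: (near0_sub (near0_and (oS x Sx) (cv x Sx _ k0))) => t [h1 h2]; split => //.
by move: h2; rewrite ltr_norml => /andP[]; lra.
Qed.

Definition ball_area b (s : R) : set T := in_plane [set x | modulus (x - b) < s].

Lemma in_ball_area b s (u : T) : (u \in ball_area b s) = (modulus (cplx u - b) < s).
Proof. by apply/idP/idP => [/set_mem|h]; [|apply/mem_set]. Qed.

Lemma measurable_ball_area b s : measurable (ball_area b s).
Proof. by apply: open_set_measurable; exact: open_ball. Qed.

Lemma measurable_square (x y s : R) : measurable
  (`](x - s)%R, (x + s)%R[%classic `*` `](y - s)%R, (y + s)%R[%classic : set T).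
Proof. by apply: measurableX; exact: measurable_itv. Qed.

Lemma measure_square (x y s : R) : 0 < s ->
  m2 (`](x - s)%R, (x + s)%R[%classic `*` `](y - s)%R, (y + s)%R[%classic) = (4 * s ^+ 2)%:E.
Proof.
move=> s0; have i (z : R) : mu `](z - s)%R, (z + s)%R[%classic = (2 * s)%:E.
  rewrite lebesgue_measure_itv /= lte_fin ifT; last by lra.
  by rewrite -EFinB; congr EFin; ring.
rewrite product_measure1E; try exact: measurable_itv.
transitivity ((2 * s)%:E * (2 * s)%:E)%E; first by congr (_ * _)%E; exact: i.
by rewrite -EFinM; congr EFin; ring.
Qed.

(** Crude bounds by a circumscribed and an inscribed square suffice: only the
    comparison with s^2 matters. *)
Lemma ball_area_le b s : 0 < s -> (m2 (ball_area b s) <= (4 * s ^+ 2)%:E)%E.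
Proof.
move=> s0; rewrite -(measure_square (complex.Re b) (complex.Im b) s0).
apply: le_measure; rewrite ?inE; [exact: measurable_ball_area|exact: measurable_square|].
move=> u /= h; split; rewrite /= in_itv /= -ltr_distl.
  by apply: le_lt_trans h; apply: le_trans (mod_Re _); case: b => ? ?.
by apply: le_lt_trans h; apply: le_trans (mod_Im _); case: b => ? ?.
Qed.

Lemma ball_area_ge b s : 0 < s -> ((s ^+ 2)%:E <= m2 (ball_area b s))%E.
Proof.
move=> s0; have s2 : 0 < s / 2 by rewrite divr_gt0.
have <- : m2 (`](complex.Re b - s / 2)%R, (complex.Re b + s / 2)%R[%classic `*`
   `](complex.Im b - s / 2)%R, (complex.Im b + s / 2)%R[%classic) = (s ^+ 2)%:E.
  by rewrite measure_square //; congr EFin; field.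
apply: le_measure; rewrite ?inE; [exact: measurable_square|exact: measurable_ball_area|].
move=> u /= []; rewrite !in_itv /= -!ltr_distl => h1 h2.
rewrite /ball_area /in_plane /=; apply: (le_lt_trans (mod_le_ReIm _)).
by case: b h1 h2 => p q /= h1 h2; rewrite [ltRHS](splitr s) ltrD.
Qed.

Lemma ge0_integral_unimodular N j (F : C -> \bar R) : (3 < N)%N ->
  (forall c, modulus c = 1 -> measurable_fun setT (fun u : T => F (c * cplx u))) ->
  (forall x, (0 <= F x)%E) ->
  (\int[m2]_u F (root_of_unity R N ^+ j * cplx u)%R = \int[m2]_u F (cplx u))%E.
Proof.
move=> N4 mF F0; elim: j => [|j ih]; first by apply: eq_integral => u _; rewrite mul1r.
rewrite -ih.
have cN : cos (pi *+ 2 / N%:R) != -1 :> R.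
  rewrite gt_eqF // (lt_le_trans (ltrN10 _)) // cos_ge0_pihalf //.
  have N0 : 0 < N%:R :> R by rewrite ltr0n; exact: leq_trans N4.
  apply/andP; split.
    apply: (le_trans (_ : _ <= 0)); first by rewrite oppr_le0 divr_ge0 // pi_ge0.
    by rewrite divr_ge0 ?(ltW N0) // mulrn_wge0 // pi_ge0.
  have N4R : 4 <= N%:R :> R by rewrite ler_nat.
  have h : 0 <= (pi : R) * (N%:R - 4) by rewrite mulr_ge0 ?pi_ge0 // subr_ge0.
  by rewrite ler_pdivrMr // -[pi *+ 2]mulr_natr; move: h; lra.
rewrite -(ge0_integral_rotation (F := fun x => F (root_of_unity R N ^+ j * x)) cN) //.
  by apply: eq_integral => u _; rewrite mulrA -exprSr.
by apply: mF; exact: mod_root_of_unityX.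
Qed.

(** Rotation invariance replaces polar coordinates: circle_mean bounds |f(b)|^p by
    means over N rotated points, and each rotation preserves the integral over the
    disc.  The constant 1 is the same for all exponents. *)
Lemma area_mean f b (s p : R) : 0 < s -> 0 < p ->
  (forall x, modulus (x - b) <= s -> hol_at f x) ->
  ((modulus (f b) `^ p)%R%:E * m2 (ball_area b s) <=
   \int[m2]_(u in ball_area b s) (modulus (f (cplx u)) `^ p)%R%:E)%E.
Proof.
move=> s0 p0 hf.
pose F (y : C) : \bar R := if modulus y < s then (modulus (f (b + y)) `^ p)%:E else 0%E.
pose J (y : C) : \bar R := if modulus y < s then 1%E else 0%E.
have mdisc : measurable (ball_area 0 s) by exact: measurable_ball_area.
have mF c : modulus c = 1 -> measurable_fun setT (fun u : T => F (c * cplx u)).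
  move=> c1; rewrite (_ : (fun _ => _) =
     (fun u : T => (modulus (f (b + c * cplx u)) `^ p)%:E) \_ (ball_area 0 s)); last first.
    by apply/funext => u; rewrite /F patchE in_ball_area subr0 modM c1 mul1r.
  apply: (measurable_restrictT _ mdisc).1; apply/measurable_EFinP.
  apply: (@cont_measurable _ (fun y => modulus (f (b + c * y)) `^ p)); first exact: open_ball.
  move=> y /=; rewrite subr0 => ys; apply: hol_cont_powR => //.
  apply: (@hol_comp _ f (fun y => b + c * y)); first exact: hol_affine.
  by apply: hf; rewrite addrAC subrr add0r modM c1 mul1r ltW.
have mF1 : measurable_fun setT (fun u : T => F (cplx u)).
  by have := mF 1 (mod1 R); apply: eq_measurable_fun => u _; rewrite mul1r.
have F0 y : (0 <= F y)%E by rewrite /F; case: ifP => // _; rewrite lee_fin powR_ge0.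
have mJ : measurable_fun setT (fun u : T => J (cplx u)).
  rewrite (_ : (fun _ => _) = (cst 1%E) \_ (ball_area 0 s)); last first.
    by apply/funext => u; rewrite /J patchE in_ball_area subr0.
  by apply: (measurable_restrictT _ mdisc).1; exact: measurable_cst.
have J0 y : (0 <= J y)%E by rewrite /J; case: ifP.
have transl (G : C -> \bar R) : measurable_fun setT (fun u : T => G (cplx u)) -> (forall y, (0 <= G y)%E) ->
    (\int[m2]_u G (cplx u - b)%R = \int[m2]_u G (cplx u))%E.
  move=> mG G0; rewrite -(@ge0_integral_translate _ (- complex.Re b, - complex.Im b) _ mG) //.
  by apply: eq_integral => u _; congr G; case: b {hf F mF mF1 F0} => p' q'.
have IE : (\int[m2]_(u in ball_area b s) (modulus (f (cplx u)) `^ p)%R%:E = \int[m2]_u F (cplx u))%E.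
  rewrite -transl // integral_mkcond; apply: eq_integral => u _.
  by rewrite patchE in_ball_area /F subrKC.
have JE : (m2 (ball_area b s) = \int[m2]_u J (cplx u))%E.
  rewrite -transl //; transitivity (\int[m2]_(u in ball_area b s) cst 1%E u)%E.
    by rewrite (integral_cst m2 (measurable_ball_area b s)) mul1e.
  rewrite integral_mkcond.
  by apply: eq_integral => u _; rewrite patchE in_ball_area /J.
rewrite IE JE; set I := (\int[m2]_u F _)%E; set M := (\int[m2]_u J _)%E.
have Mle : (M <= (4 * s ^+ 2)%:E)%E by rewrite /M -JE; exact: ball_area_le.
have M0 : (0 <= M)%E by exact: integral_ge0.
(* Integrate over the disc the inequality between f (b) and the mean over the N
   rotations of y, all of which have the same integral; the error d of circle_mean
   costs at most e in total. *)
apply/lee_addgt0Pr => e e0.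
pose d := e / (4 * s ^+ 2).
have s20 : 0 < 4 * s ^+ 2 by rewrite mulr_gt0 // exprn_gt0.
have d0 : 0 < d by rewrite divr_gt0.
have [N N4 hN] := circle_mean p0 d0 hf.
have N0 : 0 < N%:R :> R by rewrite ltr0n; exact: leq_trans N4.
pose w := root_of_unity R N.
have Ni0 : (0 <= (N%:R^-1 : R)%:E)%E by rewrite lee_fin invr_ge0 ltW.
have pt y : ((modulus (f b) `^ p)%R%:E * J y <=
    \sum_(j < N) (N%:R^-1)%R%:E * F (w ^+ j * y)%R + d%:E * J y)%E.
  rewrite /J /F; case: ifPn => ys; last first.
    rewrite !mule0 adde0 sume_ge0 // => j _.
    by rewrite mule_ge0 //; case: ifP => // _; rewrite lee_fin powR_ge0.
  rewrite !mule1 (eq_bigr (fun j : 'I_N => (N%:R^-1 * modulus (f (b + w ^+ j * y)) `^ p)%:E)).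
    rewrite sumEFin -EFinD lee_fin -mulr_sumr.
    rewrite -(ler_pM2r N0) mulrDl [N%:R^-1 * _]mulrC divfK ?gt_eqF //.
    exact: hN (ltW ys).
  by move=> j _; rewrite modM mod_root_of_unityX mul1r ys EFinM.
have mS j : measurable_fun setT (fun u : T => (N%:R^-1)%R%:E * F (w ^+ j * cplx u)%R)%E.
  by apply: emeasurable_funM => //; apply: mF; exact: mod_root_of_unityX.
have S0 j (u : T) : (0 <= (N%:R^-1)%R%:E * F (w ^+ j * cplx u)%R)%E by exact: mule_ge0.
have intpt : ((modulus (f b) `^ p)%R%:E * M <= I + d%:E * M)%E.
  rewrite /M -!ge0_integralZl_EFin ?powR_ge0 ?(ltW d0) //; try by move=> *; exact: J0.
  apply: (@le_trans _ _ (\int[m2]_u (\sum_(j < N) (N%:R^-1)%R%:E * F (w ^+ j * cplx u)%R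
      + d%:E * J (cplx u)))%E).
    apply: ge0_le_integral => //.
    - by move=> u _; rewrite mule_ge0 ?lee_fin ?powR_ge0.
    - by apply: emeasurable_funM.
    - apply: emeasurable_funD; first exact: emeasurable_sum.
      exact: emeasurable_funM.
  rewrite ge0_integralD //; last 4 first.
  - by move=> u _; exact: sume_ge0.
  - exact: emeasurable_sum.
  - by move=> u _; rewrite mule_ge0 // lee_fin ltW.
  - exact: emeasurable_funM.
  rewrite leeD2r // ge0_integral_sum //.
  rewrite (eq_bigr (fun=> ((N%:R^-1)%R%:E * I)%E)).
    rewrite -ge0_sume_distrl //= ?sumEFin ?sumr_const ?card_ord //.
    by rewrite -[_ *+ N]mulr_natr mulVf ?gt_eqF // mul1e.
  move=> j _; rewrite /I -(ge0_integral_unimodular j N4 mF F0).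
  apply: (@ge0_integralZl_EFin _ T R m2 setT measurableT (fun u => F (w ^+ j * cplx u)%R)).
  - by move=> u _; exact: F0.
  - by apply: mF; exact: mod_root_of_unityX.
  - by rewrite invr_ge0 ltW.
apply: (le_trans intpt); rewrite leeD2l //.
apply: (le_trans (lee_wpmul2l _ Mle)); first by rewrite lee_fin ltW.
by rewrite -EFinM lee_fin /d divfK // gt_eqF.
Qed.

End AreaMeans.
(** * The averaging kernel *)
Section Kernel.
Variable R : realType.
Local Notation C := R[i].
Local Notation T := (measurableTypeR R * measurableTypeR R)%type.
Local Notation mu := (@lebesgue_measure R).
Local Notation m2 := (@lebesgue_measure R \x @lebesgue_measure R)%E.
Implicit Types (d : R) (a z : C).

(** Normalised so that its integral over the line is 2 for every width d. *)
Definition kern d (x : R) : R := d / (d + `|x|) ^+ 2.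

Lemma kern_gt0 d x : 0 < d -> 0 < kern d x.
Proof. by move=> d0; rewrite divr_gt0 // exprn_gt0 // ltr_pwDl. Qed.

Lemma kern_ge0 d : 0 < d -> forall x, 0 <= kern d x.
Proof. by move=> d0 x; exact/ltW/kern_gt0. Qed.

Lemma continuous_kern d : 0 < d -> continuous (kern d).
Proof.
move=> d0 x; apply: cvgM; first exact: cvg_cst.
apply: cvgV; first by rewrite expf_neq0 // gt_eqF // ltr_pwDl.
have hc : (fun y : R => d + `|y|) @ x --> d + `|x|.
  by apply: cvgD; [exact: cvg_cst|exact: norm_continuous].
rewrite expr2 (_ : (fun y : R => _) = (fun y : R => (d + `|y|) * (d + `|y|))); last first.
  by apply/funext => y; rewrite expr2.
exact: cvgM.
Qed.

Lemma ge0_integral_kern d : 0 < d -> (\int[mu]_x (kern d x)%:E)%E = (2 : R)%:E.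
Proof.
move=> d0; have cf := continuous_kern d0; have f0 := kern_ge0 d0.
have dp (x : R) : 0 < d + `|x| by rewrite ltr_pwDl.
pose F (x : R) : R := - (d * (d + x)^-1).
have dF (x : R) : 0 <= x -> is_derive x 1 F (d / (d + x) ^+ 2).
  move=> x0; have n0 : d + x != 0 by rewrite gt_eqF // ltr_pwDl.
  have h1 : is_derive x (1 : R) (fun y : R => d + y) (0 + 1).
    by apply: is_deriveD.
  have h2 := @realfun.is_deriveV _ (fun y : R => d + y) x _ 1 n0 h1.
  have h3 := is_deriveN (is_deriveZ d h2).
  apply: is_derive_eq h3 _.
  by rewrite add0r /GRing.scale /= mulr1 mulrN opprK.
rewrite ge0_symfun_integralT //; last by move=> x; rewrite /kern /= normrN.
rewrite -set_itvcy (@ge0_continuous_FTC2y _ _ F 0 0).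
- rewrite /F addr0 divff ?gt_eqF // -EFinB sub0r opprK.
  by rewrite -EFinM mulr1.
- by move=> x _; exact: f0.
- exact: continuous_subspaceT.
- apply/cvgrPdist_lt => e e0; near=> x.
  have xe : d / e < x by near: x; apply: nbhs_pinfty_gt; exact: num_real.
  have x0 : 0 < x by apply: lt_trans xe; rewrite divr_gt0.
  rewrite /F sub0r opprK ger0_norm; last by rewrite divr_ge0 ?addr_ge0 // ltW.
  rewrite ltr_pdivrMr ?addr_gt0 // mulrDr.
  by move: xe; rewrite ltr_pdivrMr // mulrC => /lt_le_trans; apply; rewrite lerDr mulr_ge0 // ltW.
- by move=> x x0; have [] := dF x (ltW x0).
- apply: cvg_at_right_filter; have [h _] := dF 0 (lexx 0).
  exact/differentiable_continuous/derivable1_diffP.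
- move=> x; rewrite in_itv /= andbT => x0; have := dF x (ltW x0) => h.
  by rewrite derive1E (derive_val (is_derive := h)) /kern ger0_norm // ltW.
Unshelve. all: by end_near. Qed.

Lemma ge0_integral_kernM d (c : T) : 0 < d ->
  (\int[m2]_u (kern d (u.1 - c.1) * kern d (u.2 - c.2))%R%:E = (4 : R)%:E)%E.
Proof.
move=> d0; have mk : measurable_fun setT (kern d).
  exact: continuous_measurable_fun (continuous_kern d0).
pose F (u : T) : \bar R := ((kern d u.1)%:E * (kern d u.2)%:E)%E.
have F0 u : (0 <= F u)%E by rewrite mule_ge0 // lee_fin kern_ge0.
have mF : measurable_fun setT F.
  apply: emeasurable_funM; apply/measurable_EFinP.
    exact: (measurableT_comp mk (measurable_fst)).
  exact: (measurableT_comp mk (measurable_snd)).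
have k0 (x : R) : (0 <= (kern d x)%:E)%E by rewrite lee_fin kern_ge0.
have mke : measurable_fun setT (fun x => (kern d x)%:E) by exact/measurable_EFinP.
rewrite -[LHS]/(\int[m2]_u F (u.1 + (- c.1), u.2 + (- c.2))%R)%E.
rewrite (@ge0_integral_translate R (- c.1, - c.2) F mF F0) (fubini_tonelli1 F mF F0).
transitivity (\int[mu]_x ((2 : R)%:E * (kern d x)%:E))%E.
  apply: eq_integral => x _; rewrite /fubini_F /F /=.
  by rewrite ge0_integralZl_EFin ?kern_ge0 // ge0_integral_kern // muleC.
by rewrite ge0_integralZl_EFin // ge0_integral_kern // -EFinM -natrM.
Qed.
End Kernel.

Section PlaneTonelli.
Variable R : realType.
Local Notation T := (measurableTypeR R * measurableTypeR R)%type.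
Local Notation m2 := (@lebesgue_measure R \x @lebesgue_measure R)%E.

(** The product measure again, under a name of its own to which sigma-finiteness
    is attached; Tonelli's theorem on pairs of points of the plane requires it. *)
Definition plane_lebesgue : set T -> \bar R := m2.

HB.instance Definition _ := Measure.on plane_lebesgue.

Lemma plane_lebesgue_sigma_finite : sigma_finite setT plane_lebesgue.
Proof.
exists (fun n => ball_area (0 : R[i]) n.+1%:R).
  apply/esym/seteqP; split => // u _; exists (Num.truncn (modulus (cplx u))) => //.
  by apply: set_mem; rewrite in_ball_area subr0;
    exact: real_truncnS_gt (num_real _).
move=> n; split; first exact: measurable_ball_area.
by apply: (le_lt_trans (ball_area_le _ _)); rewrite ?ltry.
Qed.

HB.instance Definition _ := @Measure_isSigmaFinite.Build _ T R plane_lebesgue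
  plane_lebesgue_sigma_finite.

Lemma plane_tonelli (F : T * T -> \bar R) : measurable_fun setT F ->
  (forall u, 0 <= F u)%E ->
  (\int[m2]_u \int[m2]_v F (u, v) = \int[m2]_v \int[m2]_u F (u, v))%E.
Proof.
by move=> mF F0; exact: (@fubini_tonelli _ _ T T R plane_lebesgue plane_lebesgue F mF F0).
Qed.

Lemma measurable_plane_integral (F : T * T -> \bar R) : measurable_fun setT F ->
  (forall u, 0 <= F u)%E -> measurable_fun setT (fun u => (\int[m2]_v F (u, v))%E).
Proof.
move=> mF F0.
have h := @measurable_fun_fubini_tonelli_F _ _ T T R plane_lebesgue F mF F0.
exact: h.
Qed.

End PlaneTonelli.

Section Average.
Variable R : realType.
Local Notation C := R[i].
Local Notation T := (measurableTypeR R * measurableTypeR R)%type.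
Local Notation m2 := (@lebesgue_measure R \x @lebesgue_measure R)%E.
Local Notation D := (@plane_disc R).
Implicit Types (u v : T) (psi : T -> R).

Lemma measurable_plane_disc : measurable D.
Proof. exact: open_set_measurable (@open_unit_disc R). Qed.

(** A product of two one-dimensional kernels of width 1 - |v|.  It is comparable
    to (1 - |v|)^-2 when |u - v| is at most a multiple of 1 - |v|, it decays
    polynomially beyond, and its integral in u is explicit. *)
Definition avg_kernel u v : R :=
  kern (1 - modulus (cplx v)) (u.1 - v.1) * kern (1 - modulus (cplx v)) (u.2 - v.2).

Definition average psi u : \bar R :=
  (\int[m2]_(v in D) (avg_kernel u v * psi v)%R%:E)%E.

Lemma in_plane_disc u : (u \in D) = (modulus (cplx u) < 1).
Proof. by apply/idP/idP => [/set_mem|h]; last apply/mem_set. Qed.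

Lemma avg_kernel_ge0 u v : D v -> 0 <= avg_kernel u v.
Proof. by move=> Dv; rewrite mulr_ge0 // kern_ge0 // subr_gt0. Qed.

Lemma kernM_le (d e X Y : R) : 0 < d -> 0 < e -> 0 <= X -> 0 <= Y -> d <= e + X + Y ->
  e / (e + X) ^+ 2 * (e / (e + Y) ^+ 2) <= d ^- 2.
Proof.
move=> d0 e0 X0 Y0 le1.
have p0 : 0 < (e + X) * (e + Y) by rewrite mulr_gt0 ?ltr_pwDl.
rewrite (_ : _ * _ = (e / ((e + X) * (e + Y))) ^+ 2); last first.
  by field; rewrite !gt_eqF ?ltr_pwDl.
rewrite -exprVn ler_pXn2r ?nnegrE ?invr_ge0 ?divr_ge0 ?(ltW d0) ?(ltW e0) ?(ltW p0) //.
rewrite ler_pdivrMr // ler_pdivlMl //.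
have := ler_wpM2r (ltW e0) le1; have := mulr_ge0 X0 Y0.
by rewrite !mulrDl !mulrDr; lra.
Qed.

Lemma avg_kernel_le u v : D u -> D v -> avg_kernel u v <= (1 - modulus (cplx u)) ^- 2.
Proof.
move=> Du Dv; apply: kernM_le; rewrite ?subr_gt0 //.
by have := mod_sub_ge (cplx v) (cplx u); rewrite mod_subC; have := cplx_sub_le u v; lra.
Qed.

Lemma measurable_kern d (S : measurableType d) (g h : S -> R) : (forall x, 0 <= g x) ->
  measurable_fun setT g -> measurable_fun setT h ->
  measurable_fun setT (fun x => kern (g x) (h x)).
Proof.
move=> g0 mg mh; rewrite (_ : (fun _ => _) =
  (fun x => g x * (g x + `|h x|) `^ (- 2%:R))); last first.
  by apply/funext => x; rewrite powR_invn // addr_ge0.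
apply: measurable_funM => //; apply: (measurableT_comp (@measurable_powR R (- 2%:R))).
by apply: measurable_funD => //; exact: measurableT_comp.
Qed.

Section Psi.
Variable psi : T -> R.
Hypothesis mpsi : measurable_fun D psi.
Hypothesis psi0 : forall v, D v -> 0 <= psi v.

(** Cut off outside the disc, the integrand becomes measurable on all pairs. *)
Let gap v : R := ((fun v => 1 - modulus (cplx v)) \_ D) v.
Let gap_ge0 v : 0 <= gap v.
Proof. by rewrite /gap patchE in_plane_disc; case: ifP => // /ltW; rewrite subr_ge0. Qed.

Let mgap : measurable_fun setT gap.
Proof.
apply: (measurable_restrictT _ measurable_plane_disc).1.
apply: measurable_funB; first exact: measurable_cst.
apply: (@cont_measurable R (@unit_disc R) (fun x => modulus x)); first exact: open_unit_disc.
by move=> x _; have := hol_cont_mod (hol_id x).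
Qed.

Let F (uv : T * T) : \bar R :=
  (kern (gap uv.2) (uv.1.1 - uv.2.1) * kern (gap uv.2) (uv.1.2 - uv.2.2)
    * (psi \_ D) uv.2)%:E.

Let F0 uv : (0 <= F uv)%E.
Proof.
rewrite lee_fin /F; have [Dv|nDv] := boolP (uv.2 \in D); last first.
  by rewrite ![(_ \_ _) _]patchE (negbTE nDv) mulr0.
rewrite mulr_ge0 //; last by rewrite patchE Dv psi0 // -in_setE.
by rewrite mulr_ge0 // divr_ge0 // exprn_ge0 // addr_ge0.
Qed.

Let mF : measurable_fun setT F.
Proof.
apply/measurable_EFinP; have m1 : measurable_fun setT (fun uv : T * T => uv.1).
  exact: measurable_fst.
have m2' : measurable_fun setT (fun uv : T * T => uv.2) by exact: measurable_snd.
have mg : measurable_fun setT (fun uv : T * T => gap uv.2) by exact: measurableT_comp mgap m2'.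
apply: measurable_funM; last first.
  exact: measurableT_comp ((measurable_restrictT _ measurable_plane_disc).1 mpsi) m2'.
apply: measurable_funM; apply: measurable_kern => //; apply: measurable_funB.
- exact: measurableT_comp measurable_fst m1.
- exact: measurableT_comp measurable_fst m2'.
- exact: measurableT_comp measurable_snd m1.
- exact: measurableT_comp measurable_snd m2'.
Qed.

Let averageE u : average psi u = (\int[m2]_v F (u, v))%E.
Proof.
rewrite /average integral_mkcond; apply: eq_integral => v _.
rewrite patchE /F /gap /avg_kernel !patchE; case: ifP => //= _.
by rewrite mulr0.
Qed.

Lemma average_ge0 u : (0 <= average psi u)%E.
Proof. by rewrite averageE; exact: integral_ge0. Qed.

Lemma measurable_average : measurable_fun D (average psi).
Proof.
apply: measurable_funTS; rewrite (_ : average psi = fun u => (\int[m2]_v F (u, v))%E).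
  exact: measurable_plane_integral mF F0.
by apply/funext => u; exact: averageE.
Qed.

Lemma measurable_avg_kernelM u : measurable_fun D (fun v => (avg_kernel u v * psi v)%:E).
Proof.
apply: (@eq_measurable_fun _ _ _ _ D (fun v => F (u, v))).
  by move=> v Dv; rewrite /F /gap /= ![(_ \_ _) v]patchE Dv.
by apply: measurable_funTS; exact: measurable_fun_pair2.
Qed.

(** For fixed u the kernel is bounded, so the average of an integrable function is
    finite at every point and not only almost everywhere. *)
Lemma average_le u : D u ->
  (average psi u <= ((1 - modulus (cplx u)) ^- 2)%R%:E * \int[m2]_(v in D) (psi v)%:E)%E.
Proof.
move=> Du; have c0 : 0 <= (1 - modulus (cplx u)) ^- 2 by rewrite invr_ge0 sqr_ge0.
rewrite -ge0_integralZl_EFin //; last 2 first.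
- exact: measurable_plane_disc.
- exact/measurable_EFinP.
apply: ge0_le_integral; first exact: measurable_plane_disc.
- by move=> v Dv; rewrite lee_fin mulr_ge0 ?avg_kernel_ge0 ?psi0.
- exact: measurable_avg_kernelM.
- by apply/measurable_EFinP; apply: measurable_funM.
- by move=> v Dv; rewrite lee_fin ler_wpM2r ?psi0 ?avg_kernel_le.
Qed.

(** The kernel has mass 4 in its first variable, whatever the second. *)
Lemma integral_average_le :
  (\int[m2]_(u in D) average psi u <= (4 : R)%:E * \int[m2]_(v in D) (psi v)%:E)%E.
Proof.
apply: (@le_trans _ _ (\int[m2]_u \int[m2]_v F (u, v))%E).
  rewrite integral_mkcond; apply: ge0_le_integral => //.
  - by move=> u _; rewrite patchE; case: ifP => // _; exact: average_ge0.
  - by apply: (measurable_restrictT _ measurable_plane_disc).1; exact: measurable_average.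
  - exact: measurable_plane_integral mF F0.
  - move=> u _; rewrite patchE; case: ifP => _; first by rewrite averageE.
    exact: integral_ge0.
rewrite (plane_tonelli mF F0) -ge0_integralZl_EFin //; last 2 first.
- exact: measurable_plane_disc.
- exact/measurable_EFinP.
rewrite [leRHS]integral_mkcond le_eqVlt; apply/orP; left; apply/eqP.
apply: eq_integral => v _.
rewrite patchE /F /gap; case: ifPn => Dv; last first.
  rewrite -[RHS](integral0 m2 setT); apply: eq_integral => u _.
  by rewrite /= ![(_ \_ _) v]patchE (negbTE Dv) mulr0.
have d0 : 0 < 1 - modulus (cplx v) by rewrite subr_gt0 -in_plane_disc.
have pv0 : 0 <= psi v by apply: psi0; rewrite -in_setE.
rewrite -(ge0_integral_kernM v d0) muleC -ge0_integralZl_EFin //; last 2 first.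
- by move=> u _; rewrite lee_fin; apply: avg_kernel_ge0; rewrite -in_setE.
- by apply/measurable_EFinP; apply: measurable_funM; apply: measurable_kern;
    rewrite ?ltW //; apply: measurable_funB.
by apply: eq_integral => u _; rewrite /= ![(_ \_ _) v]patchE Dv -EFinM [in RHS]mulrC.
Qed.
End Psi.
End Average.

(** * The pointwise estimate *)
Section LevelEstimate.
Variable R : realType.
Local Notation C := R[i].
Local Notation T := (measurableTypeR R * measurableTypeR R)%type.
Local Notation m2 := (@lebesgue_measure R \x @lebesgue_measure R)%E.
Local Notation D := (@plane_disc R).
Implicit Types (a x z xi : C) (u v : T).

(** m = |1 - conj(a) xi| dominates |a - xi| and 1 - |a|, and by the identity for
    1 - |phi_a(xi)|^2, m^2 <= Q (1 - |a|^2) (1 - |xi|^2) <= 4 Q m (1 - |xi|). *)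
Lemma sub_le_gap a xi (Q : R) : unit_disc a -> unit_disc xi -> 0 < Q ->
  Q^-1 <= 1 - modulus (disc_aut a xi) ^+ 2 ->
  modulus (a - xi) <= 4 * Q * (1 - modulus xi).
Proof.
move=> a1 x1 Q0 hQ; have aid := disc_aut_identity a1 x1.
set m := modulus (1 - conjc a * xi) in aid *.
have m0 : 0 < m by rewrite /m mod_gt0 one_sub_conjM_neq0 // ltW.
have am : 1 - modulus a <= m by exact: one_sub_conjM_ge' (ltW x1).
have sub_m : modulus (a - xi) <= m.
  have -> : modulus (a - xi) = modulus (disc_aut a xi) * m.
    by rewrite /disc_aut mod_div divfK // gt_eqF.
  by rewrite ler_piMl ?(ltW m0) // ltW // disc_aut_in.
apply: (le_trans sub_m); rewrite -(ler_pM2l m0).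
move: hQ; rewrite aid ler_pdivlMr ?exprn_gt0 // ler_pdivrMl // expr2 => hQ.
apply: (le_trans hQ).
have /andP[p1 p2] := one_sub_sqr_bounds (mod_ge0 a) a1.
have /andP[q1 q2] := one_sub_sqr_bounds (mod_ge0 xi) x1.
rewrite (_ : m * _ = Q * ((2 * m) * (2 * (1 - modulus xi)))); last by ring.
have a0 : 0 <= 1 - modulus a by rewrite subr_ge0 ltW.
rewrite ler_pM2l //; apply: ler_pM (le_trans p2 _) q2; rewrite ?ler_pM2l //.
  exact: le_trans a0 p1.
by apply: le_trans q1; rewrite subr_ge0 ltW.
Qed.

(** Since |1 - conj(a) z| >= 1 - |a|, the euclidean disc about a of radius
    c (1 - |a|) lies in the pseudohyperbolic one of radius c. *)
Lemma near_ball a z (c : R) : unit_disc a -> 0 < c -> c <= 2^-1 ->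
  modulus (z - a) <= c * (1 - modulus a) ->
  [/\ unit_disc z, modulus (disc_aut a z) <= c,
      1 - modulus a <= 2 * (1 - modulus z) & 1 - modulus z <= 2 * (1 - modulus a)].
Proof.
move=> a1 c0 c1 h; have d0 : 0 < 1 - modulus a by rewrite subr_gt0.
have cd : c * (1 - modulus a) <= 2^-1 * (1 - modulus a) by rewrite ler_wpM2r // ltW.
have h1 := mod_sub_ge z a; have h2 := mod_sub_ge a z; rewrite mod_subC in h2.
have z1 : unit_disc z by rewrite /unit_disc /=; lra.
split=> //; [|lra..]; rewrite /disc_aut mod_div mod_subC.
have m0 := one_sub_conjM_ge' a (ltW z1).
rewrite ler_pdivrMr; last exact: lt_le_trans d0 m0.
by apply: (le_trans h); rewrite ler_wpM2l // ltW.
Qed.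

Section Weight.
Variables (w : C -> R) (r K : R).
Hypotheses (r01 : 0 < r < 1) (K1 : 1 <= K).
Hypothesis w_gt0 : forall x, unit_disc x -> 0 < w x.
Hypothesis w_inv : forall a x, unit_disc a -> pseudo_disc a r x ->
  K^-1 * w a <= w x <= K * w a.
Hypothesis mw : measurable_fun D (fun u => w (cplx u)).

Definition density (p : R) (f : C -> C) u : R := modulus (f (cplx u)) `^ p * w (cplx u).

Lemma density_ge0 p f u : D u -> 0 <= density p f u.
Proof. by move=> Du; rewrite mulr_ge0 ?powR_ge0 // ltW // w_gt0. Qed.

Variables (p : R) (f : C -> C).
Hypotheses (p0 : 0 < p) (hf : forall x, unit_disc x -> hol_at f x).

Lemma measurable_density : measurable_fun D (density p f).
Proof.
apply: measurable_funM => //.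
apply: (@cont_measurable R (@unit_disc R) (fun x => modulus (f x) `^ p)).
  exact: open_unit_disc.
by move=> x x1; apply: hol_cont_powR => //; exact: hf.
Qed.

(** By the sub-mean value property |f(xi)|^p w(xi) is bounded by the mean of
    |f|^p w over a disc about xi of radius (r/2)(1 - |xi|), on which w varies by at
    most a factor K.  On this disc the averaging kernel based at u is at least
    k, of order (Q^4 (1 - |xi|)^2)^-1, because |u - v| <= 9 Q (1 - |v|). *)
Lemma level_estimate u xi (Q : R) : D u -> unit_disc xi -> 1 <= Q ->
  Q^-1 <= 1 - modulus (disc_aut (cplx u) xi) ^+ 2 ->
  ((modulus (f xi) `^ p * w xi)%:E <=
   (16 * 10 ^+ 4 * K / r ^+ 2 * Q ^+ 4)%R%:E * average (density p f) u)%E.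
Proof.
move=> Du x1 Q1 hQ; have /andP[r0 r1] := r01.
have K0 : 0 < K by exact: lt_le_trans ltr01 K1.
have Q0 : 0 < Q by exact: lt_le_trans ltr01 Q1.
set d := 1 - modulus xi; have d0 : 0 < d by rewrite subr_gt0.
pose s := r / 2 * d; have s0 : 0 < s by rewrite mulr_gt0 // divr_gt0.
have r2 : 0 < r / 2 by rewrite divr_gt0.
have r2' : r / 2 <= 2^-1 by lra.
have ball v : modulus (cplx v - xi) <= s -> [/\ unit_disc (cplx v),
    modulus (disc_aut xi (cplx v)) <= r / 2, d <= 2 * (1 - modulus (cplx v))
    & 1 - modulus (cplx v) <= 2 * d].
  exact: near_ball.
pose k := (4 * 10 ^+ 4 * Q ^+ 4 * d ^+ 2)^-1.
have k0 : 0 < k by rewrite invr_gt0 !mulr_gt0 ?exprn_gt0.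
have kle v : modulus (cplx v - xi) <= s -> k <= avg_kernel u v.
  move=> vs; have [v1 _ dv vd] := ball v vs.
  set e := 1 - modulus (cplx v) in dv vd *; have e0 : 0 < e by rewrite subr_gt0.
  have av : modulus (cplx u - cplx v) <= 9 * Q * e.
    apply: (le_trans (mod_triangle _ xi _)); rewrite [modulus (xi - _)]mod_subC.
    have h1 := sub_le_gap Du x1 Q0 hQ.
    have h2 : s <= 2^-1 * d by rewrite ler_wpM2r // ltW.
    have h3 : Q * d <= Q * (2 * e) by rewrite ler_pM2l.
    have h4 : e <= Q * e by rewrite ler_peMl // ltW.
    rewrite -/d -[4 * Q * d]mulrA in h1; rewrite -[9 * Q * e]mulrA.
    rewrite [Q * (2 * e)]mulrCA in h3.
    by move: h1 h2 h3 h4 vs dv; move: (Q * d) (Q * e) => X Y; lra.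
  have ke (x : R) : `|x| <= 9 * Q * e -> (100 * Q ^+ 2 * e)^-1 <= kern e x.
    move=> xe; have ex0 : 0 < e + `|x| by rewrite ltr_pwDl.
    rewrite ler_pdivlMr ?exprn_gt0 // ler_pdivrMl ?mulr_gt0 ?exprn_gt0 //.
    rewrite (_ : 100 * Q ^+ 2 * e * e = (10 * (Q * e)) ^+ 2); last by ring.
    rewrite ler_pXn2r ?nnegrE ?(ltW ex0) ?mulr_ge0 ?(ltW Q0) ?(ltW e0) //.
    have h4 : e <= Q * e by rewrite ler_peMl // ltW.
    by rewrite -mulrA in xe; move: xe h4; move: (Q * e) => Y; lra.
  apply: (@le_trans _ _ ((100 * Q ^+ 2 * e)^-1 * (100 * Q ^+ 2 * e)^-1)).
    rewrite -invfM lef_pV2 ?posrE ?mulr_gt0 ?exprn_gt0 //.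
    rewrite (_ : 100 * Q ^+ 2 * e * _ = 10 ^+ 4 * Q ^+ 4 * e ^+ 2); last by ring.
    rewrite (_ : 4 * 10 ^+ 4 * _ * _ = 10 ^+ 4 * Q ^+ 4 * (2 * d) ^+ 2); last by ring.
    by rewrite ler_pM2l ?mulr_gt0 ?exprn_gt0 // ler_pXn2r ?nnegrE ?mulr_ge0 // ltW.
  have ke0 : 0 <= (100 * Q ^+ 2 * e)^-1 by rewrite invr_ge0 !mulr_ge0 ?exprn_ge0 // ltW.
  apply: ler_pM => //; apply: ke; apply: le_trans av.
    exact: le_trans (mod_Re _).
  exact: le_trans (mod_Im _).
have mball : measurable (ball_area xi s) by exact: measurable_ball_area.
have ballD : ball_area xi s `<=` D.
  by move=> v /= vs; have [] := ball v (ltW vs).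
have mdens := measurable_density.
have mean := area_mean s0 p0 (f := f) (b := xi).
set M := (\int[m2]_(v in ball_area xi s) (modulus (f (cplx v)) `^ p)%:E)%E in mean.
have mfp : measurable_fun (ball_area xi s) (fun v => modulus (f (cplx v)) `^ p).
  apply: (@cont_measurable R [set x | modulus (x - xi) < s] (fun x => modulus (f x) `^ p)).
    exact: open_ball.
  move=> x xs; apply: hol_cont_powR => //; apply: hf.
  by have [] := near_ball x1 r2 r2' (ltW xs).
have avg0 v : ball_area xi s v -> 0 <= avg_kernel u v by move=> /ballD; exact: avg_kernel_ge0.
have dens0 v : ball_area xi s v -> 0 <= density p f v by move=> /ballD; exact: density_ge0.
have mb : measurable_fun (ball_area xi s) (density p f).
  by apply: (measurable_funS _ ballD) => //; exact: measurable_plane_disc.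
have s1 : ((modulus (f xi) `^ p * s ^+ 2)%R%:E <= M)%E.
  apply: le_trans (mean _).
    by rewrite EFinM lee_wpmul2l ?lee_fin ?powR_ge0 //; exact: ball_area_ge.
  by move=> x xs; apply: hf; have [] := near_ball x1 r2 r2' xs.
have s2 : ((K^-1 * w xi)%R%:E * M <= \int[m2]_(v in ball_area xi s) (density p f v)%:E)%E.
  rewrite -ge0_integralZl_EFin //; last 3 first.
  - by move=> v _; rewrite lee_fin powR_ge0.
  - exact/measurable_EFinP.
  - by rewrite mulr_ge0 ?invr_ge0 ?(ltW K0) // ltW // w_gt0.
  apply: ge0_le_integral => //.
  - by move=> v _; rewrite lee_fin mulr_ge0 ?powR_ge0 // mulr_ge0 ?invr_ge0 ?(ltW K0) // ltW // w_gt0.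
  - by apply/measurable_EFinP; apply: measurable_funM.
  - exact/measurable_EFinP.
  - move=> v vs; rewrite lee_fin mulrC ler_wpM2l ?powR_ge0 //.
    have [v1 vr _ _] := ball v (ltW vs).
    have vps : pseudo_disc xi r (cplx v) by split=> //; apply: (le_lt_trans vr); lra.
    by have /andP[] := w_inv x1 vps.
have s3 : (k%:E * \int[m2]_(v in ball_area xi s) (density p f v)%:E <= average (density p f) u)%E.
  have mavg := measurable_avg_kernelM mdens u.
  rewrite -ge0_integralZl_EFin //; last 2 first.
  - exact/measurable_EFinP.
  - exact: ltW.
  apply: (@le_trans _ _ (\int[m2]_(v in ball_area xi s) (avg_kernel u v * density p f v)%R%:E)%E).
    apply: ge0_le_integral => //.
    - by move=> v vs; rewrite mule_ge0 // lee_fin ?dens0 // ltW.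
    - by apply/measurable_EFinP; apply: measurable_funM.
    - by apply: (measurable_funS _ ballD) => //; exact: measurable_plane_disc.
    - by move=> v vs; rewrite lee_fin ler_wpM2r ?dens0 //; apply/kle/ltW.
  apply: ge0_subset_integral => //; first exact: measurable_plane_disc.
  by move=> v Dv; rewrite lee_fin mulr_ge0 ?avg_kernel_ge0 // density_ge0.
have c0 : 0 < 16 * 10 ^+ 4 * K / r ^+ 2 * Q ^+ 4.
  by rewrite mulr_gt0 ?divr_gt0 ?mulr_gt0 ?exprn_gt0.
apply: le_trans (lee_wpmul2l _ s3); last by rewrite lee_fin ltW.
apply: le_trans (lee_wpmul2l _ (lee_wpmul2l _ s2)); rewrite ?lee_fin ?(ltW c0) ?(ltW k0) //.
apply: le_trans (lee_wpmul2l _ (lee_wpmul2l _ (lee_wpmul2l _ s1))); last first.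
- by rewrite lee_fin mulr_ge0 ?invr_ge0 ?(ltW K0) // ltW // w_gt0.
- by rewrite lee_fin ltW.
- by rewrite lee_fin ltW.
rewrite -!EFinM lee_fin le_eqVlt; apply/orP; left; apply/eqP; rewrite /k /s; field.
by rewrite !gt_eqF.
Qed.
End Weight.
End LevelEstimate.

Section QuotientBound.
Variable R : realType.
Local Notation C := R[i].
Local Notation T := (measurableTypeR R * measurableTypeR R)%type.
Local Notation D := (@plane_disc R).
Variables (w : C -> R) (r K : R).
Hypotheses (r01 : 0 < r < 1) (K1 : 1 <= K).
Hypothesis w_gt0 : forall x, unit_disc x -> 0 < w x.
Hypothesis w_inv : forall a x, unit_disc a -> pseudo_disc a r x ->
  K^-1 * w a <= w x <= K * w a.
Hypothesis mw : measurable_fun D (fun u : T => w (cplx u)).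

Lemma bfac_01 (z : nat -> option C) k x : in_disc z -> unit_disc x ->
  0 <= modulus (bfac (z k) x) <= 1.
Proof.
move=> zD x1; rewrite mod_ge0 andTb /bfac; case zk: (z k) => [a|]; last by rewrite mod1.
by apply/ltW/blaschke_lt1 => //; exact: zD zk.
Qed.

(** The level estimates, with Q = 4^(i+1) and constants of the form B'^(i+1), are
    exactly what combine_levels averages; this keeps the constant independent of
    p. *)
Lemma quotient_bound : exists2 Cw : R, 0 < Cw &
  forall (p : R) (f G : C -> C) (z : nat -> option C) n (u : T), 0 < p -> in_disc z ->
    (forall x, unit_disc x -> hol_at f x) -> (forall x, unit_disc x -> hol_at G x) ->
    (forall x, unit_disc x -> f x = G x * bprod z n x) -> D u ->
    ((modulus (G (cplx u)) `^ p * w (cplx u))%:E <=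
     (Cw * (\prod_(k < n) (2 - modulus (bfac (z k) (cplx u)))) `^ p)%:E
       * average (density w p f) u)%E.
Proof.
have [B B1 growth] := weight_growth r01 K1 w_gt0 w_inv.
have /andP[r0 r1] := r01; have K0 : 0 < K by exact: lt_le_trans ltr01 K1.
pose A := 16 * 10 ^+ 4 * K / r ^+ 2.
have A1 : 1 <= A.
  rewrite ler_pdivlMr ?exprn_gt0 // mul1r; apply: (@le_trans _ _ 1).
    by rewrite exprn_ile1 // ltW.
  by move: K1; move: (K) => k k1; lra.
have A0 : 0 < A by exact: lt_le_trans ltr01 A1.
have B0 : 0 < B by exact: lt_le_trans ltr01 B1.
(* A <= A^(i+1) because A >= 1, so all constants merge into a single base. *)
pose B' := A * 4 ^+ 4 * B.
have B'1 : 1 <= B' by rewrite mulr_ege1 // mulr_ege1 // exprn_ege1 //; lra.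
exists (B' ^+ 2); first by rewrite exprn_gt0 // (lt_le_trans ltr01).
move=> p f G z n u p0 zD hf hG fE Du; set a := cplx u.
have a1 : unit_disc a by exact: Du.
have wa := w_gt0 a1.
pose y (k : 'I_n) := modulus (bfac (z k) a).
have y01 k : 0 <= y k <= 1 by exact: bfac_01.
have P0 : 0 < \prod_(k < n) (2 - y k).
  by apply: prodr_gt0 => k _; have /andP[] := y01 k; lra.
have dens0 := density_ge0 w_gt0 p f.
have S0 : (0 <= average (density w p f) u)%E by exact: average_ge0.
have C0 : 0 < B' ^+ 2 * (\prod_(k < n) (2 - y k)) `^ p.
  by rewrite mulr_gt0 ?powR_gt0 // exprn_gt0 // (lt_le_trans ltr01).
have [G0|Gn0] := eqVneq (modulus (G a)) 0.
  by rewrite G0 powR0 ?gt_eqF // mul0r mule_ge0 // lee_fin ltW.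
have Gp : 0 < modulus (G a) by rewrite lt_def Gn0 mod_ge0.
have level i : (((modulus (G a) * \prod_(k < n) Num.max (y k) (lvl R i)) `^ p * w a)%:E
    <= (B' ^+ i.+1)%:E * average (density w p f) u)%E.
  have [xi [xi1 xis xim]] := jensen_max zD a1 (lvl_gt0 R i) (lvl_lt1 R i) hG fE.
  have Q1 : 1 <= (4 ^+ i.+1 : R) by rewrite exprn_ege1 //; lra.
  have hQ : (4 ^+ i.+1 : R)^-1 <= 1 - modulus (disc_aut a xi) ^+ 2.
    rewrite xis /lvl -exprVn; set q := 4^-1 ^+ i.+1.
    have q0 : 0 <= q by rewrite exprn_ge0 // invr_ge0.
    have q1 : q <= 1 by rewrite exprn_ile1 ?invr_ge0 // invf_le1 //; lra.
    have : 0 <= q * (1 - q) by rewrite mulr_ge0 // subr_ge0.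
    by rewrite expr2; lra.
  have lev := level_estimate r01 K1 w_gt0 w_inv mw p0 hf Du xi1 Q1 hQ.
  have gr := growth i a xi a1 xi1 _.
  apply: (@le_trans _ _ ((B ^+ i.+1)%:E * (modulus (f xi) `^ p * w xi)%:E)%E).
    rewrite -EFinM lee_fin mulrCA; apply: ler_pM; rewrite ?powR_ge0 ?(ltW wa) //.
      apply: ge0_ler_powR => //; rewrite ?nnegrE ?mod_ge0 ?(ltW p0) //.
      rewrite mulr_ge0 ?mod_ge0 // prodr_ge0 // => k _.
      by rewrite le_max (ltW (lvl_gt0 R i)) orbT.
    by apply: gr; rewrite xis.
  apply: le_trans (lee_wpmul2l _ lev) _; first by rewrite lee_fin exprn_ge0 // ltW.
  rewrite muleA -EFinM lee_wpmul2r // lee_fin -/A.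
  have -> : B' ^+ i.+1 = A ^+ i.+1 * (4 ^+ i.+1) ^+ 4 * B ^+ i.+1.
    rewrite /B' (exprMn i.+1 (A * 4 ^+ 4) B) (exprMn i.+1 A (4 ^+ 4)).
    by rewrite -(exprM 4 4 i.+1) -(exprM 4 i.+1 4) mulnC.
  rewrite [leLHS]mulrC ler_wpM2r ?exprn_ge0 ?(ltW B0) //.
  rewrite ler_wpM2r ?exprn_ge0 // (exprS A i).
  by rewrite ler_peMr ?(ltW A0) // exprn_ege1.
move: S0 level; case: (average _ _) => [s||] //; last first.
  by rewrite gt0_muley ?leey // lte_fin.
rewrite lee_fin => s0 level.
have {}level i : (modulus (G a) * \prod_(k < n) Num.max (y k) (lvl R i)) `^ p
    <= B' ^+ i.+1 * (s / w a).
  by rewrite mulrA ler_pdivlMr //; have := level i; rewrite -EFinM lee_fin.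
have sp : 0 < s / w a.
  have := level 0%N; rewrite expr1 => /(lt_le_trans _) h.
  rewrite -(pmulr_rgt0 _ (lt_le_trans ltr01 B'1)); apply: h.
  rewrite powR_gt0 // mulr_gt0 // prodr_gt0 // => k _.
  by rewrite lt_max lvl_gt0 orbT.
have := combine_levels Gp sp B'1 p0 y01 level.
by rewrite -EFinM lee_fin mulrAC mulrA ler_pdivlMr // -mulrA [s * _]mulrC mulrA.
Qed.
End QuotientBound.

(** * Locally uniform limits *)
Section Limits.
Variable R : realType.
Local Notation C := R[i].
Implicit Types (a b x : C) (u : nat -> C -> C).

Lemma dominated_cvg (v : nat -> C) (m : nat -> R) (T : R) (l : C) :
  (fun n => \sum_(k < n) m k) @ \oo --> T ->
  (forall n, modulus (l - v n) <= T - \sum_(k < n) m k) ->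
  (v : nat -> C^o) @ \oo --> (l : C^o).
Proof.
move=> /real_cvgP hT hl; apply/cvg_modP => e /hT[N hN]; exists N => n /hN.
by apply: le_lt_trans; apply: le_trans (hl n) (ler_norm _).
Qed.

Lemma increments_cvg (v : nat -> C) (m : nat -> R) (B : R) : (forall n, 0 <= m n) ->
  (forall n, \sum_(k < n) m k <= B) -> (forall n, modulus (v n.+1 - v n) <= m n) ->
  cvg ((v : nat -> C^o) @ \oo).
Proof.
move=> m0 mB hv; have [T hT] := bounded_sum_cvg m0 mB.
have [l hl] := summable_increments m0 hT hv.
by apply/cvg_ex; exists l; exact: dominated_cvg hT hl.
Qed.

(** The limit is the sum of the series of increments, to which hol_sum_expands
    applies on a disc about each point. *)
Lemma hol_limit u : (forall n x, unit_disc x -> hol_at (u n) x) ->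
  (forall a, unit_disc a -> exists s : R, [/\ 0 < s,
     forall x, modulus (x - a) <= s -> unit_disc x &
     exists (m : nat -> R) (B : R), [/\ forall n, 0 <= m n,
       forall n, \sum_(k < n) m k <= B &
       forall n x, modulus (x - a) <= s -> modulus (u n.+1 x - u n x) <= m n]]) ->
  exists2 g : C -> C, analytic_in_disc g &
    forall x, unit_disc x -> ((fun n => u n x) : nat -> C^o) @ \oo --> (g x : C^o).
Proof.
move=> hu hloc; exists (fun x => lim ((fun n => u n x : C^o) @ \oo)); last first.
  move=> x x1; have [s [s0 _ [m [B [m0 mB hm]]]]] := hloc x x1.
  have : cvg ((fun n => u n x : C^o) @ \oo); last by [].
  by apply: increments_cvg m0 mB _ => n; apply: hm; rewrite subrr mod0 ltW.
apply: expands_analytic => a a1; have [s [s0 sD [m [B [m0 mB hm]]]]] := hloc a a1.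
have [c _ hc] := @disc_max R (fun x => modulus (u 0%N x)) a s (ltW s0)
  (fun x xs => hol_cont_mod (hu 0%N x (sD x xs))).
pose h n x := if n is k.+1 then u n x - u k x else u n x.
pose m' n := if n is k.+1 then m k else modulus (u 0%N c).
have m'0 n : 0 <= m' n by case: n => [|n] /=; [exact: mod_ge0|exact: m0].
have sum_h n x : \sum_(k < n.+1) h k x = u n x.
  elim: n => [|n ih]; first by rewrite big_ord1.
  by rewrite big_ord_recr ih /= subrKC.
have m'B n : \sum_(k < n) m' k <= modulus (u 0%N c) + B.
  case: n => [|n]; last by rewrite big_ord_recl /= lerD2l; exact: mB.
  by rewrite big_ord0 addr_ge0 ?mod_ge0 //; have := mB 0%N; rewrite big_ord0.
have [T hT] := bounded_sum_cvg m'0 m'B.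
exists s, T; split=> //; apply: (@hol_sum_expands _ h m') => //.
- move=> [|n] x xs /=; first by apply: hu; exact: sD.
  by apply: holB; apply: hu; exact: sD.
- by move=> [|n] x xs /=; [exact: hc|exact: hm].
- move=> n x xs; have [|l hl] := @summable_increments _ (fun n => \sum_(k < n) h k x) m' T m'0 hT.
    move=> k; rewrite big_ord_recr /= addrAC subrr add0r.
    by case: k => [|k] /=; [exact: hc|exact: hm].
  suff -> : lim ((fun n => u n x : C^o) @ \oo) = l by exact: hl.
  apply: cvg_lim => //; have := dominated_cvg hT hl.
  by rewrite -cvg_shiftS; under eq_fun do rewrite sum_h.
Qed.
End Limits.

(** * Convergence of the Horowitz product *)
Section HorowitzProduct.
Variable R : realType.
Local Notation C := R[i].
Implicit Types (a b x : C) (z : nat -> option C).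

Lemma mod_cvg_le (v : nat -> C) (l : C) (c : R) N : (v : nat -> C^o) @ \oo --> (l : C^o) ->
  (forall n, (N <= n)%N -> modulus (v n) <= c) -> modulus l <= c.
Proof.
move=> /cvg_modP hv hc; apply/ler_addgt0Pr => e /hv[n0 hn0].
have := hn0 _ (leq_maxl n0 N); have := hc _ (leq_maxr n0 N).
by have := mod_sub_ge l (v (maxn n0 N)); lra.
Qed.

Lemma mod_cvg_ge (v : nat -> C) (l : C) (c : R) N : (v : nat -> C^o) @ \oo --> (l : C^o) ->
  (forall n, (N <= n)%N -> c <= modulus (v n)) -> c <= modulus l.
Proof.
move=> /cvg_modP hv hc; apply/ler_addgt0Pr => e /hv[n0 hn0].
have := hn0 _ (leq_maxl n0 N); have := hc _ (leq_maxr n0 N).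
by have := mod_sub_ge (v (maxn n0 N)) l; rewrite mod_subC; lra.
Qed.

Lemma prodD1_le_exp (I : Type) (s : seq I) (t : I -> R) : (forall k, 0 <= t k) ->
  \prod_(k <- s) (1 + t k) <= expR (\sum_(k <- s) t k).
Proof.
move=> t0; rewrite expR_sum; apply: ler_prod => k _.
by rewrite addr_ge0 //= expR_ge1Dx.
Qed.

Lemma prodB1_ge (I : Type) (s : seq I) (t : I -> R) : (forall k, 0 <= t k <= 1) ->
  1 - \sum_(k <- s) t k <= \prod_(k <- s) (1 - t k).
Proof.
move=> t01; elim: s => [|k s ih]; first by rewrite !big_nil subr0.
rewrite !big_cons; have /andP[t0 t1] := t01 k.
have p1 : \prod_(k <- s) (1 - t k) <= 1.
  by apply: prodr_ile1 => j _; have /andP[a b] := t01 j; rewrite subr_ge0 b lerBlDr lerDl.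
have := ler_wpM2l t0 p1; rewrite mulr1 mulrBl mul1r.
by move: ih; move: (\prod_(_ <- _) _) (\sum_(_ <- _) _) => P S; lra.
Qed.

Definition gap z k : R := if z k is Some a then 1 - modulus a else 0.

Definition hfac z k x : C := bfac (z k) x * (2 - bfac (z k) x).

Lemma horowitz_partialE z x n : horowitz_partial z x n = \prod_(k < n) hfac z k x.
Proof.
apply: eq_bigr => k _; rewrite /hfac /bfac; case: (z k) => [a|] //.
by rewrite mul1r -[2]/(1 + 1) addrK.
Qed.

(** The reason for the factor 2 - B: the distance to 1 becomes quadratic in that of
    B, so square summability of the gaps suffices for convergence. *)
Lemma one_sub_hfac z k x : 1 - hfac z k x = (1 - bfac (z k) x) ^+ 2.
Proof. by rewrite /hfac; ring. Qed.

Section Points.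
Variables (z : nat -> option C) (M : R).
Hypotheses (zD : in_disc z) (hM : forall n, \sum_(k < n) gap z k ^+ 2 <= M).

Lemma mod_one_sub_hfac k x : unit_disc x ->
  modulus (1 - hfac z k x) <= 4 / (1 - modulus x) ^+ 2 * gap z k ^+ 2.
Proof.
move=> x1; rewrite one_sub_hfac modX /gap /bfac.
have x0 : 0 < 1 - modulus x by rewrite subr_gt0.
case E : (z k) => [a|]; last by rewrite subrr mod0 expr0n mulr0.
have h := one_sub_blaschke (zD E) x1.
have a0 : 0 <= 1 - modulus a by rewrite subr_ge0 ltW //; exact: zD E.
rewrite (_ : 4 / _ * _ = (2 * (1 - modulus a) / (1 - modulus x)) ^+ 2).
  by rewrite ler_pXn2r ?nnegrE ?mod_ge0 // divr_ge0 ?mulr_ge0 // ltW.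
by rewrite !exprMn exprVn; ring.
Qed.

Lemma gap_sqr_ge0 k : 0 <= gap z k ^+ 2. Proof. exact: sqr_ge0. Qed.

Lemma mod_hfac_le k x : modulus (hfac z k x) <= 1 + modulus (1 - hfac z k x).
Proof. by rewrite -{1}[hfac z k x](subKr 1); apply: (le_trans (modB_le _ _)); rewrite mod1. Qed.

Lemma mod_hfac_ge k x : 1 - modulus (1 - hfac z k x) <= modulus (hfac z k x).
Proof.
rewrite -{2}[hfac z k x](subKr 1); apply: le_trans (mod_sub_ge _ _).
by rewrite mod1.
Qed.

Lemma horowitz_partial_le n x : unit_disc x ->
  modulus (horowitz_partial z x n) <= expR (4 / (1 - modulus x) ^+ 2 * M).
Proof.
move=> x1; have c0 : 0 <= 4 / (1 - modulus x) ^+ 2 by rewrite divr_ge0 // sqr_ge0.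
rewrite horowitz_partialE mod_prod.
apply: (@le_trans _ _ (\prod_(k < n) (1 + modulus (1 - hfac z k x)))).
  by apply: ler_prod => k _; rewrite mod_ge0 mod_hfac_le.
apply: le_trans (prodD1_le_exp _ _) _; first by move=> k; exact: mod_ge0.
rewrite ler_expR; apply: (@le_trans _ _ (4 / (1 - modulus x) ^+ 2 * \sum_(k < n) gap z k ^+ 2)).
  by rewrite mulr_sumr; apply: ler_sum => k _; exact: mod_one_sub_hfac.
by rewrite ler_wpM2l.
Qed.

Lemma horowitz_cvg x : unit_disc x -> cvg (horowitz_partial z x @ \oo).
Proof.
move=> x1; set c := 4 / (1 - modulus x) ^+ 2.
have c0 : 0 <= c by rewrite divr_ge0 // sqr_ge0.
set E := expR (c * M); have E0 : 0 <= E by exact: expR_ge0.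
apply: (@increments_cvg _ _ (fun k => E * (c * gap z k ^+ 2)) (E * (c * M))).
- by move=> n; rewrite mulr_ge0 // mulr_ge0 // sqr_ge0.
- by move=> n; rewrite -!mulr_sumr !ler_wpM2l.
- move=> n; rewrite !horowitz_partialE big_ord_recr /= -{2}[\prod_(k < n) _]mulr1 -mulrBr.
  rewrite modM mod_subC; apply: ler_pM; rewrite ?mod_ge0 //; last exact: mod_one_sub_hfac.
  by rewrite -horowitz_partialE; exact: horowitz_partial_le.
Qed.

(** Choose N0 such that the sum of |1 - B_k (2 - B_k)| beyond it is at most 1/2 on
    the whole disc of radius (1 - |b|) / 2 about b. *)
Lemma horowitz_tail b : unit_disc b -> exists N0, forall N n x, (N0 <= N)%N -> (N <= n)%N ->
  modulus (x - b) <= (1 - modulus b) / 2 ->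
  2^-1 <= modulus (\prod_(N <= k < n) hfac z k x) <= 2.
Proof.
move=> b1; have d0 : 0 < 1 - modulus b by rewrite subr_gt0.
pose c := 16 / (1 - modulus b) ^+ 2; have c0 : 0 < c by rewrite divr_gt0 // exprn_gt0.
have [T hT] := bounded_sum_cvg gap_sqr_ge0 hM.
have TM := partial_sum_le gap_sqr_ge0 hT.
have e0 : 0 < (2 * c)^-1 by rewrite invr_gt0 mulr_gt0.
have /real_cvgP /(_ _ e0)[N0 hN] := hT; exists N0 => N n x N0N Nn xb.
have xd : (1 - modulus b) / 2 <= 1 - modulus x by have := mod_sub_ge x b; lra.
have x1 : unit_disc x by rewrite /unit_disc /=; lra.
have qle k : modulus (1 - hfac z k x) <= c * gap z k ^+ 2.
  apply: le_trans (mod_one_sub_hfac _ x1) _; rewrite ler_wpM2r ?sqr_ge0 //.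
  rewrite /c (_ : 16 / _ = 4 / ((1 - modulus b) / 2) ^+ 2); last first.
    by field; rewrite gt_eqF.
  rewrite ler_wpM2l // lef_pV2 ?posrE ?exprn_gt0 ?divr_gt0 //; last by lra.
  by rewrite ler_pXn2r ?nnegrE ?divr_ge0 //; lra.
have sumq : \sum_(N <= k < n) modulus (1 - hfac z k x) <= 2^-1.
  apply: (@le_trans _ _ (c * \sum_(N <= k < n) gap z k ^+ 2)).
    by rewrite mulr_sumr; apply: ler_sum => k _; exact: qle.
  have -> : 2^-1 = c * (2 * c)^-1 by field; rewrite gt_eqF.
  rewrite ler_wpM2l ?(ltW c0) //; have := hN N N0N.
  have := TM n; rewrite -!(big_mkord xpredT (fun k => gap z k ^+ 2)) (@big_cat_nat _ _ _ N) //=.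
  move: (\sum_(0 <= _ < N) _) (\sum_(N <= _ < n) _) => X Y XY.
  by have := ler_norm (T - X); lra.
rewrite mod_prod; apply/andP; split.
  have q1 k : (N <= k < n)%N -> modulus (1 - hfac z k x) <= 1.
    move=> kn; apply: le_trans (_ : 2^-1 <= 1); last by rewrite invf_le1 // ler1n.
    apply: le_trans sumq; rewrite (bigD1_seq k) ?iota_uniq ?mem_index_iota //=.
    by rewrite lerDl sumr_ge0 // => j _; exact: mod_ge0.
  (* Truncation at 1 only matters outside the range N <= k < n. *)
  pose t k := Num.min 1 (modulus (1 - hfac z k x)).
  have t01 k : 0 <= t k <= 1 by rewrite ge_min lexx andbT le_min ler01 mod_ge0.
  apply: (@le_trans _ _ (\prod_(N <= k < n) (1 - t k))).
    apply: le_trans (prodB1_ge _ t01).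
    suff : \sum_(N <= k < n) t k <= 2^-1 by lra.
    by apply: le_trans sumq; apply: ler_sum => k _; rewrite ge_min lexx orbT.
  rewrite big_nat_cond [leRHS]big_nat_cond; apply: ler_prod => k /andP[kn _].
  rewrite /t min_r ?q1 // mod_hfac_ge andbT subr_ge0; exact: q1.
apply: (@le_trans _ _ (\prod_(N <= k < n) (1 + modulus (1 - hfac z k x)))).
  by apply: ler_prod => k _; rewrite mod_ge0 mod_hfac_le.
apply: le_trans (prodD1_le_exp _ _) _; first by move=> k; exact: mod_ge0.
apply: (@le_trans _ _ (expR 2^-1)); first by rewrite ler_expR.
rewrite -[expR _]invrK -[leRHS]invrK -expRN lef_pV2 ?posrE ?expR_gt0 ?invr_gt0 //.
by have := expR_ge1Dx (- 2^-1 : R); lra.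
Qed.
End Points.
End HorowitzProduct.

Section GapSum.
Variable R : realType.
Local Notation C := R[i].
Implicit Types (a b c x : C) (z : nat -> option C).

(** Since x (2 - x) = 1 - (1 - x)^2, a lower bound on the product of these
    numbers bounds the sum of the (1 - x)^2. *)
Lemma prodB1_sum_le1 (I : Type) (s : seq I) (t : I -> R) : (forall k, 0 <= t k <= 1) ->
  \prod_(k <- s) (1 - t k) * (1 + \sum_(k <- s) t k) <= 1.
Proof.
move=> t01; elim: s => [|k s ih]; first by rewrite !big_nil addr0 mulr1.
rewrite !big_cons; have /andP[t0 t1] := t01 k.
set P := \prod_(_ <- _) _; set S := \sum_(_ <- _) _ in ih *.
have S0 : 0 <= S by rewrite sumr_ge0 // => j _; have /andP[] := t01 j.
have P0 : 0 <= P by rewrite prodr_ge0 // => j _; have /andP[_] := t01 j; rewrite subr_ge0.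
apply: le_trans ih; rewrite -subr_ge0.
rewrite (_ : _ - _ = P * (t k * (t k + S))); last by rewrite /P /S; ring.
by rewrite !mulr_ge0 // addr_ge0.
Qed.

Lemma gap_le a c : unit_disc a -> unit_disc c ->
  1 - modulus c <= 8 / (1 - modulus a) * (1 - modulus (blaschke_factor c a)).
Proof.
move=> a1 c1; rewrite mod_blaschke; have a0 : 0 < 1 - modulus a by rewrite subr_gt0.
have t1 := disc_aut_in c1 a1; have t0 := mod_ge0 (disc_aut c a).
have id := disc_aut_identity c1 a1.
have m2 := one_sub_conjM_le2 (ltW c1) (ltW a1).
set m := modulus (1 - conjc c * a) in id m2.
have m0 : 0 < m by rewrite /m mod_gt0 one_sub_conjM_neq0 // ltW.
rewrite mulrAC ler_pdivlMr //.
have /andP[_ h1] := one_sub_sqr_bounds t0 t1.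
have /andP[h2 _] := one_sub_sqr_bounds (mod_ge0 a) a1.
have /andP[h3 _] := one_sub_sqr_bounds (mod_ge0 c) c1.
have h4 : (1 - modulus c) * (1 - modulus a) <= (1 - modulus c ^+ 2) * (1 - modulus a ^+ 2).
  by apply: ler_pM => //; rewrite subr_ge0 ltW.
have h5 : (1 - modulus c ^+ 2) * (1 - modulus a ^+ 2) <= 4 * (1 - modulus (disc_aut c a) ^+ 2).
  rewrite id mulrCA ler_peMr //.
    by apply: le_trans h4; rewrite mulr_ge0 // subr_ge0 ltW.
  rewrite ler_pdivlMr ?exprn_gt0 // mul1r -[4]/(2 * 2)%:R natrM -expr2.
  by rewrite ler_pXn2r ?nnegrE // ltW.
by move: h1 h4 h5; move: (_ * (1 - modulus a)) (_ * (1 - _ ^+ 2)) => X Y; lra.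
Qed.

(** By prodB1_sum_le1 the sum of the (1 - |B_k(a)|)^2 is bounded, and 1 - |z_k| is at
    most a multiple of 1 - |B_k(a)| that depends on a only. *)
Lemma gap_sum_bounded z a (d : R) : in_disc z -> unit_disc a -> 0 < d ->
  (forall n, d <= \prod_(k < n) (modulus (bfac (z k) a) * (2 - modulus (bfac (z k) a)))) ->
  exists M : R, forall n, \sum_(k < n) gap z k ^+ 2 <= M.
Proof.
move=> zD a1 d0 hd; have a0 : 0 < 1 - modulus a by rewrite subr_gt0.
pose t k := (1 - modulus (bfac (z k) a)) ^+ 2.
have t01 k : 0 <= t k <= 1.
  have /andP[y0 y1] := bfac_01 k zD a1.
  by rewrite sqr_ge0 exprn_ile1 // ?subr_ge0 // lerBlDr lerDl.
exists ((8 / (1 - modulus a)) ^+ 2 * d^-1) => n.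
apply: (@le_trans _ _ ((8 / (1 - modulus a)) ^+ 2 * \sum_(k < n) t k)).
  rewrite mulr_sumr; apply: ler_sum => k _; rewrite /t -exprMn /gap /bfac.
  case E : (z k) => [c|]; last by rewrite expr0n sqr_ge0.
  have c1 := zD _ _ E; rewrite ler_pXn2r ?nnegrE //; first exact: gap_le.
    by rewrite subr_ge0 ltW.
  by rewrite mulr_ge0 ?divr_ge0 ?(ltW a0) // subr_ge0 ltW // blaschke_lt1.
rewrite ler_wpM2l ?sqr_ge0 //.
have := prodB1_sum_le1 (index_enum 'I_n) (fun k : 'I_n => t01 k).
rewrite (eq_bigr (fun k : 'I_n => modulus (bfac (z k) a) * (2 - modulus (bfac (z k) a)))); last first.
  by move=> k _; rewrite /t; ring.
move=> h; have S0 : 0 <= \sum_(k < n) t k by rewrite sumr_ge0 // => j _; have /andP[] := t01 j.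
have h2 : d * (1 + \sum_(k < n) t k) <= 1.
  by apply: le_trans h; apply: ler_wpM2r; [exact: addr_ge0|exact: hd].
by rewrite -[d^-1]mulr1 ler_pdivlMl //; move: h2; rewrite mulrDr mulr1; lra.
Qed.
End GapSum.

(** * The quotient by the Horowitz product *)
Section Quotients.
Variable R : realType.
Local Notation C := R[i].

Lemma powR_root (p x : R) : 0 < p -> 0 <= x -> (x `^ p) `^ p^-1 = x.
Proof. by move=> p0 x0; rewrite -powRrM mulfV ?gt_eqF // powRr1. Qed.

Lemma le_powR_root (p x y : R) : 0 < p -> 0 <= x -> x `^ p <= y -> x <= y `^ p^-1.
Proof.
move=> p0 x0 h; rewrite -{1}(powR_root p0 x0).
by apply: ge0_ler_powR; rewrite ?nnegrE ?powR_ge0 ?invr_ge0 ?(ltW p0) ?(le_trans _ h) ?powR_ge0.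
Qed.

Lemma powR_root_le (p x y : R) : 0 < p -> 0 <= x -> 0 <= y -> y <= x `^ p -> y `^ p^-1 <= x.
Proof.
move=> p0 x0 y0 h; rewrite -[leRHS](powR_root p0 x0).
by apply: ge0_ler_powR; rewrite ?nnegrE ?powR_ge0 ?invr_ge0 ?(ltW p0).
Qed.

(** The measure theory enters only through the values A of the average, their local
    bound A_le and the estimate GA. *)
Variables (w : C -> R) (p : R) (f : C -> C) (z : nat -> option C) (G : nat -> C -> C).
Variables (A : C -> R) (Cw I : R).
Hypothesis p0 : 0 < p.
Hypothesis w_low : forall s : R, 0 < s ->
  exists2 w0, 0 < w0 & forall x, modulus x <= 1 - s -> w0 <= w x.
Hypothesis zD : in_disc z.
Hypothesis hG : forall n x, unit_disc x -> hol_at (G n) x.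
Hypothesis GS : forall n x, unit_disc x -> G n x = G n.+1 x * bfac (z n) x.
Hypothesis fE : forall n x, unit_disc x -> f x = G n x * bprod z n x.
Hypothesis Cw0 : 0 < Cw.
Hypothesis A0 : forall x, 0 <= A x.
Hypothesis A_le : forall x, unit_disc x -> A x <= (1 - modulus x) ^- 2 * I.
Hypothesis GA : forall n x, unit_disc x ->
  modulus (G n x) `^ p * w x <= Cw * (\prod_(k < n) (2 - modulus (bfac (z k) x))) `^ p * A x.

Lemma weight_pos x : unit_disc x -> 0 < w x.
Proof.
move=> x1; have [|w0 w00 h] := w_low (s := 1 - modulus x); first by rewrite subr_gt0.
by apply: lt_le_trans w00 (h x _); rewrite opprB subrKC.
Qed.

(** Multiplied by the p-th power of prod y_k, the estimate bounds |f(a)|^p w(a) by a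
    constant times the p-th power of prod y_k (2 - y_k), for every n. *)
Lemma zero_gaps a : unit_disc a -> f a != 0 ->
  exists M : R, forall n, \sum_(k < n) gap z k ^+ 2 <= M.
Proof.
move=> a1 fa; have fa0 : 0 < modulus (f a) `^ p * w a.
  by rewrite mulr_gt0 ?weight_pos // powR_gt0 // mod_gt0.
pose P n := \prod_(k < n) (2 - modulus (bfac (z k) a)).
pose X n := \prod_(k < n) modulus (bfac (z k) a).
have y01 k := bfac_01 k zD a1.
have X0 n : 0 <= X n by rewrite prodr_ge0 // => k _; have /andP[] := y01 k.
have P0 n : 0 <= P n.
  by rewrite prodr_ge0 // => k _; have /andP[_ h] := y01 k; rewrite subr_ge0 (le_trans h) ?ler1n.
have key n : modulus (f a) `^ p * w a <= Cw * A a * (P n * X n) `^ p.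
  rewrite (fE n a1) modM /bprod mod_prod -/(X n) !powRM ?mod_ge0 //.
  rewrite mulrAC [leRHS]mulrA ler_wpM2r ?powR_ge0 //.
  by apply: le_trans (GA n a1) _; rewrite mulrAC.
have c0 : 0 < Cw * A a.
  rewrite mulr_gt0 // lt_def A0 andbT; apply/eqP => Aa.
  by have := key 0%N; rewrite Aa mulr0 mul0r leNgt fa0.
apply: (gap_sum_bounded (d := (modulus (f a) `^ p * w a / (Cw * A a)) `^ p^-1) zD a1).
  by rewrite powR_gt0 // divr_gt0.
move=> n; rewrite big_split /= -/(P n) -/(X n) [X in _ <= X]mulrC; apply: powR_root_le => //.
- by rewrite mulr_ge0.
- by rewrite divr_ge0 // ltW.
- by rewrite ler_pdivrMr // [leRHS]mulrC; exact: key.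
Qed.

Definition quot n x : C := G n x / \prod_(k < n) (2 - bfac (z k) x).

Lemma two_sub_bfac_neq0 k x : unit_disc x -> 2 - bfac (z k) x != 0.
Proof.
move=> x1; rewrite -mod_gt0; apply: lt_le_trans (mod_sub_ge _ _).
have /andP[_] := bfac_01 k zD x1.
by rewrite -[(2 : C)]/(2%:R) mod_natr; move: (modulus (bfac _ _)) => y; lra.
Qed.

Lemma hol_two_sub_bfac k x : unit_disc x -> hol_at (fun x => 2 - bfac (z k) x) x.
Proof. by move=> x1; apply: holB; [exact: hol_cst|exact: hol_bfac]. Qed.

Lemma prod_two_sub_neq0 n x : unit_disc x -> \prod_(k < n) (2 - bfac (z k) x) != 0.
Proof. by move=> x1; apply/prodf_neq0 => k _; exact: two_sub_bfac_neq0. Qed.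

Lemma hol_prod_two_sub n x : unit_disc x ->
  hol_at (fun x => \prod_(k < n) (2 - bfac (z k) x)) x.
Proof. by move=> x1; apply: hol_prod => k; exact: hol_two_sub_bfac. Qed.

Lemma hol_quot n x : unit_disc x -> hol_at (quot n) x.
Proof.
by move=> x1; apply: hol_div; [exact: hG|exact: hol_prod_two_sub|exact: prod_two_sub_neq0].
Qed.

Lemma quotS n x : unit_disc x -> quot n x = quot n.+1 x * hfac z n x.
Proof.
move=> x1; rewrite /quot /hfac big_ord_recr /= (GS n x1).
have := two_sub_bfac_neq0 n x1; have := prod_two_sub_neq0 n x1.
move: (\prod_(_ < _) _) (bfac _ _) (G _ _) => P B g h1 h2.
by rewrite invfM [RHS]mulrACA divfK.
Qed.

Lemma quot_tail N n x : unit_disc x -> (N <= n)%N ->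
  quot N x = quot n x * \prod_(N <= k < n) hfac z k x.
Proof.
move=> x1; elim: n => [|n ih]; first by rewrite leqn0 => /eqP ->; rewrite big_geq ?mulr1.
rewrite leq_eqVlt => /predU1P[->|]; first by rewrite big_geq ?mulr1.
by rewrite ltnS => Nn; rewrite (ih Nn) big_nat_recr //= (quotS n x1) mulrAC mulrA.
Qed.

Lemma quot_horowitz n x : unit_disc x -> f x = quot n x * horowitz_partial z x n.
Proof.
move=> x1; rewrite horowitz_partialE big_split /= (fE n x1) /quot -/(bprod z n x).
have := prod_two_sub_neq0 n x1; move: (\prod_(_ < _) (_ - _)) => P h.
by rewrite mulrACA [P^-1 * _]mulrC mulfV // mulr1.
Qed.

Lemma quot_pow_le n x : unit_disc x -> modulus (quot n x) `^ p * w x <= Cw * A x.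
Proof.
move=> x1; set P := \prod_(k < n) (2 - modulus (bfac (z k) x)).
have P0 : 0 < P.
  by apply: prodr_gt0 => k _; have /andP[_] := bfac_01 k zD x1; lra.
have PP : P <= modulus (\prod_(k < n) (2 - bfac (z k) x)).
  rewrite mod_prod; apply: ler_prod => k _; apply/andP; split.
    by have /andP[_] := bfac_01 k zD x1; lra.
  by apply: le_trans (mod_sub_ge _ _); rewrite -[(2 : C)]/(2%:R) mod_natr.
have Pp : 0 < P `^ p by exact: powR_gt0.
rewrite -(ler_pM2r Pp) [leRHS]mulrAC; apply: le_trans (GA n x1).
rewrite mulrAC ler_wpM2r ?(ltW (weight_pos x1)) // -powRM ?mod_ge0 ?(ltW P0) //.
apply: ge0_ler_powR; rewrite ?nnegrE ?mod_ge0 ?mulr_ge0 ?mod_ge0 ?(ltW P0) ?(ltW p0) //.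
rewrite /quot mod_div -mulrA ler_piMr ?mod_ge0 // ler_pdivrMl ?mulr1 //.
exact: lt_le_trans P0 PP.
Qed.

(** On compact subsets of the disc A is bounded, and w is bounded away from 0. *)
Lemma quot_bounded b : unit_disc b ->
  exists M1 : R, forall n x, modulus (x - b) <= (1 - modulus b) / 2 -> modulus (quot n x) <= M1.
Proof.
move=> b1; set s := (1 - modulus b) / 2.
have s0 : 0 < s by rewrite divr_gt0 // subr_gt0.
have [w0 w00 hw] := w_low s0.
exists ((Cw * (s ^- 2 * Num.max 0 I) / w0) `^ p^-1) => n x xb.
have xs : modulus x <= 1 - s by have := mod_sub_ge x b; rewrite /s in xb *; lra.
have x1 : unit_disc x by rewrite /unit_disc /=; lra.
apply: le_powR_root => //; first exact: mod_ge0.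
rewrite ler_pdivlMr //; apply: (@le_trans _ _ (modulus (quot n x) `^ p * w x)).
  by rewrite ler_wpM2l ?powR_ge0 // hw.
apply: le_trans (quot_pow_le n x1) _; rewrite ler_pM2l //.
apply: le_trans (A_le x1) _; apply: (@le_trans _ _ ((1 - modulus x) ^- 2 * Num.max 0 I)).
  by rewrite ler_wpM2l ?le_max ?lexx ?orbT // invr_ge0 sqr_ge0.
rewrite ler_wpM2r ?le_max ?lexx // lef_pV2 ?posrE ?exprn_gt0 //; last by lra.
by rewrite ler_pXn2r ?nnegrE //; lra.
Qed.

Variable M : R.
Hypothesis hM : forall n, \sum_(k < n) gap z k ^+ 2 <= M.

Lemma quot_limit : exists2 g : C -> C, analytic_in_disc g &
  forall x, unit_disc x -> ((fun n => quot n x) : nat -> C^o) @ \oo --> (g x : C^o).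
Proof.
apply: hol_limit => [n x|b b1]; first exact: hol_quot.
have [M1 hM1] := quot_bounded b1; set s := (1 - modulus b) / 2 in hM1.
have s0 : 0 < s by rewrite divr_gt0 // subr_gt0.
have xs x : modulus (x - b) <= s -> s <= 1 - modulus x.
  by have := mod_sub_ge x b; rewrite /s; lra.
have x1 x : modulus (x - b) <= s -> unit_disc x.
  by move=> /xs; rewrite /unit_disc /=; lra.
have M10 : 0 <= M1 by apply: le_trans (hM1 0%N b _); rewrite ?mod_ge0 // subrr mod0 ltW.
have c0 : 0 <= 4 / s ^+ 2 by rewrite divr_ge0 // sqr_ge0.
exists s; split=> //; exists (fun k => M1 * (4 / s ^+ 2 * gap z k ^+ 2)), (M1 * (4 / s ^+ 2 * M)).
split.
- by move=> n; rewrite mulr_ge0 // mulr_ge0 // sqr_ge0.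
- by move=> n; rewrite -!mulr_sumr !ler_wpM2l.
- move=> n x xb; rewrite (quotS n (x1 x xb)) -{1}[quot n.+1 x]mulr1 -mulrBr modM.
  apply: ler_pM; rewrite ?mod_ge0 ?hM1 //.
  apply: le_trans (mod_one_sub_hfac zD n (x1 x xb)) _; rewrite ler_wpM2r ?sqr_ge0 //.
  have sx := xs x xb; rewrite ler_wpM2l // lef_pV2 ?posrE ?exprn_gt0 //; last by lra.
  by rewrite ler_pXn2r ?nnegrE //; lra.
Qed.

Variable g : C -> C.
Hypothesis hg : forall x, unit_disc x -> ((fun n => quot n x) : nat -> C^o) @ \oo --> (g x : C^o).

Lemma limit_horowitz x : unit_disc x -> f x = g x * horowitz_product z x.
Proof.
move=> x1; have hH := horowitz_cvg zD hM x1.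
have := cvgM (hg x1) hH.
rewrite (_ : _ \* _ = cst (f x : C^o)); last by apply/funext => n /=; rewrite -quot_horowitz.
move=> /(_ _) /cvg_modP h; apply/eqP; rewrite -subr_eq0 -mod_eq0 eq_le mod_ge0 andbT leNgt.
by apply/negP => /h[n /(_ n (leqnn n))]; rewrite mod_subC ltxx.
Qed.

Lemma limit_pow_le x : unit_disc x -> modulus (g x) `^ p * w x <= Cw * A x.
Proof.
move=> x1; have w0 := weight_pos x1; rewrite -ler_pdivlMr //.
have c0 : 0 <= Cw * A x / w x by rewrite divr_ge0 ?mulr_ge0 // ltW.
rewrite -[leRHS](powRr1 c0) -[X in _ <= _ `^ X](mulVf (lt0r_neq0 p0)) powRrM.
apply: ge0_ler_powR; rewrite ?nnegrE ?mod_ge0 ?powR_ge0 ?(ltW p0) //.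
apply: (mod_cvg_le (N := 0%N) (hg x1)) => n _; apply: le_powR_root; rewrite ?mod_ge0 //.
by rewrite ler_pdivlMr // quot_pow_le.
Qed.

(** For large N the quotient g_N / g is a tail of the product, of modulus
    between 1/2 and 2 near b, while g_N has lost exactly the m occurrences of b. *)
Lemma limit_ord b n m : unit_disc b -> ord_at f b n -> (occurrences z b #= `I_m)%card ->
  (m <= n)%N -> ord_at g b (n - m).
Proof.
move=> b1 fn om mn; have omle : (occurrences z b #<= `I_m)%card by rewrite (card_le_eql om).
have [n0 hn0] := occ_below_total omle.
have [N0 hN0] := horowitz_tail zD hM b1.
pose N := maxn n0 N0; have size_m : size (occ_below z b N) = m.
  apply/card_eq_II; rewrite -(card_eql (card_occ_below z b N)) hn0 ?leq_maxl //.
have ordG : ord_at (G N) b (n - m).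
  apply: (@ord_at_div _ (bprod z N)); rewrite -?size_m; last by rewrite size_m.
    apply: ord_at_ext fn; apply: (near0_sub (near0_unit_disc b1)) => t t1 _.
    by rewrite (fE N t1) mulrC.
  exact: ord_at_bprod.
have ordq : ord_at (quot N) b (n - m).
  rewrite -[(n - m)%N]subn0.
  apply: (@ord_at_div _ (fun x => \prod_(k < N) (2 - bfac (z k) x))) => //.
    apply: ord_at_ext ordG; apply: (near0_sub (near0_unit_disc b1)) => t t1 _.
    by rewrite /quot mulrC divfK // prod_two_sub_neq0.
  by apply: ord_at_hol; [exact: hol_prod_two_sub|exact: prod_two_sub_neq0].
have [d [L [d0 L0 hdL]]] := ordq; exists (d / 2), (2 * L); split.
- by rewrite divr_gt0.
- by rewrite mulr_ge0.
have s0 : 0 < (1 - modulus b) / 2 by rewrite divr_gt0 // subr_gt0.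
apply: (near0_sub (near0_and (near0_and hdL (near0_unit_disc b1)) (near0_lt s0))).
move=> t [[h t1] ts] t0; have /andP[h1 h2] := h t0.
have tail k : (N <= k)%N -> modulus (quot N (b + t)) / 2 <= modulus (quot k (b + t)) <=
    2 * modulus (quot N (b + t)).
  move=> Nk; have := hN0 N k (b + t) (leq_maxr _ _) Nk.
  rewrite (addrC b) addrK (addrC t) => /(_ (ltW ts)); rewrite (quot_tail t1 Nk) modM.
  move: (modulus (\prod_(_ <= _ < _) _)) => T /andP[T1 T2]; have q0 := mod_ge0 (quot k (b + t)).
  have := ler_wpM2l q0 T1; have := ler_wpM2l q0 T2.
  by move: (modulus (quot k _)) => q; move: (q * T) => Y; lra.
apply/andP; split.
  apply: (@le_trans _ _ (modulus (quot N (b + t)) / 2)).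
    by move: h1; rewrite mulrAC; lra.
  by apply: (mod_cvg_ge (N := N) (hg t1)) => k /tail /andP[].
apply: (@le_trans _ _ (2 * modulus (quot N (b + t)))).
  by apply: (mod_cvg_le (N := N) (hg t1)) => k /tail /andP[].
by rewrite -mulrA ler_pM2l.
Qed.
End Quotients.

Section Division.
Variable R : realType.
Local Notation C := R[i].
Local Notation T := (measurableTypeR R * measurableTypeR R)%type.
Local Notation m2 := (@lebesgue_measure R \x @lebesgue_measure R)%E.
Local Notation D := (@plane_disc R).
Implicit Types (f g : C -> C) (z : nat -> option C).

(** Compare w with its value at 0, within a level that contains |x| <= 1 - s. *)
Lemma weight_lower (w : C -> R) (r K : R) : 0 < r < 1 -> 1 <= K ->
  (forall x, unit_disc x -> 0 < w x) ->
  (forall a x, unit_disc a -> pseudo_disc a r x -> K^-1 * w a <= w x <= K * w a) ->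
  forall s : R, 0 < s -> exists2 w0, 0 < w0 & forall x, modulus x <= 1 - s -> w0 <= w x.
Proof.
move=> r01 K1 w_gt0 w_inv s s0; have [B B1 growth] := weight_growth r01 K1 w_gt0 w_inv.
have B0 : 0 < B by exact: lt_le_trans ltr01 B1.
have [||i hi] := @geometric_small R 4^-1 s _ _ s0; rewrite ?invr_ge0 ?invf_lt1 //; first by lra.
have z1 := unit_disc0 R.
exists (w 0 / B ^+ i.+1); first by rewrite divr_gt0 ?w_gt0 ?exprn_gt0.
move=> x xs; rewrite ler_pdivrMr ?exprn_gt0 // mulrC; apply: growth => //.
  by apply: le_lt_trans xs _; rewrite ltrBlDr ltrDl.
rewrite /disc_aut sub0r conjc0 mul0r subr0 divr1 modN; apply: (le_trans xs).
by rewrite /lvl lerD2l lerN2; apply/ltW/hi.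
Qed.

(** Integrating the pointwise bound of g by the average of |f|^p w costs the mass 4
    of the kernel.  The orders of g are recorded for the sake of zero sets. *)
Lemma horowitz_division (w : C -> R) : invariant_weight w ->
  exists2 Cw : R, 0 < Cw & forall (p : R) f z, 0 < p -> in_bergman p w f ->
    (exists2 a, unit_disc a & f a != 0) -> zero_subset f z ->
    (forall x, unit_disc x -> cvg (horowitz_partial z x @ \oo)) /\
    exists g, [/\ analytic_in_disc g,
      forall x, unit_disc x -> f x = g x * horowitz_product z x,
      (bergman_norm_pow p w g <= Cw%:E * bergman_norm_pow p w f)%E &
      forall b n m, unit_disc b -> ord_at f b n -> (occurrences z b #= `I_m)%card ->
        (m <= n)%N -> ord_at g b (n - m)].
Proof.
move=> [[w_gt0 iw] [r r01 [K K1 w_inv]]].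
have mw : measurable_fun D (fun u : T => w (cplx u)).
  by apply/measurable_EFinP; exact: measurable_int iw.
have [Cq Cq0 bound] := quotient_bound r01 K1 w_gt0 w_inv mw.
have w_low := weight_lower r01 K1 w_gt0 w_inv.
exists (4 * Cq); first by rewrite mulr_gt0.
move=> p f z p0 [af nf] [a a1 fa] zf; have [zD _] := zf.
have hf := analyticP f; have {}hf := hf.1 af.
have [G [hG GS fE]] := bprod_quotients af zf.
have mdens := measurable_density mw p0 hf.
have dens0 := density_ge0 w_gt0 p f.
set J := (\int[m2]_(v in D) (density w p f v)%:E)%E.
have pi0 : 0 < (pi^-1 : R) by rewrite invr_gt0 pi_gt0.
have J0 : (0 <= J)%E by apply: integral_ge0 => v Dv; rewrite lee_fin dens0.
have Joo : (J < +oo)%E.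
  have := nf; rewrite /bergman_norm_pow /disc_integral -[X in (_ * X)%E]/J.
  move: J0; case: J => [r' _ _| |] //; first by rewrite ltry.
  by rewrite gt0_muley ?ltxx // lte_fin.
have Jfin : J \is a fin_num by rewrite ge0_fin_numE.
pose A x := fine (average (density w p f) (complex.Re x, complex.Im x)).
have cD x : unit_disc x -> D (complex.Re x, complex.Im x) by case: x.
have av_le x : unit_disc x -> (average (density w p f) (complex.Re x, complex.Im x)
    <= ((1 - modulus x) ^- 2 * fine J)%:E)%E.
  move=> x1; have := average_le mdens dens0 (cD x x1).
  by rewrite cplx_ReIm -/J EFinM fineK.
have av_ge x : (0 <= average (density w p f) (complex.Re x, complex.Im x))%E.
  exact: average_ge0.
have AE x : unit_disc x -> average (density w p f) (complex.Re x, complex.Im x) = (A x)%:E.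
  move=> x1; rewrite /A fineK // ge0_fin_numE //.
  exact: le_lt_trans (av_le x x1) (ltry _).
have A0 x : 0 <= A x by exact: fine_ge0.
have A_le x : unit_disc x -> A x <= (1 - modulus x) ^- 2 * fine J.
  by move=> x1; rewrite -lee_fin -AE //; exact: av_le.
have GA n x : unit_disc x -> modulus (G n x) `^ p * w x <=
    Cq * (\prod_(k < n) (2 - modulus (bfac (z k) x))) `^ p * A x.
  move=> x1; have := bound p f (G n) z n _ p0 zD hf (hG n) (fE n) (cD x x1).
  rewrite (AE x x1) (cplx_ReIm x) => h; rewrite -lee_fin.
  by rewrite [X in (_ <= X)%E]EFinM.
have [M hM] := zero_gaps p0 w_low zD fE Cq0 A0 GA a1 fa.
split; first by move=> x x1; exact: (@horowitz_cvg R z M zD hM x x1).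
have [g ag hg] := quot_limit p0 w_low zD hG GS Cq0 A_le GA hM.
exists g; split=> //.
- by move=> x x1; exact: (limit_horowitz zD fE hM hg x1).
- have hgol := (analyticP g).1 ag.
  have gle (u : T) : D u -> ((density w p g u)%:E <= Cq%:E * average (density w p f) u)%E.
    move=> Du; have := limit_pow_le p0 w_low zD Cq0 A0 GA hg Du.
    rewrite -lee_fin [X in (_ <= X)%E -> _]EFinM -(AE _ Du).
    by rewrite (_ : (_, _) = u) //; case: (u).
  rewrite /bergman_norm_pow /disc_integral muleCA lee_pmul2l ?lte_fin //.
  rewrite -[leLHS]/(\int[m2]_(v in D) (density w p g v)%:E)%E -[X in (_ * X)%E]/J.
  apply: (@le_trans _ _ (Cq%:E * \int[m2]_(u in D) average (density w p f) u)%E).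
    rewrite -ge0_integralZl_EFin //; last 4 first.
    + exact: measurable_plane_disc.
    + by move=> u _; exact: average_ge0.
    + exact: measurable_average.
    + exact: ltW.
    apply: ge0_le_integral => //; first exact: measurable_plane_disc.
    + by move=> u Du; rewrite lee_fin (density_ge0 w_gt0).
    + by apply/measurable_EFinP; exact: measurable_density.
    + by apply: emeasurable_funM => //; exact: measurable_average.
  rewrite [(4 * Cq)%R]mulrC EFinM -muleA lee_wpmul2l ?lee_fin ?(ltW Cq0) //.
  exact: integral_average_le.
- by move=> b n m b1 fn om mn; exact: (limit_ord zD GS fE hM hg b1 fn om mn).
Qed.
End Division.

(** * Subsets of zero sets *)
Section SubsetsOfZeroSets.
Variable R : realType.
Local Notation C := R[i].
Implicit Types (f g : C -> C) (z : nat -> option C).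

(** Only the number of complementary occurrences matters, so any subset of A of the
    right size may serve as the complement of B. *)
Lemma card_complement (A B : set nat) n : (A #= `I_n)%card -> (B #<= A)%card ->
  exists E : set nat, exists j : nat,
    [/\ E `<=` A, (B #= `I_j)%card, (j <= n)%N & (E #= `I_(n - j))%card].
Proof.
move=> An BA; have fA : finite_set A by apply/finite_setP; exists n.
have /finite_setP[j Bj] : finite_set B := card_le_finite BA fA.
have /finite_fsetP[X AX] := fA; pose s := enum_fset X.
have us : uniq s by exact: fset_uniq.
have As : A = [set` s] by rewrite AX.
have sn : size s = n.
  by apply/card_eq_II; rewrite -(card_eql (card_seq us)) -As.
have jn : (j <= n)%N by rewrite -card_le_II -(card_le_eql Bj) -(card_le_eqr An).
exists [set` take (n - j) s], j; split=> //.
  by rewrite As => k /=; exact: mem_take.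
have := card_seq (take_uniq (n - j) us); rewrite size_takel // sn; exact: leq_subr.
Qed.

Lemma zero_subset_division (w : C -> R) (p : R) z z' : invariant_weight w -> 0 < p ->
  bergman_zero_set p w z -> subset_with_mult z' z -> bergman_zero_set p w z'.
Proof.
move=> hw p0 [f bf [zD zf]] sub; have [Cw Cw0 div] := horowitz_division hw.
have /choice[E hE] : forall a, exists E : set nat, unit_disc a -> exists n j,
    [/\ zero_order f a n, (occurrences z a #= `I_n)%card, E `<=` occurrences z a,
      (occurrences z' a #= `I_j)%card & (j <= n)%N /\ (E #= `I_(n - j))%card].
  move=> a; have [a1|na] := pselect (unit_disc a); last by exists set0.
  have [n zn on] := zf a a1; have [E [j [Es oj jn Ec]]] := card_complement on (sub a).
  by exists E => _; exists n, j.
(* Dividing f by the product over z2 leaves each point a with its multiplicity in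
   z'. *)
pose z2 k := if z k is Some a then if `[< E a k >] then Some a else None else None.
have z2E a : unit_disc a -> occurrences z2 a = E a.
  move=> a1; have [n [j [_ _ Es _ _]]] := hE a a1; apply/seteqP; split => k.
    rewrite /occurrences /= /z2; case: (z k) => [b|] //.
    by case: asboolP => // Ek [<-].
  by move=> Ek; have := Es k Ek; rewrite /occurrences /= /z2 => ->; rewrite asboolT.
have z2D : in_disc z2.
  move=> k a; rewrite /z2; case zk : (z k) => [b|] //; case: asboolP => // _ [<-].
  exact: zD zk.
have z2f : zero_subset f z2.
  split=> // a a1; have [n [j [fn on Es _ _]]] := hE a a1; exists n => //.
  by rewrite z2E // -(card_le_eqr on); exact: subset_card_le.
have nz : exists2 a, unit_disc a & f a != 0.
  have z1 := unit_disc0 R.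
  have [n fn _] := zf 0 z1.
  have [d [L [d0 _ [s s0 hs]]]] := zero_order_ord_at z1 fn.
  have [t t0 ts] : exists2 t : C, t != 0 & modulus t = Num.min s 1 / 2.
    by apply: small_mod; rewrite divr_gt0 // lt_min s0 ltr01.
  have mt : modulus t < Num.min s 1.
    by rewrite ts ltr_pdivrMr // ltr_pMr ?ltr1n // lt_min s0 ltr01.
  move: mt; rewrite lt_min => /andP[ts' t1]; have /andP[h _] := hs t ts' t0.
  exists (0 + t); first by rewrite add0r.
  by rewrite -mod_gt0; apply: lt_le_trans h; rewrite mulr_gt0 // exprn_gt0 // mod_gt0.
have [_ [g [ag _ ng gord]]] := div p f z2 p0 bf nz z2f.
exists g.
  split=> //; apply: (le_lt_trans ng); have [_ nf] := bf.
  by apply: lte_mul_pinfty; rewrite // lee_fin ltW.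
split=> [k a z'k|a a1].
  have : (occurrences z a !=set0).
    apply/set0P/eqP => z0; have := sub a; rewrite z0 => /card_le0P z'0.
    by have : occurrences z' a k by []; rewrite z'0.
  by move=> [i zi]; exact: zD zi.
have [n [j [fn on Es oj [jn Ec]]]] := hE a a1; exists j => //.
apply: ord_at_zero_order => //; rewrite -[j in ord_at _ _ j](subKn jn).
apply: gord => //; [exact: zero_order_ord_at|by rewrite z2E|exact: leq_subr].
Qed.
End SubsetsOfZeroSets.

Theorem theorem3p5 (R : realType) (w : R[i] -> R) (hw : invariant_weight w) :
  (exists2 C : R, 0 < C &
    forall (p : R) (f : R[i] -> R[i]) (z : nat -> option R[i]),
      0 < p -> in_bergman p w f ->
      (exists2 a : R[i], unit_disc a & f a != 0) ->
      zero_subset f z ->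
      (forall x : R[i], unit_disc x -> cvg (horowitz_partial z x @ \oo)) /\
      exists g : R[i] -> R[i],
        [/\ analytic_in_disc g,
            forall x : R[i], unit_disc x -> f x = g x * horowitz_product z x &
            (bergman_norm_pow p w g <= C%:E * bergman_norm_pow p w f)%E]) /\
  (forall (p : R) (z z' : nat -> option R[i]),
      0 < p -> bergman_zero_set p w z -> subset_with_mult z' z ->
      bergman_zero_set p w z').
Proof.
split; last by move=> p z z' p0; exact: zero_subset_division.
have [Cw Cw0 div] := horowitz_division hw; exists Cw => // p f z p0 bf nz zf.
have [cH [g [ag fgH ng _]]] := div p f z p0 bf nz zf.
by split=> //; exists g.
Qed.
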